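(* Let $\mathcal{H}=A_1^2(\mathbb{D})$ and for each $k\in\mathbb{N}=\{1,2,3,\ldots\}$ let $T_k$ be the bounded operator on $\mathcal{H}$ defined by $$(T_kf)(z)=k^{1/2}z^{k-1}f(z^k)\frac{1-z^k}{1-z},\qquad z\in\mathbb{D},\ f\in\mathcal{H}.$$ Then the von Neumann algebra generated by $T_{\mathbb{N}}=\{T_k:k\in\mathbb{N}\}$ in $B(\mathcal{H})$ is exactly $B(\mathcal{H})$.
   Context: $\mathbb{D}=\{z\in\mathbb{C}:|z|<1\}$ is the open unit disk. $dA=\pi^{-1}\,dx\,dy$ is the normalized area measure on $\mathbb{D}$, and $dA_1(z)=2(1-|z|^2)\,dA(z)$, a probability measure on $\mathbb{D}$. The weighted Bergman space $\mathcal{H}=A_1^2(\mathbb{D})$ is the Hilbert space of all analytic functions on $\mathbb{D}$ lying in $L^2(\mathbb{D},dA_1)$, with the inner product of $L^2(\mathbb{D},dA_1)$; for $f(z)=\sum_{n\ge 0}a_nz^n$ one has $\|f\|_2^2=\sum_{n\ge 0}\frac{2|a_n|^2}{(n+1)(n+2)}$. $B(\mathcal{H})$ is the algebra of all bounded linear operators on $\mathcal{H}$. A von Neumann algebra is a unital $*$-algebra of bounded operators on a Hilbert space that is closed in the weak operator topology; the one generated by a set of operators is the smallest von Neumann algebra containing that set. *)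

(* Defs.v *)
From HB Require Import structures.
From mathcomp Require Import all_boot all_order all_algebra.
From mathcomp Require Import complex.
From mathcomp Require Import all_classical all_reals all_analysis.
From mathcomp Require Import measurable_realfun ring.

Set Implicit Arguments.
Unset Strict Implicit.
Unset Printing Implicit Defensive.

Import Order.TTheory GRing.Theory Num.Theory.
Import numFieldNormedType.Exports.

Local Open Scope classical_set_scope.
Local Open Scope ring_scope.
Local Open Scope complex_scope.

(* [R[i]^o] is [R[i]] seen as a normed module over itself; this is the copy
   that carries the topology. *)

Section operator_algebras.
Variables (R : realType) (H : lmodType R[i]) (dot : H -> H -> R[i]).
Implicit Types (S T : H -> H) (M : set (H -> H)).

Definition hilbert_norm (f : H) : R := Num.sqrt (complex.Re (dot f f)).

Definition bounded_operators : set (H -> H) :=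
  [set T | linear T /\
    exists c : R, forall f, hilbert_norm (T f) <= c * hilbert_norm f].

Definition is_adjoint T S := forall f g, dot (T f) g = dot f (S g).

(* The coarsest topology making [T |-> dot (T f) g] continuous for all [f] and
   [g]; the weak operator topology of [bounded_operators] is the topology that
   it induces on that set. *)
Definition weak_operator_topology :=
  initial_topology (fun T => (fun fg => dot (T fg.1) fg.2)
    : prod_topology (fun _ : H * H => R[i]^o)).

(* The adjoint of a bounded operator on a Hilbert space is bounded, and it is
   unique, so quantifying over all the bounded [S] with [is_adjoint T S] is
   closure under the involution. *)
Definition von_neumann_algebra M :=
  [/\ M `<=` bounded_operators,
      M id /\
      (forall (a : R[i]) S T, M S -> M T -> M (a *: S + T)),
      (forall S T, M S -> M T -> M (S \o T)),
      (forall T S, M T -> bounded_operators S -> is_adjoint T S -> M S) &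
      bounded_operators `&` closure (M : set weak_operator_topology) `<=` M].

Definition generated_von_neumann_algebra (G : set (H -> H)) : set (H -> H) :=
  smallest von_neumann_algebra G.

End operator_algebras.

Section bergman_space.
Variable R : realType.
Implicit Types (f g : R[i] -> R[i]^o) (p : R * R).

Definition unit_disk : set R[i] := [set z | `|z| < 1].

Definition analytic_on (U : set R[i]) f := forall z0, U z0 ->
  exists a : nat -> R[i], \forall z \near (z0 : R[i]^o),
    series (fun n => a n * (z - z0) ^+ n : R[i]^o) @ \oo --> f z.

Definition xy_to_C p : R[i] := p.1 +i* p.2.

Definition unit_disk2 : set (R * R) := xy_to_C @^-1` unit_disk.

Local Notation area := ((@lebesgue_measure R) \x (@lebesgue_measure R))%E.

(* The density of [dA_1] with respect to [dx dy]. *)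
Definition weight p : R := pi^-1 * (2 * (1 - (p.1 ^+ 2 + p.2 ^+ 2))).

(* [\int_D h dA_1] for a complex-valued [h]. *)
Definition integral_A1 (h : R[i] -> R[i]) : R[i] :=
  (\int[area]_(p in unit_disk2) (complex.Re (h (xy_to_C p)) * weight p)) +i*
  (\int[area]_(p in unit_disk2) (complex.Im (h (xy_to_C p)) * weight p)).

Definition abs2 (z : R[i]) : R := complex.Re z ^+ 2 + complex.Im z ^+ 2.

Definition L2_A1 f :=
  [/\ measurable_fun unit_disk2 (fun p => complex.Re (f (xy_to_C p))),
      measurable_fun unit_disk2 (fun p => complex.Im (f (xy_to_C p))) &
      (\int[area]_(p in unit_disk2)
         (abs2 (f (xy_to_C p)) * weight p)%:E < +oo)%E].

(* A function on the disk is represented by its extension by 0 to [R[i]], so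
   that equality in the space is Leibniz equality. *)
Definition bergman_fun : {pred R[i] -> R[i]^o} :=
  mem [set f : R[i] -> R[i]^o |
    [/\ forall z, ~ unit_disk z -> f z = 0,
        analytic_on unit_disk f & L2_A1 f]].

Lemma unit_disk2E p : unit_disk2 p <-> p.1 ^+ 2 + p.2 ^+ 2 < 1.
Proof.
rewrite /unit_disk2 /unit_disk /xy_to_C /= normc_def /= ltcR.
by rewrite -[X in _ < X]sqrtr1 ltr_sqrt // -sqrtr1.
Qed.

Lemma measurable_unit_disk2 : measurable unit_disk2.
Proof.
rewrite (_ : unit_disk2 =
    (fun p : R * R => p.1 ^+ 2 + p.2 ^+ 2) @^-1` `]-oo, 1[%classic).
  rewrite -[X in measurable X]setTI.
  apply: (@measurable_funD _ _ _ _ (fun p : R * R => p.1 ^+ 2)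
    (fun p : R * R => p.2 ^+ 2)) => //;
  by apply: measurable_funX.
by apply/seteqP; split => p; rewrite /= in_itv /= => /unit_disk2E.
Qed.

Lemma weight_ge0 p : unit_disk2 p -> 0 <= weight p.
Proof.
move=> /unit_disk2E p1; rewrite /weight mulr_ge0 ?invr_ge0 ?pi_ge0 //.
by rewrite mulr_ge0 // subr_ge0 ltW.
Qed.

Lemma abs2_ge0 z : 0 <= abs2 z.
Proof. by rewrite addr_ge0 ?sqr_ge0. Qed.

Lemma measurable_weight : measurable_fun unit_disk2 weight.
Proof.
apply: measurable_funM => //; apply: measurable_funM => //.
apply: measurable_funB => //.
by apply: measurable_funD; apply: measurable_funX;
  apply: measurable_funS (@subsetT _ _) _ => //.
Qed.

Lemma measurable_abs2 f :
  measurable_fun unit_disk2 (fun p => complex.Re (f (xy_to_C p))) ->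
  measurable_fun unit_disk2 (fun p => complex.Im (f (xy_to_C p))) ->
  measurable_fun unit_disk2 (fun p => abs2 (f (xy_to_C p))).
Proof. by move=> mr mi; apply: measurable_funD; apply: measurable_funX. Qed.

Lemma abs2_lin a (x y : R[i]) :
  abs2 (a * x + y) <= (2 * abs2 a) * abs2 x + 2 * abs2 y.
Proof.
case: a => a b; case: x => x x'; case: y => y y'; rewrite /abs2 /=.
rewrite -subr_ge0 [leRHS](_ : _ = (a * x - b * x' - y) ^+ 2 +
   (a * x' + b * x - y') ^+ 2); last by ring.
by rewrite addr_ge0 ?sqr_ge0.
Qed.

Lemma analytic_on_lin (U : set R[i]) a f g :
  analytic_on U f -> analytic_on U g -> analytic_on U (a *: f + g).
Proof.
move=> af ag z Uz; have [u fu] := af z Uz; have [v gv] := ag z Uz.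
exists (fun n => a * u n + v n).
apply: filterS2 fu gv => w fw gw.
rewrite (_ : series _ =
    a \*: series (fun n => u n * (w - z) ^+ n : R[i]^o) \+
    series (fun n => v n * (w - z) ^+ n : R[i]^o)).
  exact: cvgD (cvgZl_tmp fw) gw.
apply/funext => n; rewrite /series /= scaler_sumr -big_split /=.
by apply: eq_bigr => m _; rewrite mulrDl -mulrA.
Qed.

Lemma L2_A1_lin a f g : L2_A1 f -> L2_A1 g -> L2_A1 (a *: f + g).
Proof.
move=> [rf jf sf] [rg jg sg].
have D p : (a *: f + g) (xy_to_C p) = a * f (xy_to_C p) + g (xy_to_C p) by [].
have rD : measurable_fun unit_disk2
    (fun p => complex.Re ((a *: f + g) (xy_to_C p))).
  rewrite (_ : (fun _ => _) = fun p =>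
    complex.Re a * complex.Re (f (xy_to_C p)) -
    complex.Im a * complex.Im (f (xy_to_C p)) + complex.Re (g (xy_to_C p))).
    by apply: measurable_funD => //; apply: measurable_funB;
      apply: measurable_funM.
  apply/funext => p; rewrite D; case: a {D} => ? ?.
  by case: (f _) => ? ?; case: (g _).
have jD : measurable_fun unit_disk2
    (fun p => complex.Im ((a *: f + g) (xy_to_C p))).
  rewrite (_ : (fun _ => _) = fun p =>
    complex.Re a * complex.Im (f (xy_to_C p)) +
    complex.Im a * complex.Re (f (xy_to_C p)) + complex.Im (g (xy_to_C p))).
    by apply: measurable_funD => //; apply: measurable_funD;
      apply: measurable_funM.
  apply/funext => p; rewrite D; case: a {D rD} => ? ?.
  by case: (f _) => ? ?; case: (g _).
split => //.
pose F h p := (abs2 (h (xy_to_C p)) * weight p)%:E.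
have F0 h p : unit_disk2 p -> (0 <= F h p)%E.
  by move=> Dp; rewrite lee_fin mulr_ge0 ?abs2_ge0 ?weight_ge0.
have mF h : measurable_fun unit_disk2 (fun p => abs2 (h (xy_to_C p))) ->
    measurable_fun unit_disk2 (F h).
  move=> mh; apply/measurable_EFinP; apply: measurable_funM => //.
  exact: measurable_weight.
have mFf : measurable_fun unit_disk2 (F f) by apply: mF; apply: measurable_abs2.
have mFg : measurable_fun unit_disk2 (F g) by apply: mF; apply: measurable_abs2.
have mD := measurable_unit_disk2.
have c0 : 0 <= 2 * abs2 a by rewrite mulr_ge0 ?abs2_ge0.
apply: (@le_lt_trans _ _ (\int[area]_(p in unit_disk2)
    ((2 * abs2 a)%:E * F f p + 2%:E * F g p))%E).
  apply: ge0_le_integral => //.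
  - exact: F0.
  - by apply: mF; apply: measurable_abs2.
  - by apply: emeasurable_funD; apply: measurable_funeM.
  - move=> p Dp; rewrite /F -!EFinM -EFinD lee_fin.
    rewrite [_ * (_ * weight p)]mulrA [2 * (_ * weight p)]mulrA -mulrDl.
    by rewrite ler_wpM2r ?weight_ge0 // D abs2_lin.
rewrite ge0_integralD //; last 4 first.
- by move=> p Dp; rewrite mule_ge0 ?F0 ?lee_fin.
- by apply: measurable_funeM.
- by move=> p Dp; rewrite mule_ge0 ?F0 ?lee_fin.
- by apply: measurable_funeM.
rewrite !ge0_integralZl_EFin //; try exact: F0.
by apply: lte_add_pinfty; apply: lte_mul_pinfty; rewrite ?lee_fin.
Qed.

Lemma bergman_fun_submod_closed : submod_closed bergman_fun.
Proof.
split=> [|a f g].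
  rewrite inE; split=> [//|z _|].
    exists (fun=> 0); near=> w.
    rewrite (_ : series _ = fun=> 0); first exact: cvg_cst.
    by apply/funext => n; rewrite /series /= big1 // => i _; rewrite mul0r.
  split=> /=; [exact: measurable_cst|exact: measurable_cst|].
  rewrite (eq_integral (cst 0%E)) ?integral0 // => p _.
  by rewrite /abs2 /= !expr0n /= addr0 mul0r.
rewrite !inE => -[f0 fA fL] [g0 gA gL]; split.
- by move=> z Dz; rewrite /= !fctE f0 // g0 // scaler0 addr0.
- exact: analytic_on_lin.
- exact: L2_A1_lin.
Unshelve. all: by end_near.
Qed.

HB.instance Definition _ :=
  GRing.isSubmodClosed.Build R[i] (R[i] -> R[i]^o) bergman_fun
    bergman_fun_submod_closed.

Definition bergman := {f | f \in bergman_fun}.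
HB.instance Definition _ := SubType.on bergman.
HB.instance Definition _ := Choice.on bergman.
HB.instance Definition _ := [SubChoice_isSubLmodule of bergman by <:].

Definition bergman_dot (f g : bergman) : R[i] :=
  integral_A1 (fun z => val f z * (val g z)^*).

Definition dilation (k : nat) f (z : R[i]) : R[i] :=
  (Num.sqrt k%:R)%:C * z ^+ k.-1 * f (z ^+ k) * ((1 - z ^+ k) / (1 - z)).

End bergman_space.

(* Main.v *)
(* In terms of Taylor coefficients, A^2_1 is the weighted l^2 space with
   ||z^(m-1)||^2 proportional to 1/m - 1/(m+1), and T_k sends the indicator of
   the index m >= 1 to sqrt k times the indicator of the block [km, km+k);
   telescoping shows that T_k is an isometry.  An index m >= 2 is the
   difference of two unions of blocks, {m} = [m, m(m+1)) - [m+1, m(m+1)), so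
   the ranges of the T_k with k >= 2 span the orthogonal complement of the
   constants.  The products W_n of the contractions
   1 - sum_(2 <= k < n+2) 2^(1-k) T_k T_k^* fix the constants, and their energy
   balance forces T_k^* W_n f -> 0 for k >= 2; hence W_n tends weakly to the
   projection on the constants, which lies in the algebra.  Finally
   T_2^* T_(n+1) 1 is a polynomial of exact degree n-1, so the algebra contains
   all rank one operators between monomials, and is dense.

   That functions of the space are power series on the whole disk is proved
   without contour integrals: orthogonality of the monomials on disks (rotation
   invariance of area) gives Parseval's identity and from it Cauchy's estimates,
   and if the Taylor series represented f only up to a radius rho < 1, uniform
   bounds C(m,n) |a_m| rho^(m-n) d^n <= const * m for the re-expansions at the
   points of the closed disk of radius rho would give, after summation over n,
   a radius of convergence of at least rho + d. *)

Require Import Defs.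
From HB Require Import structures.
From mathcomp Require Import all_boot all_order all_algebra.
From mathcomp Require Import complex.
From mathcomp Require Import all_classical all_reals all_analysis.
From mathcomp Require Import measurable_realfun ring lra zify.

Set Implicit Arguments.
Unset Strict Implicit.
Unset Printing Implicit Defensive.

Import Order.TTheory GRing.Theory Num.Theory.
Import numFieldNormedType.Exports.
Import ComplexField.Normc.

Local Open Scope classical_set_scope.
Local Open Scope ring_scope.
Local Open Scope complex_scope.

(** * Limits in the complex numbers *)

(** The algebra is reached through weakly convergent sequences, never through commutants. This
    shapes [damped]: the averages of [T_k T_k^*] are truncated at a stage that grows with [n], so
    that each [damped n] is a finite expression in the generators while every [k >= 2] acts at all
    but finitely many stages. The weights have total at most 1, so the squared norm of such an
    average is at most its inner product with the vector; half of the cross term in the energy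
    balance pays for it, and the other half is a loss that telescopes over the stages. The analytic
    half has to turn an area integral in Cartesian coordinates into a sum over coefficients. Two
    kinds of symmetries are enough: shears, which compose to one rotation of infinite order with
    rational entries and give orthogonality, and dilations, which determine all moments up to the
    common positive factor [kappa]. The operators and their adjoints are built on coefficients, each
    with its own norm bound; [val_T] alone returns to values on the disk. *)

Section complex_limits.
Variable R : realType.
Implicit Types (u v : nat -> R[i]) (z l : R[i]).

Lemma normc_ge0 z : 0 <= normc z.
Proof. by case: z => x y; rewrite /= sqrtr_ge0. Qed.

Lemma norm_normc z : `|z| = (normc z)%:C.
Proof. by case: z. Qed.

Lemma normcX z n : normc (z ^+ n) = normc z ^+ n.
Proof.
by elim: n => [|n IH]; rewrite ?expr0 ?normc1 // !exprS normcM IH.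
Qed.

Lemma normc_sq z : normc z ^+ 2 = abs2 z.
Proof. by case: z => x y; rewrite /= sqr_sqrtr // addr_ge0 ?sqr_ge0. Qed.

Lemma normc_real (x : R) : normc x%:C = `|x|.
Proof. by rewrite /= expr0n /= addr0 sqrtr_sqr. Qed.

Lemma normc_conj z : normc (z^*) = normc z.
Proof. by case: z => x y; rewrite /= sqrrN. Qed.

Lemma conjD z l : conjc (z + l) = conjc z + conjc l.
Proof. exact: rmorphD. Qed.

Lemma conjB z l : conjc (z - l) = conjc z - conjc l.
Proof. exact: rmorphB. Qed.

Lemma conjM z l : conjc (z * l) = conjc z * conjc l.
Proof. exact: rmorphM. Qed.

Lemma conj_sum I (r : seq I) (F : I -> R[i]) :
  conjc (\sum_(i <- r) F i) = \sum_(i <- r) conjc (F i).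
Proof. exact: rmorph_sum. Qed.

Lemma abs2M z l : abs2 (z * l) = abs2 z * abs2 l.
Proof. by rewrite -!normc_sq normcM exprMn. Qed.

Lemma normc_sum I (r : seq I) (P : pred I) (F : I -> R[i]) :
  normc (\sum_(i <- r | P i) F i) <= \sum_(i <- r | P i) normc (F i).
Proof.
elim/big_rec2 : _ => [|i x y _ le]; first by rewrite normc0.
by rewrite (le_trans (le_normcD _ _)) // lerD2l.
Qed.

Lemma normcB z l : normc (z - l) = normc (l - z).
Proof. by rewrite -normcN opprB. Qed.

Lemma normc_triangleB z l : `|normc z - normc l| <= normc (z - l).
Proof.
rewrite ler_norml; apply/andP; split.
  rewrite lerNl opprB lerBlDr normcB; apply: le_trans (le_normcD _ _).
  by rewrite subrK.
by rewrite lerBlDr; apply: le_trans (le_normcD _ _); rewrite subrK.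
Qed.

(** Convergence is phrased as a real limit so that squeezing and order arguments apply; [ccvgP]
    translates to the topology in which analyticity is stated. *)
Definition ccvg u l := (fun n => normc (u n - l)) @ \oo --> (0 : R).

Lemma ccvgP (u : nat -> R[i]^o) (l : R[i]^o) : (u @ \oo --> l) <-> ccvg u l.
Proof.
split => H.
  apply/cvgrPdist_lt => e e0.
  have /cvgrPdist_lt /(_ (e%:C)) := H; rewrite ltcR => /(_ e0).
  apply: filterS => n; rewrite norm_normc ltcR sub0r normrN normcB.
  by rewrite ger0_norm ?normc_ge0.
(* A positive element of [R[i]] is real, so the imaginary part of the tolerance disappears. *)
apply/cvgrPdist_lt => -[e e'] /=; rewrite ltcE /= => /andP[/eqP-> e0].
have /cvgrPdist_lt /(_ _ e0) := H.
apply: filterS => n; rewrite sub0r normrN ger0_norm ?normc_ge0 //.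
by rewrite norm_normc normcB complexr0 ltcR.
Qed.

Lemma ccvg_squeeze u l (e : nat -> R) :
  (forall n, normc (u n - l) <= e n) -> e @ \oo --> (0 : R) -> ccvg u l.
Proof.
move=> le e0; apply: squeeze_cvgr (@cvg_cst _ _ _ _ _) e0.
by near=> n; rewrite normc_ge0 le.
Unshelve. all: by end_near. Qed.

Lemma eq_ccvg u v l : u =1 v -> ccvg u l -> ccvg v l.
Proof. by move=> /funext ->. Qed.

Lemma ccvg_cst l : ccvg (fun=> l) l.
Proof. by rewrite /ccvg; under eq_cvg do rewrite subrr normc0;
  exact: cvg_cst. Qed.

Lemma ccvgD u v l l' : ccvg u l -> ccvg v l' ->
  ccvg (fun n => u n + v n) (l + l').
Proof.
move=> ul vl; apply: (ccvg_squeeze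
  (e := fun n => normc (u n - l) + normc (v n - l'))) => [n|].
  by rewrite opprD addrACA le_normcD.
by rewrite -[0]addr0; apply: cvgD.
Qed.

Lemma ccvgZ z u l : ccvg u l -> ccvg (fun n => z * u n) (z * l).
Proof.
move=> H; apply: (ccvg_squeeze (e := fun n => normc z * normc (u n - l))).
  by move=> n; rewrite -mulrBr normcM.
by rewrite -[0](mulr0 (normc z)); apply: cvgM H; exact: cvg_cst.
Qed.

Lemma ccvgB u v l l' : ccvg u l -> ccvg v l' ->
  ccvg (fun n => u n - v n) (l - l').
Proof.
move=> ul vl; rewrite -mulN1r; under [X in ccvg X]eq_fun do rewrite -mulN1r.
by apply: ccvgD => //; exact: ccvgZ.
Qed.

Lemma ccvg_sum I (r : seq I) (F : I -> nat -> R[i]) (L : I -> R[i]) :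
  (forall i, ccvg (F i) (L i)) ->
  ccvg (fun n => \sum_(i <- r) F i n) (\sum_(i <- r) L i).
Proof.
move=> H; elim: r => [|i r IH].
  by rewrite big_nil; under [X in ccvg X]eq_fun do rewrite big_nil;
    exact: ccvg_cst.
by rewrite big_cons; under [X in ccvg X]eq_fun do rewrite big_cons;
  exact: ccvgD.
Qed.

Lemma ccvg_normc u l : ccvg u l -> (fun n => normc (u n)) @ \oo --> normc l.
Proof.
move=> H; apply/cvgrPdist_lt => e e0.
have /cvgrPdist_lt /(_ _ e0) := H.
apply: filterS => n; rewrite sub0r normrN ger0_norm ?normc_ge0 // => lt.
by apply: le_lt_trans lt; rewrite distrC normc_triangleB.
Qed.

Lemma Re_le_normc z : `|complex.Re z| <= normc z.
Proof.
by case: z => x y /=; rewrite -sqrtr_sqr ler_wsqrtr // lerDl sqr_ge0.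
Qed.

Lemma Im_le_normc z : `|complex.Im z| <= normc z.
Proof.
by case: z => x y /=; rewrite -sqrtr_sqr ler_wsqrtr // lerDr sqr_ge0.
Qed.

Lemma normc_le_ReIm z : normc z <= `|complex.Re z| + `|complex.Im z|.
Proof.
case: z => x y; rewrite (_ : x +i* y = x%:C + 0 +i* y); last first.
  by rewrite /= /real_complex_def; congr Complex; rewrite ?addr0 ?add0r.
rewrite (le_trans (le_normcD _ _)) // normc_real.
by rewrite /= expr0n /= add0r sqrtr_sqr addr0 add0r.
Qed.

Lemma ReB z l : complex.Re (z - l) = complex.Re z - complex.Re l.
Proof. by case: z; case: l. Qed.

Lemma ImB z l : complex.Im (z - l) = complex.Im z - complex.Im l.
Proof. by case: z; case: l. Qed.

Lemma ccvg_Re u l : ccvg u l ->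
  (fun n => complex.Re (u n)) @ \oo --> complex.Re l.
Proof.
move=> H; apply/cvgrPdist_lt => e e0.
have /cvgrPdist_lt /(_ _ e0) := H.
apply: filterS => n; rewrite sub0r normrN ger0_norm ?normc_ge0 // => lt.
by apply: le_lt_trans lt; rewrite distrC -ReB Re_le_normc.
Qed.

Lemma ccvg_Im u l : ccvg u l ->
  (fun n => complex.Im (u n)) @ \oo --> complex.Im l.
Proof.
move=> H; apply/cvgrPdist_lt => e e0.
have /cvgrPdist_lt /(_ _ e0) := H.
apply: filterS => n; rewrite sub0r normrN ger0_norm ?normc_ge0 // => lt.
by apply: le_lt_trans lt; rewrite distrC -ImB Im_le_normc.
Qed.

Lemma ccvg_ReIm u l :
  (fun n => complex.Re (u n)) @ \oo --> complex.Re l ->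
  (fun n => complex.Im (u n)) @ \oo --> complex.Im l -> ccvg u l.
Proof.
move=> re im; apply: (@ccvg_squeeze _ _ (fun n =>
  `|complex.Re (u n) - complex.Re l| + `|complex.Im (u n) - complex.Im l|)).
  by move=> n; rewrite -ReB -ImB normc_le_ReIm.
rewrite -[0]addr0; apply: cvgD.
  rewrite -(normr0 R) -(subrr (complex.Re l)).
  by apply: cvg_norm; apply: cvgB => //; exact: cvg_cst.
rewrite -(normr0 R) -(subrr (complex.Im l)).
by apply: cvg_norm; apply: cvgB => //; exact: cvg_cst.
Qed.

Lemma ccvg_unique u l l' : ccvg u l -> ccvg u l' -> l = l'.
Proof.
move=> h1 h2; apply/eqP; rewrite eq_complex.
rewrite (cvg_unique _ (ccvg_Re h1) (ccvg_Re h2)) //.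
by rewrite (cvg_unique _ (ccvg_Im h1) (ccvg_Im h2)) // !eqxx.
Qed.

Lemma ccvg_le u l B : ccvg u l -> (forall n, normc (u n) <= B) -> normc l <= B.
Proof.
by move=> /ccvg_normc H le; apply: (cvgr_to_le H); exact: nearW.
Qed.

Lemma ccvg_subseq u l (k : nat -> nat) : (forall n, (n <= k n)%N) ->
  ccvg u l -> ccvg (u \o k) l.
Proof.
move=> nk H; apply/cvgrPdist_lt => e e0.
have /cvgrPdist_lt /(_ _ e0) [N _ HN] := H.
by exists N => // n /= Nn; apply: HN => /=; rewrite (leq_trans Nn).
Qed.

Lemma cvg_sum_seq I (r : seq I) (F : I -> nat -> R) (L : I -> R) :
  (forall i, F i @ \oo --> L i) ->
  (fun n => \sum_(i <- r) F i n) @ \oo --> \sum_(i <- r) L i.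
Proof.
move=> H; elim: r => [|i r IH].
  by rewrite big_nil; under eq_cvg do rewrite big_nil; exact: cvg_cst.
by rewrite big_cons; under eq_cvg do rewrite big_cons; exact: cvgD.
Qed.

(** Used to let radii tend to 1 from below inside expressions that are polynomial in the radius. *)
Lemma unit_seq : exists q : nat -> R, (forall k, 0 < q k < 1) /\
  forall i, (fun k => q k ^+ i) @ \oo --> (1 : R).
Proof.
pose q (k : nat) : R := 1 - k.+2%:R^-1.
have cq : q @ \oo --> (1 : R).
  rewrite -[X in _ --> X]subr0; apply: cvgB; first exact: cvg_cst.
  by have := @cvg_harmonic R; rewrite -(cvg_shiftS (@harmonic R)).
exists q; split.
  by move=> k; rewrite subr_gt0 invf_lt1 // ltr1n gtrBl invr_gt0 ltr0Sn.
move=> i; rewrite -(expr1n _ i).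
elim: i => [|i IH]; first exact: cvg_cst.
by rewrite exprS; under eq_cvg do rewrite exprS; exact: cvgM.
Qed.

Lemma Re_sum I (r : seq I) (P : pred I) (F : I -> R[i]) :
  complex.Re (\sum_(i <- r | P i) F i) = \sum_(i <- r | P i) complex.Re (F i).
Proof. by elim/big_rec2 : _ => // i x y _ <-; case: (F i); case: y. Qed.

Lemma Im_sum I (r : seq I) (P : pred I) (F : I -> R[i]) :
  complex.Im (\sum_(i <- r | P i) F i) = \sum_(i <- r | P i) complex.Im (F i).
Proof. by elim/big_rec2 : _ => // i x y _ <-; case: (F i); case: y. Qed.

Definition csum u l := ccvg (fun n => \sum_(0 <= k < n) u k) l.

Lemma abs_summable_csum u : cvgn (series (fun n => normc (u n))) ->
  exists l, csum u l.
Proof.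
move=> cu.
have re : cvgn (series (fun n => complex.Re (u n))).
  apply: normed_cvg; apply: series_le_cvg cu => n /=.
  - exact: normr_ge0.
  - exact: normc_ge0.
  - exact: Re_le_normc.
have im : cvgn (series (fun n => complex.Im (u n))).
  apply: normed_cvg; apply: series_le_cvg cu => n /=.
  - exact: normr_ge0.
  - exact: normc_ge0.
  - exact: Im_le_normc.
exists (limn (series (fun n => complex.Re (u n))) +i*
        limn (series (fun n => complex.Im (u n)))).
apply: ccvg_ReIm => /=.
  rewrite (_ : (fun n => _) = series (fun n => complex.Re (u n))) //.
  by apply/funext => n; rewrite /series /= Re_sum.
rewrite (_ : (fun n => _) = series (fun n => complex.Im (u n))) //.
by apply/funext => n; rewrite /series /= Im_sum.
Qed.

Lemma csum_bounded u l : csum u l -> exists B, forall n, normc (u n) <= B.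
Proof.
move=> H; have H' : ccvg (fun n => \sum_(0 <= k < n.+1) u k) l.
  by apply: (ccvg_subseq (k := succn)) H => n; exact: leqnSn.
have := ccvg_normc (ccvgB H' H); rewrite subrr normc0 => /cvgP.
move=> /cvg_seq_bounded [B [_ /(_ (B + 1))]]; rewrite ltrDl ltr01 =>
  /(_ isT) HB.
exists (B + 1) => n; have := HB n I => /=.
by rewrite ger0_norm ?normc_ge0 // big_nat_recr //= addrAC subrr add0r.
Qed.

End complex_limits.

(** * Power series *)

Section power_series.
Variable R : realType.
Implicit Types (a b : nat -> R[i]) (z h l : R[i]) (r s t B : R).

Definition psums a z l :=
  csum (fun n => a n * z ^+ n) l.

Lemma psums_unique a z l l' : psums a z l -> psums a z l' -> l = l'.
Proof. exact: ccvg_unique. Qed.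

Lemma psums_bounded a z l : psums a z l ->
  exists B, forall n, normc (a n) * normc z ^+ n <= B.
Proof.
by move=> /csum_bounded[B HB]; exists B => n; rewrite -normcX -normcM.
Qed.

(** Abel's lemma, by comparison with the geometric series of ratio [r / s]. *)
Lemma bounded_summable (x : nat -> R) r s B : (forall n, 0 <= x n) ->
  0 <= r -> r < s -> (forall n, x n * s ^+ n <= B) ->
  cvgn (series (fun n => x n * r ^+ n)).
Proof.
move=> x0 r0 rs HB; have s0 : 0 < s by apply: le_lt_trans rs.
apply: (@series_le_cvg _ _ (geometric B (r / s))).
- by move=> n; rewrite mulr_ge0 // exprn_ge0.
- move=> n; rewrite /= mulr_ge0 //;
    last by rewrite exprn_ge0 // divr_ge0 // ltW.
  by apply: le_trans _ (HB 0%N); rewrite mulr_ge0 // exprn_ge0 // ltW.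
- move=> n; rewrite /= expr_div_n mulrA mulrAC.
  rewrite ler_wpM2r ?exprn_ge0 // ler_pdivlMr ?exprn_gt0 //.
apply: is_cvg_geometric_series.
by rewrite ger0_norm ?ltr_pdivrMr ?mul1r // divr_ge0 // ltW.
Qed.

Lemma summable_psums a z r : normc z <= r ->
  cvgn (series (fun n => normc (a n) * r ^+ n)) -> exists l, psums a z l.
Proof.
move=> zr H; apply: abs_summable_csum; apply: series_le_cvg H => n.
- exact: normc_ge0.
- by rewrite mulr_ge0 ?normc_ge0 // exprn_ge0 // (le_trans _ zr) // normc_ge0.
- by rewrite normcM normcX ler_wpM2l ?normc_ge0 // lerXn2r // ?nnegrE
    ?(le_trans _ zr) // normc_ge0.
Qed.

(** With [q = r / s], each of the [n.+1] copies of [q ^+ n] is at most a term of the geometric sum,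
    so [n.+1%:R * q ^+ n] stays below [(1 - q)^-1]. A linear factor thus costs only an arbitrarily
    small loss of radius. *)
Lemma linear_growth_bounded (x : nat -> R) r s B : (forall n, 0 <= x n) ->
  0 <= r -> r < s -> (forall n, x n * s ^+ n <= n.+1%:R * B) ->
  exists B', forall n, x n * r ^+ n <= B'.
Proof.
move=> x0 r0 rs HB; have s0 : 0 < s by apply: le_lt_trans rs.
have B0 : 0 <= B.
  by have := HB 0%N; rewrite mul1r; apply: le_trans;
    rewrite mulr_ge0 // exprn_ge0 // ltW.
pose q := r / s; have q0 : 0 <= q by rewrite divr_ge0 // ltW.
have q1 : q < 1 by rewrite ltr_pdivrMr // mul1r.
have Hq n : n.+1%:R * q ^+ n <= (1 - q)^-1.
  rewrite -[leRHS]mul1r ler_pdivlMr ?subr_gt0 //.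
  apply: (@le_trans _ _ ((\sum_(i < n.+1) q ^+ i) * (1 - q))).
    rewrite ler_wpM2r ?subr_ge0 ?(ltW q1) // mulr_natl -[in leLHS](card_ord
      n.+1) -sumr_const.
    by apply: ler_sum => i _; rewrite ler_wiXn2l // ?(ltW q1) // -ltnS.
  by rewrite mulrC -opprB mulNr -subrX1 opprB gerBl exprn_ge0.
exists ((1 - q)^-1 * B) => n.
have -> : r ^+ n = s ^+ n * q ^+ n.
  by rewrite -exprMn /q mulrCA divff ?mulr1 // gt_eqF.
rewrite mulrA (le_trans (ler_wpM2r (exprn_ge0 n q0) (HB n))) //.
by rewrite mulrAC ler_wpM2r.
Qed.

Lemma binomial_partial_sum_le m n r s : 0 <= r -> 0 <= s ->
  \sum_(0 <= k < n) (r ^+ (m - k) * s ^+ k) *+ 'C(m, k) <= (r + s) ^+ m.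
Proof.
move=> r0 s0.
have p k : 0 <= (r ^+ (m - k) * s ^+ k) *+ 'C(m, k).
  by rewrite mulrn_wge0 // mulr_ge0 ?exprn_ge0.
rewrite exprDn -(big_mkord xpredT (fun k =>
  (r ^+ (m - k) * s ^+ k) *+ 'C(m, k))).
case: (leqP n m.+1) => nm.
  by rewrite (big_cat_nat (leq0n _) nm) //= lerDl sumr_ge0.
rewrite (big_cat_nat (leq0n _) (ltnW nm)) //= gerDl big_nat_cond big1 // => k.
by rewrite andbT => /andP[mk _]; rewrite bin_small.
Qed.

(** The contribution of [a m] to the [n]-th Taylor coefficient at [z], that is, to the [n]-th
    derivative at [z] divided by [n!]; it vanishes for [m < n]. *)
Definition reexp a z n m := (a m * z ^+ (m - n)) *+ 'C(m, n).

(** Rearrangement of a double series, carried out on finite rectangles. The coefficient bound holds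
    for every [B] above the partial sums, so that one [B] can serve many centres [z]. *)
Lemma power_series_reexpansion a z t : 0 < t ->
  cvgn (series (fun m => normc (a m) * (normc z + t) ^+ m)) ->
  exists b, [/\ forall n, csum (reexp a z n) (b n),
    forall B, (forall N, \sum_(0 <= m < N) normc (a m) * (normc z + t) ^+ m <=
      B) ->
      forall n, normc (b n) * t ^+ n <= B &
    forall h l, normc h <= t -> psums a (z + h) l -> psums b h l].
Proof.
move=> t0 cA; set L := limn (series (fun m =>
  normc (a m) * (normc z + t) ^+ m)).
have zt0 : 0 <= normc z + t by rewrite addr_ge0 ?normc_ge0 // ltW.
have A0 m : 0 <= normc (a m) * (normc z + t) ^+ m.
  by rewrite mulr_ge0 ?normc_ge0 // exprn_ge0.
have leL N : \sum_(0 <= m < N) normc (a m) * (normc z + t) ^+ m <= L.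
  apply: nondecreasing_cvgn_le cA N; apply/nondecreasing_seqP => n.
  by rewrite -subr_ge0 seriesSB.
have key n m : normc (reexp a z n m) * t ^+ n <=
    normc (a m) * (normc z + t) ^+ m.
  rewrite /reexp -mulr_natr !normcM normcX.
  have -> : normc ('C(m, n)%:R : R[i]) = 'C(m, n)%:R.
    by rewrite -(rmorph_nat (real_complex R)) normc_real ger0_norm.
  rewrite -!mulrA ler_wpM2l ?normc_ge0 //.
  have := binomial_partial_sum_le m n.+1 (normc_ge0 z) (ltW t0).
  rewrite big_nat_recr //=; apply: le_trans;
    rewrite -[X in _ <= _ + X]mulr_natr.
  rewrite [_%:R * _]mulrC mulrA lerDr sumr_ge0 // => k _.
  by rewrite mulrn_wge0 // mulr_ge0 ?exprn_ge0 ?normc_ge0 // ltW.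
have cb n : exists l, csum (reexp a z n) l.
  apply: abs_summable_csum.
  apply: (@series_le_cvg _ _ (fun m =>
    t ^- n * (normc (a m) * (normc z + t) ^+ m))).
  - by move=> m; exact: normc_ge0.
  - by move=> m; rewrite mulr_ge0 // invr_ge0 exprn_ge0 // ltW.
  - by move=> m; rewrite mulrC ler_pdivlMr ?exprn_gt0.
  - exact: is_cvg_seriesZ.
have [b Hb] := choice cb; exists b; split => //.
  move=> B HB n; rewrite -ler_pdivlMr ?exprn_gt0 //.
  apply: (ccvg_le (Hb n)) => N; rewrite ler_pdivlMr ?exprn_gt0 //.
  rewrite (le_trans _ (HB N)) // (le_trans (ler_wpM2r _ (normc_sum _ _ _))) //.
    by rewrite exprn_ge0 // ltW.
  by rewrite mulr_suml; apply: ler_sum => m _.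
move=> h l ht Hl.
(* [X N N] is a partial sum of [a] at [z + h], because the binomial coefficients vanish for [n > m].
   When [N'] exceeds [N], the extra columns are dominated by a tail of the absolutely convergent
   series, uniformly in [N']. *)
pose X (N N' : nat) : R[i] :=
  \sum_(0 <= n < N) h ^+ n * \sum_(0 <= m < N') reexp a z n m.
have XE (N N' : nat) : X N N' =
    \sum_(0 <= m < N') a m *
      \sum_(0 <= n < N) (z ^+ (m - n) * h ^+ n) *+ 'C(m, n).
  rewrite /X; under eq_bigr do rewrite mulr_sumr.
  rewrite exchange_big_nat /=; apply: eq_bigr => m _.
  rewrite mulr_sumr; apply: eq_bigr => n _.
  by rewrite /reexp mulrC !mulrnAl mulrnAr mulrA.
have XN (N : nat) : X N N = \sum_(0 <= m < N) a m * (z + h) ^+ m.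
  rewrite XE; apply: eq_big_nat => m /andP[_ mN].
  rewrite exprDn -(big_mkord xpredT (fun k =>
    (z ^+ (m - k) * h ^+ k) *+ 'C(m, k))).
  rewrite (big_cat_nat (leq0n _) mN) //= [X in _ + X]big_nat_cond [X in _ +
    X]big1 ?addr0 //.
  by move=> k; rewrite andbT => /andP[mk _]; rewrite bin_small.
have Xle (N N' : nat) : (N <= N')%N -> normc (X N N' - X N N) <=
    L - \sum_(0 <= m < N) normc (a m) * (normc z + t) ^+ m.
  move=> NN'; rewrite lerBrDr (le_trans _ (leL N')) // (big_cat_nat (leq0n _)
    NN') //=.
  rewrite [leLHS]addrC lerD2l !XE (big_cat_nat (leq0n _) NN') //= [X in normc
    X]addrC addKr.
  rewrite (le_trans (normc_sum _ _ _)) //; apply: ler_sum => m _.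
  rewrite normcM ler_wpM2l ?normc_ge0 //.
  apply: (@le_trans _ _ ((normc z + normc h) ^+ m)); last first.
    by rewrite lerXn2r // ?nnegrE ?addr_ge0 ?normc_ge0 ?lerD2l // ltW.
  rewrite (le_trans _ (binomial_partial_sum_le m N (normc_ge0 z) (normc_ge0
    h))) //.
  rewrite (le_trans (normc_sum _ _ _)) //; apply: ler_sum => n _.
  by rewrite -mulr_natr !normcM !normcX -(rmorph_nat (real_complex R))
    normc_real
    ger0_norm // mulr_natr.
have lim N : normc (\sum_(0 <= n < N) b n * h ^+ n - X N N) <=
    L - \sum_(0 <= m < N) normc (a m) * (normc z + t) ^+ m.
  have cX : ccvg (X N) (\sum_(0 <= n < N) b n * h ^+ n).
    under eq_bigr do rewrite mulrC.
    by apply: ccvg_sum => n; apply: ccvgZ; exact: Hb.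
  have H := ccvg_normc (ccvgB cX (ccvg_cst (X N N))).
  apply: (cvgr_to_le H).
  by exists N => // N' /= NN'; exact: Xle.
have c0 : ccvg (fun N => \sum_(0 <= n < N) b n * h ^+ n - X N N) 0.
  apply: (ccvg_squeeze (e := fun N =>
    L - \sum_(0 <= m < N) normc (a m) * (normc z + t) ^+ m)) => [N|].
    by rewrite subr0.
  have : (fun N => L - series (fun m =>
    normc (a m) * (normc z + t) ^+ m) N) @ \oo --> L - L.
    by apply: cvgB cA; exact: cvg_cst.
  by rewrite subrr.
rewrite -[l]add0r; have := ccvgD c0 Hl.
by under [X in ccvg X]eq_fun do rewrite XN subrK.
Qed.

End power_series.

(** * Invariance of planar Lebesgue measure *)

Section area_invariance.
Variable R : realType.
Local Notation leb := (@lebesgue_measure R).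
Local Notation area := ((@lebesgue_measure R) \x (@lebesgue_measure R))%E.

(** By uniqueness of Lebesgue measure: the push-forward gives half-open intervals their length. *)
Lemma lebesgue_measure_translation (c : R) (A : set R) : measurable A ->
  leb ((fun x => x + c) @^-1` A) = leb A.
Proof.
have mf : measurable_fun setT (fun x : R => x + c).
  by apply: measurable_funD => //; exact: measurable_cst.
move=> mA; rewrite -[LHS]/(pushforward leb
  ((fun x => x + c) : _ -> measurableTypeR R) A).
apply/esym/lebesgue_measure_unique => //= _ [[a b]] _ <-.
rewrite /pushforward (_ : _ @^-1` _ = `]a - c, b - c]%classic).
  by rewrite !lebesgue_measure_itv /= !lte_fin ltrD2r -!EFinB opprB addrA subrK.
by apply/seteqP; split => x /=; rewrite !in_itv /= ltrBlDr lerBrDr.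
Qed.

Lemma lebesgue_measure_scaling (s : R) (A : set R) : 0 < s -> measurable A ->
  leb ((fun x => s * x) @^-1` A) = (s^-1%:E * leb A)%E.
Proof.
move=> s0.
have mf : measurable_fun setT (fun x : R => s * x).
  by apply: measurable_funM => //; exact: measurable_cst.
have {}mf : measurable_fun setT (( *%R s) : measurableTypeR R ->
  measurableTypeR R) := mf.
pose ns : {nonneg R} := NngNum (ltW s0).
move=> mA.
suff -> : leb A = (s%:E * leb (( *%R s) @^-1` A))%E.
  by rewrite muleA -EFinM mulVf ?gt_eqF // mul1e.
pose m := mscale ns
  (measure_function_pushforward__canonical__measure_function_Measure
  leb mf).
apply: (@lebesgue_measure_unique R m) => //= _ [[a b]] _ <-.
have pre : ( *%R s) @^-1` `]a, b]%classic = `]s^-1 * a, s^-1 * b]%classic.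
  by apply/seteqP; split => x /=;
    rewrite !in_itv /= ![s^-1 * _]mulrC ltr_pdivrMr // ler_pdivlMr // [s *
      x]mulrC.
change (leb `]a, b]%classic = s%:E * leb (( *%R s) @^-1` `]a, b]%classic))%E.
rewrite pre !lebesgue_measure_itv /= !lte_fin ltr_pM2l ?invr_gt0 //.
case: ifP => _; last by rewrite mule0.
by rewrite -!EFinB -EFinM -mulrBr mulrA divff ?gt_eqF // mul1r.
Qed.

Local Notation R2 := (measurableTypeR R * measurableTypeR R)%type.

(** The sections of the preimage of a set under a shear are translates of the sections of the set,
    so Fubini reduces invariance of area to translations of the line. *)
Definition shear1 (t : R) (p : R * R) := (p.1 + t * p.2, p.2).
Definition shear2 (t : R) (p : R * R) := (p.1, p.2 + t * p.1).

Lemma measurable_shear1 t : measurable_fun setT (shear1 t).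
Proof.
apply: measurable_fun_pair => //; apply: measurable_funD => //.
by apply: measurable_funM => //; exact: measurable_cst.
Qed.

Lemma measurable_shear2 t : measurable_fun setT (shear2 t).
Proof.
apply: measurable_fun_pair => //; apply: measurable_funD => //.
by apply: measurable_funM => //; exact: measurable_cst.
Qed.

Lemma area_shear2 t A : measurable A -> area (shear2 t @^-1` A) = area A.
Proof.
move=> mA; rewrite /product_measure1; apply: eq_integral => x _ /=.
rewrite -[RHS](@lebesgue_measure_translation (t * x)); last first.
  exact: measurable_xsection.
by congr (leb _); apply/seteqP; split => y; rewrite /xsection /= !inE.
Qed.

(** Lets area be computed from horizontal sections too, as horizontal shears require. *)
Lemma area_product_measure2 A : measurable A ->
  area A = (leb \x^ leb)%E A.
Proof.
move=> mA; apply: product_measure_unique => // B C mB mC.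
by rewrite /= product_measure2E.
Qed.

Lemma area_shear1 t A : measurable A -> area (shear1 t @^-1` A) = area A.
Proof.
move=> mA; rewrite !area_product_measure2 //; last first.
  by rewrite -[X in measurable X]setTI; apply: measurable_shear1.
rewrite /product_measure2; apply: eq_integral => y _ /=.
rewrite -[RHS](@lebesgue_measure_translation (t * y)); last first.
  exact: measurable_ysection.
by congr (leb _); apply/seteqP; split => x; rewrite /ysection /= !inE.
Qed.

(* A rotation by an angle that is not a rational multiple of pi. *)
Definition rotation345 (p : R * R) : R * R :=
  (3 / 5 * p.1 - 4 / 5 * p.2, 4 / 5 * p.1 + 3 / 5 * p.2).

(** The factorization of a rotation by theta into three shears, with parameters
    [- tan (theta / 2) = - 1 / 2] and [sin theta = 4 / 5]. *)
Lemma rotation345E :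
  rotation345 = shear1 (- (1 / 2)) \o (shear2 (4 / 5) \o shear1 (- (1 / 2))).
Proof.
apply/funext => -[x y]; rewrite /rotation345 /shear1 /shear2 /=; congr (_, _);
  lra.
Qed.

Lemma measurable_rotation345 : measurable_fun setT rotation345.
Proof.
rewrite rotation345E; apply: measurableT_comp; first exact: measurable_shear1.
by apply: measurableT_comp; [exact: measurable_shear2|exact: measurable_shear1].
Qed.

Lemma area_rotation345 A : measurable A -> area (rotation345 @^-1` A) = area A.
Proof.
move=> mA; rewrite rotation345E !comp_preimage area_shear1; last first.
  rewrite -[X in measurable X]setTI; apply: measurable_shear2 => //.
  by rewrite -[X in measurable X]setTI; apply: measurable_shear1.
rewrite area_shear2; last first.
  by rewrite -[X in measurable X]setTI; apply: measurable_shear1.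
by rewrite area_shear1.
Qed.

Definition dilate (s : R) (p : R * R) : R * R := (s * p.1, s * p.2).

Lemma measurable_dilate s : measurable_fun setT (dilate s).
Proof.
by apply: measurable_fun_pair; apply: measurable_funM => //;
  exact: measurable_cst.
Qed.

Lemma area_dilate s A : 0 < s -> measurable A ->
  area (dilate s @^-1` A) = ((s ^- 2)%:E * area A)%E.
Proof.
move=> s0 mA.
have ns : 0 <= s ^+ 2 by rewrite sqr_ge0.
suff -> : area A = ((s ^+ 2)%:E * area (dilate s @^-1` A))%E.
  by rewrite muleA -EFinM mulVf ?mul1e // gt_eqF // exprn_gt0.
pose R2 : measurableType _ := (measurableTypeR R * measurableTypeR R)%type.
have md : measurable_fun setT (dilate s : R2 -> R2) := measurable_dilate s.
pose m := mscale (NngNum ns)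
  (measure_function_pushforward__canonical__measure_function_Measure area md).
apply: (@product_measure_unique _ _ _ _ R leb leb m) => // B C mB mC;
  rewrite /m.
change ((s ^+ 2)%:E * area ((( *%R s) @^-1` B) `*` (( *%R s) @^-1` C)) = leb B
  * leb C)%E.
have mp D : measurable D -> measurable (( *%R s) @^-1` D).
  move=> mD; rewrite -[X in measurable X]setTI.
  have mf : measurable_fun setT (fun x : R => s * x) by
    apply: measurable_funM => //; exact: measurable_cst.
  exact: mf.
rewrite product_measure1E; [|exact: mp|exact: mp].
have e D : measurable D -> leb (( *%R s) @^-1` D) = (s^-1%:E * leb D)%E.
  exact: lebesgue_measure_scaling.
change ((s ^+ 2)%:E * (leb (( *%R s) @^-1` B) * leb (( *%R s) @^-1` C)) =
  leb B * leb C)%E.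
rewrite (e _ mB) (e _ mC) [X in (_ * X)%E]muleACA.
move: (leb B * leb C)%E => x; rewrite -[RHS]mul1e !muleA; congr (_ * x)%E.
by rewrite -!EFinM; congr EFin; field; rewrite gt_eqF.
Qed.

Lemma integral_rotation345 (D : set (R * R)) (f : R * R -> R) :
  measurable D -> rotation345 @^-1` D = D -> measurable_fun setT f ->
  area.-integrable D (EFin \o f \o rotation345) ->
  (\int[area]_(p in D) (f (rotation345 p))%:E = \int[area]_(p in D) (f p)%:E)%E.
Proof.
move=> mD DE mf fi.
have mr : measurable_fun setT (rotation345 : R2 -> R2) :=
  measurable_rotation345.
have mf' : measurable_fun setT (EFin \o f : R2 -> \bar R) by
  exact/measurable_EFinP.
have := @integral_pushforward _ _ R2 R2 R rotation345 mr area D (EFin \o f) mf'.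
rewrite DE => /(_ fi mD) /= <-.
apply: eq_measure_integral => A mA _; exact: area_rotation345.
Qed.

Lemma ge0_integral_dilate (s : R) (D : set (R * R)) (f : R * R -> \bar R) :
  0 < s -> measurable D -> measurable_fun D f -> {in D, forall y, 0 <= f y}%E ->
  (\int[area]_(p in dilate s @^-1` D) f (dilate s p) =
   (s ^- 2)%:E * \int[area]_(p in D) f p)%E.
Proof.
move=> s0 mD mf f0.
have ns : 0 <= s ^- 2 by rewrite invr_ge0 sqr_ge0.
have md : measurable_fun setT (dilate s : R2 -> R2) := measurable_dilate s.
have := @ge0_integral_pushforward _ _ R2 R2 R (dilate s) md area D f mD mf f0.
move=> /= <-.
have f0' x : D x -> (0 <= f x)%E by move=> Dx; apply: f0; rewrite inE.
have := @ge0_integral_mscale _ R2 _ area D mD (NngNum ns) f mf f0' => <-.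
apply: eq_measure_integral => A mA _.
by change (area (dilate s @^-1` A) = (s ^- 2)%:E * area A)%E;
  apply: area_dilate.
Qed.

End area_invariance.

(** * Moments of disks *)

Section disk_moments.
Variable R : realType.
Local Notation leb := (@lebesgue_measure R).
Local Notation area := ((@lebesgue_measure R) \x (@lebesgue_measure R))%E.
Implicit Types (r : R) (p : R * R).

Definition norm2 p : R := p.1 ^+ 2 + p.2 ^+ 2.

Definition disk r : set (R * R) := [set p | norm2 p < r ^+ 2].

Lemma norm2_ge0 p : 0 <= norm2 p.
Proof. by rewrite addr_ge0 ?sqr_ge0. Qed.

Lemma abs2_xy p : abs2 (xy_to_C p) = norm2 p.
Proof. by []. Qed.

Lemma unit_disk2_disk : @unit_disk2 R = disk 1.
Proof.
by apply/seteqP; split => p; rewrite /disk /= expr1n => H; apply/unit_disk2E.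
Qed.

Lemma measurable_norm2 : measurable_fun setT norm2.
Proof. by apply: measurable_funD; apply: measurable_funX. Qed.

Lemma measurable_disk r : measurable (disk r).
Proof.
rewrite (_ : disk r = norm2 @^-1` `]-oo, r ^+ 2[%classic).
  by rewrite -[X in measurable X]setTI; exact: measurable_norm2.
by apply/seteqP; split => p; rewrite /disk /= in_itv.
Qed.

Lemma disk_sub r s : 0 <= r -> r <= s -> disk r `<=` disk s.
Proof.
move=> r0 rs p; rewrite /disk /= => /lt_le_trans; apply.
by rewrite lerXn2r // nnegrE (le_trans r0).
Qed.

Lemma area_disk_lty r : (area (disk r) < +oo)%E.
Proof.
wlog r0 : r / 0 <= r => [H|].
  have := H `|r| (normr_ge0 r); rewrite (_ : disk `|r| = disk r) //.
  by rewrite /disk real_normK ?num_real.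
have sub : disk r `<=` `[- r, r]%classic `*` `[- r, r]%classic.
  move=> [x y]; rewrite /disk /norm2 /= => H; rewrite !in_itv /= -!ler_norml.
  have X (u v : R) : u ^+ 2 + v ^+ 2 < r ^+ 2 -> `|u| <= r.
    move=> uv; rewrite -(ger0_norm r0) -ler_sqr ?nnegrE ?normr_ge0 //.
    by rewrite !real_normK ?num_real // ltW // (le_lt_trans _ uv) // lerDl
      sqr_ge0.
  by split; [apply: X H|rewrite addrC in H; apply: X H].
apply: (@le_lt_trans _ _ (area (`[- r, r]%classic `*` `[- r, r]%classic))).
  apply: le_measure => //; rewrite inE.
    exact: measurable_disk.
  by apply: measurableX.
rewrite product_measure1E // /= lebesgue_measure_itv /=.
by case: ifP => _; rewrite ?mul0e // -EFinB -EFinM ltry.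
Qed.

Lemma disk_bounded_integrable r (f : R * R -> R) (M : R) :
  measurable_fun (disk r) f -> (forall p, disk r p -> `|f p| <= M) ->
  area.-integrable (disk r) (EFin \o f).
Proof.
move=> mf fM; apply: measurable_bounded_integrable => //.
- exact: measurable_disk.
- exact: area_disk_lty.
- by exists M; split; [exact: num_real|move=> x Mx p Dp;
    apply: le_trans (fM p Dp) _; exact: ltW].
Qed.

Lemma dilate_disk r s : 0 < s -> dilate s @^-1` disk (s * r) = disk r.
Proof.
move=> s0; apply/seteqP; split => p;
  rewrite /disk /norm2 /dilate /= !exprMn -mulrDr;
  by rewrite ltr_pM2l // exprn_gt0.
Qed.

Lemma rotation345_disk r : @rotation345 R @^-1` disk r = disk r.
Proof.
have E p : norm2 (rotation345 p) = norm2 p by rewrite /norm2 /rotation345 /=;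
  field.
by apply/seteqP; split => p; rewrite /disk /= E.
Qed.

Definition moment n r : R := \int[area]_(p in disk r) (norm2 p ^+ n).

Lemma moment_integrable n r :
  area.-integrable (disk r) (EFin \o (fun p => norm2 p ^+ n)).
Proof.
apply: (@disk_bounded_integrable _ _ (r ^+ 2 ^+ n)).
  by apply: measurable_funX; apply: measurable_funTS; exact: measurable_norm2.
move=> p; rewrite /disk /= => H; rewrite ger0_norm ?exprn_ge0 ?norm2_ge0 //.
by rewrite lerXn2r ?nnegrE ?norm2_ge0 ?sqr_ge0 // ltW.
Qed.

Lemma moment_scaling n r : 0 < r -> moment n r = r ^+ (2 * n.+1) * moment n 1.
Proof.
move=> r0; have r2 : r ^+ 2 != 0 by rewrite gt_eqF // exprn_gt0.
have H : (\int[area]_(p in dilate r @^-1` disk r) (norm2 (dilate r p) ^+ n)%:E =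
   (r ^- 2)%:E * \int[area]_(p in disk r) (norm2 p ^+ n)%:E)%E.
  apply: (@ge0_integral_dilate _ r (disk r) (fun p => (norm2 p ^+ n)%:E)) => //.
  - exact: measurable_disk.
  - by have /integrableP[] := moment_integrable n r.
  - by move=> p _; rewrite lee_fin exprn_ge0 // norm2_ge0.
have DE : dilate r @^-1` disk r = disk 1 by rewrite -{2}[r]mulr1 dilate_disk.
rewrite DE in H.
have E : (fun p : R * R => (norm2 (dilate r p) ^+ n)%:E) =
    (fun p => (r ^+ 2 ^+ n)%:E * (norm2 p ^+ n)%:E)%E.
  apply/funext => p; rewrite -EFinM -exprMn; congr (_ ^+ _)%:E.
  by rewrite /norm2 /dilate /= !exprMn mulrDr.
rewrite E integralZl // in H; last 2 first.
- exact: measurable_disk.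
- exact: moment_integrable.
have fin s : (\int[area]_(p in disk s) (norm2 p ^+ n)%:E = (moment n s)%:E)%E.
  rewrite /moment /Rintegral fineK //.
  by apply: integrable_fin_num;
    [exact: measurable_disk|exact: moment_integrable].
rewrite !fin -!EFinM in H; case: H => H.
rewrite mulnS exprD exprM -mulrA H mulrA divff ?mul1r //.
Qed.

(** On the annulus between the two disks the integrand lies between [(r ^+ 2) ^+ n] and 1, which
    compares the [n]-th moment with the area. *)
Lemma moment_succ_disk n r : 0 < r -> r < 1 ->
  (r ^+ 2) ^+ n * (moment 0 1 - moment 0 r) <= moment n 1 - moment n r /\
  moment n 1 - moment n r <= moment 0 1 - moment 0 r.
Proof.
move=> r0 r1.
have sub : disk r `<=` disk 1 by apply: disk_sub; rewrite ltW.
have mD : measurable (disk 1 `\` disk r) by apply: measurableD;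
  exact: measurable_disk.
have int m : area.-integrable (disk 1 `\` disk r) (EFin \o (fun p =>
  norm2 p ^+ m)).
  apply: integrableS (moment_integrable m 1) => //;
    first exact: measurable_disk.
have split m : moment m 1 - moment m r =
    \int[area]_(p in disk 1 `\` disk r) (norm2 p ^+ m).
  rewrite {1}/moment -{1}(setDUK sub) Rintegral_setU //.
  - by rewrite addrAC subrr add0r.
  - exact: measurable_disk.
  - by rewrite setDUK //; exact: moment_integrable.
  - by rewrite disj_set2E setDIK.
rewrite !split; split.
  rewrite -RintegralZl //; apply: le_Rintegral => //.
    rewrite (_ : EFin \o _ = fun p =>
      (((r ^+ 2) ^+ n)%:E * (norm2 p ^+ 0)%:E)%E) //.
    by apply: integrableZl => //; exact: int.
  move=> p [_ /negP]; rewrite -leNgt => rp; rewrite expr0 mulr1.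
  by rewrite lerXn2r // ?nnegrE ?sqr_ge0 ?norm2_ge0.
apply: le_Rintegral => // p [p1 _]; rewrite expr0 exprn_ile1 ?norm2_ge0 //.
by move: p1; rewrite /disk /= expr1n => /ltW.
Qed.

(** In effect a derivative at [r = 1]. With [q = r ^+ 2], scaling evaluates the two annulus
    integrals as [1 - q] times [(1 + q + ... + q ^+ n) * m] and [1 - q] times [c]; after division by
    [1 - q], letting [q] tend to 1 squeezes the identity. *)
Lemma moment_unit n : n.+1%:R * moment n 1 = moment 0 1.
Proof.
set c := moment 0 1; set m := moment n 1.
have key (q : R) : 0 < q -> q < 1 ->
    q ^+ n * c <= (\sum_(i < n.+1) q ^+ i) * m /\ (\sum_(i < n.+1) q ^+ i) * m
      <= c.
  move=> q0 q1; set r := Num.sqrt q.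
  have r0 : 0 < r by rewrite sqrtr_gt0.
  have rq : r ^+ 2 = q by rewrite sqr_sqrtr // ltW.
  have r1 : r < 1 by rewrite -sqrtr1 ltr_sqrt.
  have [] := moment_succ_disk n r0 r1.
  rewrite !(moment_scaling _ r0) !exprM rq expr1 -/c -/m.
  have -> : c - q * c = (1 - q) * c by rewrite mulrBl mul1r.
  have -> : m - q ^+ n.+1 * m = (1 - q) * ((\sum_(i < n.+1) q ^+ i) * m).
    by rewrite mulrA -[1 - q]opprB mulNr -subrX1 opprB mulrBl mul1r.
  rewrite mulrCA !ler_pM2l ?subr_gt0 //.
have [q_ [q01 cX]] := unit_seq R.
have q0 k : 0 < q_ k by have /andP[] := q01 k.
have q1 k : q_ k < 1 by have /andP[] := q01 k.
have cS : (fun k => (\sum_(i < n.+1) q_ k ^+ i) * m) @ \oo --> n.+1%:R * m.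
  apply: cvgM; last exact: cvg_cst.
  rewrite -[X in X%:R](card_ord n.+1) -sumr_const.
  have := @cvg_sum_seq R _ (index_enum 'I_n.+1) (fun (i : 'I_n.+1) k =>
    q_ k ^+ i) (fun=> 1).
  by apply => i; exact: cX.
apply/eqP; rewrite eq_le; apply/andP; split.
  by apply: (cvgr_to_le cS); apply: nearW => k; have [] := key _ (q0 k) (q1 k).
have cL : (fun k => (\sum_(i < n.+1) q_ k ^+ i) * m - q_ k ^+ n * c) @ \oo -->
    n.+1%:R * m - 1 * c.
  by apply: cvgB => //; apply: cvgM; [exact: cX|exact: cvg_cst].
rewrite -[X in X <= _]mul1r -subr_ge0; apply: (cvgr_to_ge cL).
by apply: nearW => k; rewrite subr_ge0; have [] := key _ (q0 k) (q1 k).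
Qed.

Lemma moment0_gt0 : 0 < moment 0 1.
Proof.
have sub : `[0, 2^-1 : R]%classic `*` `[0, 2^-1 : R]%classic `<=` disk 1.
  move=> [x y] /=; rewrite !in_itv /= => -[/andP[x0 x1] /andP[y0 y1]].
  by rewrite /disk /norm2 /= expr1n !expr2; nra.
have mS : measurable (`[0, 2^-1 : R]%classic `*` `[0, 2^-1 : R]%classic).
  exact: measurableX.
rewrite /moment; under eq_Rintegral do rewrite expr0.
rewrite Rintegral_cst ?mul1r; last exact: measurable_disk.
apply: fine_gt0; rewrite area_disk_lty andbT.
apply: (@lt_le_trans _ _ (area (`[0, 2^-1 : R]%classic `*` `[0, 2^-1 :
  R]%classic))).
  rewrite product_measure1E // /= lebesgue_measure_itv /= lte_fin invr_gt0
    ltr0n /=.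
  by rewrite -EFinB -EFinM lte_fin subr0 mulr_gt0 // invr_gt0.
by apply: le_measure => //; rewrite inE //; exact: measurable_disk.
Qed.

End disk_moments.

(** * Integrals over disks *)

Section disk_integrals.
Variable R : realType.
Local Notation area := ((@lebesgue_measure R) \x (@lebesgue_measure R))%E.
Implicit Types (r : R) (p : R * R) (z a : R[i]) (g h : R[i] -> R).

Definition cmeasurable (D : set (R * R)) (F : R[i] -> R[i]) :=
  measurable_fun D (fun p => complex.Re (F (xy_to_C p))) /\
  measurable_fun D (fun p => complex.Im (F (xy_to_C p))).

Lemma cmeasurable_cst D a : cmeasurable D (fun=> a).
Proof. by split; exact: measurable_cst. Qed.

Lemma cmeasurable_id D : cmeasurable D id.
Proof.
by split; apply: measurable_funTS;
  [exact: measurable_fst|exact: measurable_snd].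
Qed.

Lemma cmeasurable_conj D F : cmeasurable D F -> cmeasurable D (fun z =>
  (F z)^*).
Proof.
move=> [mr mi]; split.
  rewrite (_ : (fun p => _) = fun p => complex.Re (F (xy_to_C p))) //.
  by apply/funext => p; case: (F _).
rewrite (_ : (fun p => _) = \- (fun p => complex.Im (F (xy_to_C p)))).
  exact: measurableT_comp.
by apply/funext => p /=; case: (F _).
Qed.

Lemma cmeasurableM D F G : measurable D -> cmeasurable D F -> cmeasurable D G ->
  cmeasurable D (fun z => F z * G z).
Proof.
move=> mD [Fr Fi] [Gr Gi]; split.
  rewrite (_ : (fun p => _) = fun p =>
    complex.Re (F (xy_to_C p)) * complex.Re (G (xy_to_C p)) -
    complex.Im (F (xy_to_C p)) * complex.Im (G (xy_to_C p))).
    by apply: measurable_funB; apply: measurable_funM.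
  by apply/funext => p /=; case: (F _) => ? ?; case: (G _).
rewrite (_ : (fun p => _) = fun p =>
    complex.Re (F (xy_to_C p)) * complex.Im (G (xy_to_C p)) +
    complex.Im (F (xy_to_C p)) * complex.Re (G (xy_to_C p))).
  by apply: measurable_funD; apply: measurable_funM.
by apply/funext => p /=; case: (F _) => ? ?; case: (G _).
Qed.

Lemma cmeasurableX D F n : measurable D -> cmeasurable D F ->
  cmeasurable D (fun z => F z ^+ n).
Proof.
move=> mD mF; elim: n => [|n IH]; first exact: cmeasurable_cst.
rewrite (_ : (fun z => _) = fun z => F z * F z ^+ n); first exact: cmeasurableM.
by apply/funext => z; rewrite exprS.
Qed.

Lemma cmeasurable_sum D (F : nat -> R[i] -> R[i]) n : measurable D ->
  (forall k, cmeasurable D (F k)) ->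
  cmeasurable D (fun z => \sum_(0 <= k < n) F k z).
Proof.
move=> mD mF; split.
  rewrite (_ : (fun p => _) = fun p =>
    \sum_(0 <= k < n) complex.Re (F k (xy_to_C p))).
    by apply: measurable_sum => k; have [] := mF k.
  by apply/funext => p; rewrite Re_sum.
rewrite (_ : (fun p => _) = fun p =>
  \sum_(0 <= k < n) complex.Im (F k (xy_to_C p))).
  by apply: measurable_sum => k; have [] := mF k.
by apply/funext => p; rewrite Im_sum.
Qed.

Lemma cmeasurable_monomial D a j k : measurable D ->
  cmeasurable D (fun z => a * z ^+ j * (z^*) ^+ k).
Proof.
move=> mD; have id := cmeasurable_id D.
exact: cmeasurableM mD (cmeasurableM mD (cmeasurable_cst D a)
  (cmeasurableX j mD id)) (cmeasurableX k mD (cmeasurable_conj id)).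
Qed.

Lemma cmeasurable_abs2 D F : measurable D -> cmeasurable D F ->
  measurable_fun D (fun p => abs2 (F (xy_to_C p))).
Proof. by move=> mD [mr mi]; apply: measurable_funD;
  apply: measurable_funX. Qed.

Lemma cmeasurable_cvg D (F : nat -> R[i] -> R[i]) f : measurable D ->
  (forall n, cmeasurable D (F n)) ->
  (forall p, D p -> ccvg (fun n => F n (xy_to_C p)) (f (xy_to_C p))) ->
  cmeasurable D f.
Proof.
move=> mD mF cF; split.
  apply: (measurable_fun_cvg (fun n => (mF n).1)) => p Dp.
  exact: ccvg_Re (cF p Dp).
apply: (measurable_fun_cvg (fun n => (mF n).2)) => p Dp.
exact: ccvg_Im (cF p Dp).
Qed.

Lemma normc_xy p : normc (xy_to_C p) ^+ 2 = norm2 p.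
Proof. by rewrite normc_sq abs2_xy. Qed.

Lemma diskE r p : 0 < r -> disk r p <-> normc (xy_to_C p) < r.
Proof.
by move=> r0; rewrite /disk /= -normc_xy ltr_sqr ?nnegrE ?normc_ge0 // ltW.
Qed.

Lemma weightE p : weight p = 2 / pi * (1 - norm2 p).
Proof. by rewrite /weight mulrA [pi^-1 * 2]mulrC. Qed.

Lemma weight_bounds r p : 0 < r -> r <= 1 -> disk r p ->
  0 <= weight p <= 2 / pi.
Proof.
move=> r0 r1 /(disk_sub (ltW r0) r1); rewrite /disk /= expr1n => p1.
have pi0 : 0 <= 2 / pi :> R by rewrite divr_ge0 // pi_ge0.
rewrite weightE; apply/andP; split; first by rewrite mulr_ge0 // subr_ge0 ltW.
by rewrite ler_piMr // gerBl norm2_ge0.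
Qed.

Definition disk_integral r g : R :=
  \int[area]_(p in disk r) (g (xy_to_C p) * weight p).

Definition disk_nice r g :=
  measurable_fun (disk r) (fun p => g (xy_to_C p)) /\
  exists M, forall z, normc z < r -> `|g z| <= M.

Section fixed_radius.
Variable r : R.
Hypotheses (r0 : 0 < r) (r1 : r <= 1).

Lemma measurable_weight_disk : measurable_fun (disk r) (@weight R).
Proof.
apply: measurable_funS (@measurable_weight R).
  exact: measurable_unit_disk2.
by rewrite unit_disk2_disk; apply: disk_sub => //; exact: ltW.
Qed.

Lemma disk_nice_integrable g : disk_nice r g ->
  area.-integrable (disk r) (EFin \o (fun p => g (xy_to_C p) * weight p)).
Proof.
move=> [mg [M gM]]; apply: (@disk_bounded_integrable _ _ _ (M * (2 / pi))).
  by apply: measurable_funM => //; exact: measurable_weight_disk.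
move=> p Dp; have /andP[w0 wle] := weight_bounds r0 r1 Dp.
rewrite normrM ler_pM // ?gM //; last by rewrite ger0_norm.
exact/(diskE _ r0).
Qed.

Lemma disk_niceD g h : disk_nice r g -> disk_nice r h -> disk_nice r (g \+ h).
Proof.
move=> [mg [M gM]] [mh [N hN]]; split; first exact: measurable_funD.
exists (M + N) => z zr; apply: le_trans (ler_normD _ _) _.
by rewrite lerD ?gM ?hN.
Qed.

Lemma disk_niceZ c g : disk_nice r g -> disk_nice r (fun z => c * g z).
Proof.
move=> [mg [M gM]]; split; first by apply: measurable_funM => //;
  exact: measurable_cst.
by exists (`|c| * M) => z zr; rewrite normrM ler_wpM2l // gM.
Qed.

Lemma disk_nice_cst c : disk_nice r (fun=> c).
Proof. by split; [exact: measurable_cst|exists `|c|]. Qed.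

Lemma disk_nice_sum I (s : seq I) (F : I -> R[i] -> R) :
  (forall i, disk_nice r (F i)) -> disk_nice r (fun z => \sum_(i <- s) F i z).
Proof.
move=> H; elim: s => [|i s IH].
  rewrite (_ : (fun z => _) = fun=> 0); first exact: disk_nice_cst.
  by apply/funext => z; rewrite big_nil.
rewrite (_ : (fun z => _) = F i \+ (fun z => \sum_(i <- s) F i z)).
  exact: disk_niceD.
by apply/funext => z; rewrite big_cons.
Qed.

Lemma disk_integralD g h : disk_nice r g -> disk_nice r h ->
  disk_integral r (g \+ h) = disk_integral r g + disk_integral r h.
Proof.
move=> ng nh; rewrite -RintegralD; last 3 first.
- exact: measurable_disk.
- exact: disk_nice_integrable.
- exact: disk_nice_integrable.
by apply: eq_Rintegral => p _; rewrite /= mulrDl.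
Qed.

Lemma disk_integralZ c g : disk_nice r g ->
  disk_integral r (fun z => c * g z) = c * disk_integral r g.
Proof.
move=> ng; rewrite -RintegralZl; last 2 first.
- exact: measurable_disk.
- exact: disk_nice_integrable.
by apply: eq_Rintegral => p _; rewrite /= mulrA.
Qed.

Lemma disk_integral_sum I (s : seq I) (F : I -> R[i] -> R) :
  (forall i, disk_nice r (F i)) ->
  disk_integral r (fun z => \sum_(i <- s) F i z) =
  \sum_(i <- s) disk_integral r (F i).
Proof.
move=> H; elim: s => [|i s IH].
  rewrite big_nil /disk_integral.
  under eq_Rintegral do rewrite big_nil mul0r.
  by rewrite Rintegral_cst ?mul0r //; exact: measurable_disk.
rewrite big_cons -IH -disk_integralD //; last exact: disk_nice_sum.
by congr disk_integral; apply/funext => z; rewrite big_cons.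
Qed.

Lemma le_disk_integral g h : disk_nice r g -> disk_nice r h ->
  (forall z, normc z < r -> g z <= h z) -> disk_integral r g <= disk_integral r
    h.
Proof.
move=> ng nh gh; apply: le_Rintegral.
- exact: measurable_disk.
- exact: disk_nice_integrable.
- exact: disk_nice_integrable.
move=> p Dp; have /andP[w0 _] := weight_bounds r0 r1 Dp.
by rewrite ler_wpM2r // gh //; exact/(diskE _ r0).
Qed.

(** Real parts suffice because [abs2] of a polynomial is a real sum of such terms; the complex
    factor [a] makes the family stable under rotation. *)
Definition monomial a (j k : nat) z : R := complex.Re (a * z ^+ j * (z^*) ^+ k).

Lemma disk_nice_monomial a j k : disk_nice r (monomial a j k).
Proof.
have mD := @measurable_disk R r.
split.
  by have [] := cmeasurable_monomial a j k mD.
exists (normc a * r ^+ j * r ^+ k) => z zr.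
rewrite (le_trans (Re_le_normc _)) // !normcM !normcX normc_conj.
have X m : normc z ^+ m <= r ^+ m.
  by rewrite lerXn2r ?nnegrE ?normc_ge0 // ltW.
by rewrite !ler_pM // ?mulr_ge0 ?exprn_ge0 ?normc_ge0.
Qed.

Definition c345 : R[i] := (3 / 5) +i* (4 / 5).

Lemma xy_rotation345 p : xy_to_C (rotation345 p) = c345 * xy_to_C p.
Proof. by case: p => x y; congr Complex => /=; rewrite addrC. Qed.

(** Substitution of [c345 * z] for [z], under which both the disk and the weight are invariant. *)
Lemma disk_integral_rotation a j k :
  disk_integral r (monomial a j k) =
  disk_integral r (monomial (a * (c345 ^+ j * (c345^*) ^+ k)) j k).
Proof.
have W p : weight (rotation345 p) = weight p.
  by rewrite !weightE /norm2 /rotation345 /=; congr (_ * (1 - _)); field.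
pose f p := monomial a j k (xy_to_C p) * weight p.
have E p : f (rotation345 p) =
    monomial (a * (c345 ^+ j * (c345^*) ^+ k)) j k (xy_to_C p) * weight p.
  rewrite /f W xy_rotation345 /monomial; set z := xy_to_C p.
  suff -> : a * (c345 * z) ^+ j * ((c345 * z)^*) ^+ k =
      a * (c345 ^+ j * (c345^*) ^+ k) * z ^+ j * (z^*) ^+ k by [].
  by rewrite rmorphM !exprMn -!mulrA; do 2 congr (_ * _); rewrite mulrCA.
rewrite /disk_integral /Rintegral; congr fine.
under [RHS]eq_integral do rewrite -E.
rewrite integral_rotation345 //.
- exact: measurable_disk.
- exact: rotation345_disk.
- apply: measurable_funM.
    by have [] := cmeasurable_monomial a j k (@measurableT _ (R * R)%type).
  rewrite (_ : @weight R = fun p => 2 / pi * (1 - norm2 p)); last first.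
    by apply/funext => p; exact: weightE.
  apply: measurable_funM; first exact: measurable_cst.
  by apply: measurable_funB; [exact: measurable_cst|exact: measurable_norm2].
rewrite (_ : _ \o _ = EFin \o (fun p =>
  monomial (a * (c345 ^+ j * (c345^*) ^+ k)) j k (xy_to_C p) * weight p)).
  exact: disk_nice_integrable (disk_nice_monomial _ _ _).
by apply/funext => p /=; rewrite E.
Qed.

End fixed_radius.
End disk_integrals.

(** * Parseval's identity on disks and Cauchy's estimate *)

Section parseval.
Variable R : realType.
Implicit Types (r : R) (z b : R[i]) (a : nat -> R[i]) (f : R[i] -> R[i]).

Lemma c345_conj : c345 R * (c345 R)^* = 1.
Proof. by rewrite /c345; apply/eqP; rewrite eq_complex /=; apply/andP; split;
  apply/eqP; field. Qed.

(* (3 + 4i)^n stays congruent to 3 + 4i modulo 5, so it is never 5^n. *)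
Lemma c345_exp_neq1 n : c345 R ^+ n.+1 != 1.
Proof.
have [x [y E]] : exists x y : int, (3 +i* 4) ^+ n.+1 =
    (5 * x + 3)%:~R +i* (5 * y + 4)%:~R :> R[i].
  elim: n => [|n [x [y E]]].
    by exists 0, 0; rewrite expr1 !mulr0 !add0r.
  exists (3 * x - 4 * y - 2), (4 * x + 3 * y + 4).
  rewrite exprS E; apply/eqP; rewrite eq_complex /=.
  by apply/andP; split; apply/eqP; ring.
apply/eqP => H.
have : (3 +i* 4) ^+ n.+1 = (5 ^+ n.+1)%:C :> R[i].
  rewrite (_ : 3 +i* 4 = 5%:C * c345 R); last first.
    by apply/eqP; rewrite eq_complex /=; apply/andP; split; apply/eqP; field.
  by rewrite exprMn H mulr1 rmorphXn.
rewrite E => -[_] /eqP; rewrite intr_eq0 => /eqP; lia.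
Qed.

(** As [c345] has modulus 1, the product is a positive power of [c345] or of its conjugate. *)
Lemma c345_rot_neq1 j k : j != k -> c345 R ^+ j * ((c345 R)^*) ^+ k != 1.
Proof.
move: (c345 R) c345_conj c345_exp_neq1 => c cc cn.
have pow m n : c ^+ (n + m) * (c^*) ^+ m = c ^+ n.
  by rewrite exprD -mulrA -exprMn cc expr1n mulr1.
rewrite neq_ltn => /orP[] /subnKC <-; last by rewrite addSnnS addnC pow.
apply/eqP => /(congr1 conjc); rewrite rmorph1 rmorphM !rmorphXn /= conjcK mulrC.
by rewrite addSnnS addnC pow; apply/eqP.
Qed.

(* The value of [kappa] is 2, but only its sign matters. *)
Definition kappa : R := 2 / pi * moment 0 1.

Lemma kappa_gt0 : 0 < kappa.
Proof. by rewrite mulr_gt0 ?moment0_gt0 // divr_gt0 // pi_gt0. Qed.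

(** The squared norm of [z ^+ n] over the disk of radius [r]; the factor [1 - |z|^2] of the density
    makes it a difference of consecutive moments. *)
Definition disk_weight (n : nat) r : R :=
  kappa * (r ^+ (2 * n.+1) / n.+1%:R - r ^+ (2 * n.+2) / n.+2%:R).

Section fixed_radius.
Variable r : R.
Hypotheses (r0 : 0 < r) (r1 : r <= 1).

(** Coefficients [d] and [d * u] give the same integral by rotation invariance, and [u] differs from
    1, so [d] can be chosen with [b = d - d * u]. The division happens in the coefficient because a
    complex factor cannot be pulled out of a real part. *)
Lemma disk_integral_monomial_neq b j k : j != k ->
  disk_integral r (monomial b j k) = 0.
Proof.
move=> jk; set u := c345 R ^+ j * ((c345 R)^*) ^+ k.
have u1 : 1 - u != 0 by rewrite subr_eq0 eq_sym c345_rot_neq1.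
pose d := b / (1 - u).
have -> : monomial b j k = monomial d j k \+ (fun z =>
  -1 * monomial (d * u) j k z).
  apply/funext => z; rewrite /monomial /=.
  have -> : b = d - d * u by rewrite -[X in X - _]mulr1 -mulrBr /d mulfVK.
  by rewrite !mulrBl ReB mulN1r.
rewrite disk_integralD //; last 2 first.
- exact: disk_nice_monomial.
- by apply: disk_niceZ; exact: disk_nice_monomial.
rewrite disk_integralZ //; last exact: disk_nice_monomial.
by rewrite -disk_integral_rotation // mulN1r subrr.
Qed.

Lemma moment_eq n s : moment n s = \int[((@lebesgue_measure R) \x
  (@lebesgue_measure R))%E]_(p in disk s) (norm2 p ^+ n).
Proof. by []. Qed.

Lemma disk_integral_monomial_diag b n :
  disk_integral r (monomial b n n) = complex.Re b * disk_weight n r.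
Proof.
have E p : monomial b n n (xy_to_C p) * weight p =
    complex.Re b * (2 / pi) * (norm2 p ^+ n - norm2 p ^+ n.+1).
  rewrite /monomial -mulrA -exprMn weightE exprSr.
  have -> : xy_to_C p * (xy_to_C p)^* = (norm2 p)%:C.
    rewrite /xy_to_C /norm2 /=; apply/eqP; rewrite eq_complex /= !expr2.
    by apply/andP; split; apply/eqP; ring.
  rewrite -rmorphXn.
  by case: b => x y /=; rewrite mulr0 subr0; ring.
rewrite /disk_integral; under eq_Rintegral do rewrite E.
have i n' := moment_integrable n' r.
have iB : (((@lebesgue_measure R) \x (@lebesgue_measure R))%E).-integrable
  (disk r)
    (EFin \o (fun p => norm2 p ^+ n - norm2 p ^+ n.+1)).
  rewrite (_ : EFin \o _ = (EFin \o (fun p => norm2 p ^+ n)%R) \-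
    (EFin \o (fun p => norm2 p ^+ n.+1)%R))%E //.
  by apply: integrableB => //; exact: measurable_disk.
rewrite RintegralZl //; last exact: measurable_disk.
rewrite RintegralB //; last exact: measurable_disk.
rewrite -!moment_eq !(moment_scaling _ r0) -mulrA; congr (_ * _).
have M m : moment m 1 = moment 0 1 / m.+1%:R :> R.
  by rewrite -(@moment_unit R m) mulrC mulKf // pnatr_eq0.
rewrite (M n) (M n.+1) /disk_weight /kappa -[RHS]mulrA; congr (_ * _).
by rewrite mulrBr; congr (_ - _); rewrite mulrCA.
Qed.

Lemma abs2_sum_monomial a z N :
  abs2 (\sum_(0 <= n < N) a n * z ^+ n) =
  \sum_(0 <= j < N) \sum_(0 <= k < N) monomial (a j * (a k)^*) j k z.
Proof.
set s := (X in abs2 X).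
have -> : abs2 s = complex.Re (s * s^*).
  by case: s => x y; rewrite /abs2 /= !expr2; ring.
rewrite rmorph_sum mulr_suml Re_sum; apply: eq_bigr => j _.
rewrite mulr_sumr Re_sum; apply: eq_bigr => k _.
by rewrite /monomial rmorphM rmorphXn mulrACA mulrA.
Qed.

Lemma disk_integral_polynomial a N :
  disk_integral r (fun z => abs2 (\sum_(0 <= n < N) a n * z ^+ n)) =
  \sum_(0 <= n < N) abs2 (a n) * disk_weight n r.
Proof.
rewrite (_ : (fun z => _) = fun z =>
  \sum_(0 <= j < N) \sum_(0 <= k < N) monomial (a j * (a k)^*) j k z);
    last first.
  by apply/funext => z; exact: abs2_sum_monomial.
rewrite disk_integral_sum //; last first.
  by move=> j; apply: disk_nice_sum => k; exact: disk_nice_monomial.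
apply: eq_big_nat => j /andP[_ jN].
rewrite disk_integral_sum //; last by move=> k; exact: disk_nice_monomial.
rewrite (bigD1_seq j) ?mem_index_iota ?iota_uniq //=.
rewrite big1 ?addr0 => [|k kj];
  last by rewrite disk_integral_monomial_neq // eq_sym.
rewrite disk_integral_monomial_diag; congr (_ * _).
by case: (a j) => x y; rewrite /abs2 /= !expr2; ring.
Qed.

Lemma disk_weight_ge n : kappa * r ^+ (2 * n.+1) / (n.+1%:R * n.+2%:R) <=
  disk_weight n r.
Proof.
rewrite /disk_weight -mulrA ler_wpM2l ?(ltW kappa_gt0) // [(2 * n.+2)%N]mulnS
  exprD.
have : 0 <= r ^+ (2 * n.+1) * (1 - r ^+ 2) / n.+2%:R.
  by rewrite divr_ge0 // mulr_ge0 ?exprn_ge0 ?(ltW r0) // subr_ge0 exprn_ile1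
    // ltW.
rewrite -subr_ge0; congr (0 <= _).
set x := r ^+ _; have : n.+2%:R = n.+1%:R + 1 :> R by rewrite -natr1.
move=> ->; field.
by rewrite nat1r natr1 !pnatr_eq0.
Qed.

Lemma disk_weight_gt0 n : 0 < disk_weight n r.
Proof.
apply: lt_le_trans (disk_weight_ge n).
by rewrite divr_gt0 // mulr_gt0 // ?exprn_gt0 ?kappa_gt0 ?ltr0Sn.
Qed.

Lemma disk_weight0_le : disk_weight 0 r <= kappa.
Proof.
rewrite /disk_weight -[leRHS]mulr1 ler_wpM2l ?(ltW kappa_gt0) // muln1 divr1.
rewrite lerBlDr ler_wpDr ?divr_ge0 ?exprn_ge0 ?(ltW r0) //.
by rewrite exprn_ile1 // ltW.
Qed.

Section function.
Variables (a : nat -> R[i]) (f : R[i] -> R[i]).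
Hypothesis fa : forall z, normc z < r -> psums a z (f z).

Lemma power_series_cmeasurable : cmeasurable (disk r) f.
Proof.
apply: (cmeasurable_cvg (F := fun N z => \sum_(0 <= n < N) a n * z ^+ n)).
- exact: measurable_disk.
- move=> N; apply: cmeasurable_sum; first exact: measurable_disk.
  move=> k; apply: cmeasurableM; first exact: measurable_disk.
    exact: cmeasurable_cst.
  by apply: cmeasurableX; [exact: measurable_disk|exact: cmeasurable_id].
by move=> p Dp; apply: fa; exact/(diskE _ r0).
Qed.

Hypothesis ca : cvgn (series (fun n => normc (a n) * r ^+ n)).
Let L := limn (series (fun n => normc (a n) * r ^+ n)).
Let S N := \sum_(0 <= n < N) normc (a n) * r ^+ n.

Let S_le N : S N <= L.
Proof.
apply: nondecreasing_cvgn_le ca N; apply/nondecreasing_seqP => n.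
by rewrite -subr_ge0 seriesSB mulr_ge0 ?normc_ge0 // exprn_ge0 // ltW.
Qed.

Let poly_le N z : normc z < r -> normc (\sum_(0 <= n < N) a n * z ^+ n) <= L.
Proof.
move=> zr; apply: le_trans (S_le N); apply: le_trans (normc_sum _ _ _) _.
apply: ler_sum => n _; rewrite normcM normcX ler_wpM2l ?normc_ge0 //.
by rewrite lerXn2r ?nnegrE ?normc_ge0 // ltW.
Qed.

Let tail_le N z : normc z < r ->
  normc (f z - \sum_(0 <= n < N) a n * z ^+ n) <= L - S N.
Proof.
move=> zr; have H := ccvg_normc (ccvgB (fa zr) (ccvg_cst (\sum_(0 <= n < N) a n
  * z ^+ n))).
apply: (cvgr_to_le H); exists N => // N' /= NN'.
rewrite (big_cat_nat (leq0n _) NN') /= addrAC subrr add0r lerBrDr.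
apply: le_trans (S_le N');
  rewrite /S (big_cat_nat (leq0n _) NN') /= [leLHS]addrC lerD2l.
apply: le_trans (normc_sum _ _ _) _.
apply: ler_sum => n _; rewrite normcM normcX ler_wpM2l ?normc_ge0 //.
by rewrite lerXn2r ?nnegrE ?normc_ge0 // ltW.
Qed.

Let f_le z : normc z < r -> normc (f z) <= L.
Proof. by move=> zr; apply: ccvg_le (fa zr) _ => N; exact: poly_le. Qed.

Let abs2_dist N z : normc z < r ->
  `|abs2 (f z) - abs2 (\sum_(0 <= n < N) a n * z ^+ n)| <= (L - S N) * (2 * L).
Proof.
move=> zr; rewrite -!normc_sq subr_sqr normrM.
rewrite ler_pM // ?(le_trans (normc_triangleB _ _)) ?tail_le //.
by rewrite ger0_norm ?addr_ge0 ?normc_ge0 // mulr2n mulrDl mul1r lerD ?f_le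
  ?poly_le.
Qed.

Lemma power_series_abs2_nice : disk_nice r (fun z => abs2 (f z)).
Proof.
split.
  by apply: cmeasurable_abs2 power_series_cmeasurable; exact: measurable_disk.
exists (L ^+ 2) => z zr; rewrite ger0_norm ?abs2_ge0 // -normc_sq.
have := f_le zr; have := normc_ge0 (f z) => p q.
by rewrite lerXn2r // nnegrE (le_trans p).
Qed.

Let poly_nice N : disk_nice r (fun z => abs2 (\sum_(0 <= n < N) a n * z ^+ n)).
Proof.
rewrite (_ : (fun z => _) = fun z =>
  \sum_(0 <= j < N) \sum_(0 <= k < N) monomial (a j * (a k)^*) j k z).
  by do 2 apply: disk_nice_sum => ?; exact: disk_nice_monomial.
by apply/funext => z; exact: abs2_sum_monomial.
Qed.

(** Partial sums converge uniformly on the disk, so the identity for polynomials passes to the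
    limit: the error is at most a constant times the tail [L - S N]. *)
Lemma power_series_parseval :
  series (fun n => abs2 (a n) * disk_weight n r) @ \oo --> disk_integral r (fun
    z => abs2 (f z)).
Proof.
pose K := disk_integral r (fun=> 1).
have bound N : `|disk_integral r (fun z => abs2 (f z)) -
    series (fun n => abs2 (a n) * disk_weight n r) N| <= (L - S N) * (2 * L *
      K).
  rewrite /series /= -disk_integral_polynomial; set P := fun z =>
    abs2 (\sum_(_ <= _ < _) _).
  pose F := fun z => abs2 (f z); set c := (L - S N) * (2 * L).
  have nF : disk_nice r F := power_series_abs2_nice.
  have nP : disk_nice r P := poly_nice N.
  have nc : disk_nice r (fun=> 1) by exact: disk_nice_cst.
  have nc' : disk_nice r (fun z => c * 1) by exact: disk_niceZ.
  rewrite mulrA -/c -/F ler_distl; apply/andP; split.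
    rewrite lerBlDr -disk_integralZ // -disk_integralD //.
    apply: le_disk_integral => //; first exact: disk_niceD.
    move=> z zr; have := abs2_dist N zr; rewrite ler_distl => /andP[].
    by rewrite lerBlDr /= mulr1.
  rewrite -disk_integralZ // -disk_integralD //.
  apply: le_disk_integral => //; first exact: disk_niceD.
  by move=> z zr; have := abs2_dist N zr; rewrite ler_distl /= mulr1 => /andP[].
have e0 : (fun N => (L - S N) * (2 * L * K)) @ \oo --> (0 : R).
  rewrite -[0](mul0r (2 * L * K)); apply: cvgM; last exact: cvg_cst.
  have : (fun N => L - series (fun n =>
    normc (a n) * r ^+ n) N) @ \oo --> L - L.
    by apply: cvgB ca; exact: cvg_cst.
  by rewrite subrr.
apply/cvgrPdist_le => e e_gt0; have /cvgrPdist_le /(_ _ e_gt0) := e0.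
apply: filterS => N; rewrite sub0r normrN => H.
by apply: le_trans (bound N) (le_trans (ler_norm _) H).
Qed.

Lemma coefficient_disk_le n :
  abs2 (a n) * disk_weight n r <= disk_integral r (fun z => abs2 (f z)).
Proof.
have nn k : 0 <= abs2 (a k) * disk_weight k r by rewrite mulr_ge0 ?abs2_ge0 //
  ltW // disk_weight_gt0.
have := nondecreasing_cvgn_le _ (cvgP _ power_series_parseval) n.+1.
rewrite (cvg_lim _ power_series_parseval) // => H.
apply: le_trans (H _); last first.
  by apply/nondecreasing_seqP => k; rewrite -subr_ge0 seriesSB.
by rewrite /series /= big_nat_recr //= lerDr sumr_ge0.
Qed.

(** One term of Parseval's sum is at most the mean square of [f]. The factor [n.+2%:R] is the price
    of means over disks instead of circles; being linear, it can be absorbed by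
    [linear_growth_bounded]. *)
Lemma cauchy_estimate M n : 0 <= M -> (forall z, normc z < r -> normc (f z) <=
  M) ->
  normc (a n) * r ^+ n.+1 <= n.+2%:R * M.
Proof.
move=> M0 fM.
have H1 : disk_integral r (fun z => abs2 (f z)) <= M ^+ 2 * disk_weight 0 r.
  have -> : M ^+ 2 * disk_weight 0 r = disk_integral r (fun=> M ^+ 2).
    have := disk_integral_monomial_diag (M ^+ 2)%:C 0.
    rewrite /= => <-; congr disk_integral.
    by apply/funext => z; rewrite /monomial !expr0 !mulr1.
  apply: le_disk_integral => //;
    [exact: power_series_abs2_nice|exact: disk_nice_cst|].
  by move=> z zr; rewrite -normc_sq lerXn2r ?nnegrE ?normc_ge0 // fM.
have H2 := le_trans (coefficient_disk_le n) H1.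
have H3 : abs2 (a n) * (kappa * r ^+ (2 * n.+1) / (n.+1%:R * n.+2%:R)) <= M ^+
  2 * kappa.
  apply: le_trans (le_trans _ H2) _.
  - by rewrite ler_wpM2l ?abs2_ge0 // disk_weight_ge.
  - by rewrite ler_wpM2l ?sqr_ge0 // disk_weight0_le.
have {}H3 : abs2 (a n) * r ^+ (2 * n.+1) <= n.+1%:R * n.+2%:R * M ^+ 2.
  rewrite -(ler_pM2l kappa_gt0).
  have p0 : 0 < n.+1%:R * n.+2%:R :> R by rewrite mulr_gt0.
  move: H3; rewrite mulrA ler_pdivrMr // mulrCA => H3.
  by apply: le_trans H3 _; rewrite -[leLHS]mulrA [leLHS]mulrCA [in leLHS](mulrC
    (M ^+ 2)).
rewrite -ler_sqr ?nnegrE ?mulr_ge0 ?normc_ge0 ?exprn_ge0 ?(ltW r0) //.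
rewrite !exprMn normc_sq -exprM mulnC (le_trans H3) // ler_wpM2r ?sqr_ge0 //.
by rewrite expr2 ler_wpM2r // ler_nat.
Qed.

End function.
End fixed_radius.
End parseval.

(** * Analytic functions on the disk are power series *)

Section global_power_series.
Variable R : realType.
Implicit Types (a b : nat -> R[i]) (x z h l : R[i]) (r s t d e B : R) (f : R[i]
  -> R[i]).

Lemma psums_summable a f r e : 0 <= r -> r < e ->
  (forall z, normc z < e -> psums a z (f z)) ->
  cvgn (series (fun n => normc (a n) * r ^+ n)).
Proof.
move=> r0 re fa; pose s := (r + e) / 2.
have rs : r < s by rewrite /s; lra.
have se : s < e by rewrite /s; lra.
have s0 : 0 < s by apply: le_lt_trans rs.
have ns : normc s%:C = s by rewrite normc_real gtr0_norm.
have [B HB] := psums_bounded (fa s%:C (eq_ind_r (fun u => u < e) se ns)).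
apply: (bounded_summable (s := s) (B := B)) => // n; first exact: normc_ge0.
by have := HB n; rewrite ns.
Qed.

(** Cauchy's estimate with bound 0 for the series with coefficients [a n - b n], whose sum is the
    zero function near 0. *)
Lemma psums_coef_unique a b f e : 0 < e ->
  (forall h, normc h < e -> psums a h (f h)) ->
  (forall h, normc h < e -> psums b h (f h)) -> a = b.
Proof.
move=> e0 fa fb; pose r := Num.min (e / 2) 1.
have r0 : 0 < r by rewrite lt_min ltr01 divr_gt0.
have r1 : r <= 1 by rewrite ge_min lexx orbT.
have re : r < e by rewrite gt_min ltr_pdivrMr // ltr_pMr // ltr1n.
have H h : normc h < e -> psums (fun n => a n - b n) h 0.
  move=> he; rewrite /psums /csum -[X in ccvg _ X](subrr (f h)).
  apply: eq_ccvg (ccvgB (fa h he) (fb h he)) => n /=.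
  by rewrite -sumrB; apply: eq_bigr => k _; rewrite mulrBl.
apply/funext => n; apply/eqP; rewrite -subr_eq0; apply/eqP/eq0_normc/eqP.
rewrite eq_le normc_ge0 andbT -(pmulr_lle0 _ (exprn_gt0 n.+1 r0)).
have := @cauchy_estimate R r r0 r1 (fun n =>
  a n - b n) (fun=> 0) _ _ 0 n (lexx 0).
rewrite mulr0; apply.
- by move=> z zr; apply: H; exact: lt_trans re.
- by apply: psums_summable H => //; exact: ltW.
- by move=> z _; rewrite normc0.
Qed.

(** One number [d] serves as radius and, through [d^-1], as bound on the coefficients. The condition
    weakens as [d] decreases, so compactness has a single parameter to make uniform. *)
Definition expands f d x := exists2 b, (forall n, normc (b n) * d ^+ n <= d^-1)
  &
  forall h, normc h < d -> psums b h (f (x + h)).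

(** Re-expansion at [x'] keeps the radius [e / 4], and its coefficients are controlled by the
    absolute sum [B] at radius [e / 2], whatever [x'] near [x] is chosen. *)
Lemma expands_near f x e b : 0 < e ->
  (forall h, normc h < e -> psums b h (f (x + h))) ->
  exists2 d0, 0 < d0 & forall d x', 0 < d -> d <= d0 -> normc (x' - x) < d0 ->
    expands f d x'.
Proof.
move=> e0 fb; pose r := e / 2; pose t := e / 4.
have t0 : 0 < t by rewrite divr_gt0.
have sb : cvgn (series (fun n => normc (b n) * r ^+ n)).
  by apply: psums_summable fb; rewrite /r; lra.
pose B := limn (series (fun n => normc (b n) * r ^+ n)).
have term0 n u : 0 <= u -> 0 <= normc (b n) * u ^+ n.
  by move=> u0; rewrite mulr_ge0 ?normc_ge0 // exprn_ge0.
have r0 : 0 <= r by rewrite /r; lra.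
have HB N : \sum_(0 <= m < N) normc (b m) * r ^+ m <= B.
  apply: nondecreasing_cvgn_le sb N; apply/nondecreasing_seqP => n.
  by rewrite -subr_ge0 seriesSB term0.
have B0 : 0 <= B by have := HB 0%N; rewrite big_geq.
(* The second entry forces [d^-1] above [B]; adding 1 keeps it meaningful when [B] is 0. *)
exists (Num.min t (B + 1)^-1) => [|d x' d0].
  by rewrite lt_min t0 invr_gt0 ltr_wpDl.
rewrite le_min => /andP[dt dB]; rewrite lt_min => /andP[xt _].
set y := x' - x in xt.
have yt : 0 <= normc y + t by rewrite addr_ge0 ?normc_ge0 // ltW.
have ytr : normc y + t <= r by rewrite /r; move: xt; rewrite /t; lra.
have le1 n : normc (b n) * (normc y + t) ^+ n <= normc (b n) * r ^+ n.
  by rewrite ler_wpM2l ?normc_ge0 // lerXn2r // nnegrE.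
have [b' [_ b'B b'p]] : exists b', [/\ forall n, csum (reexp b y n) (b' n),
    forall B, (forall N, \sum_(0 <= m < N) normc (b m) * (normc y + t) ^+ m <=
      B) ->
      forall n, normc (b' n) * t ^+ n <= B &
    forall h l, normc h <= t -> psums b (y + h) l -> psums b' h l].
  apply: power_series_reexpansion => //.
  by apply: series_le_cvg sb => n //; exact: term0.
exists b' => [n|h hd].
  have H : normc (b' n) * t ^+ n <= B.
    by apply: b'B => N; apply: le_trans (HB N); apply: ler_sum => m _.
  apply: (@le_trans _ _ B).
    apply: le_trans H; rewrite ler_wpM2l ?normc_ge0 // lerXn2r ?nnegrE // ltW
      //.
  have B1 : 0 < B + 1 by rewrite ltr_wpDl.
  apply: (@le_trans _ _ (B + 1)); first by rewrite lerDl.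
  by rewrite -(invrK (B + 1)) lef_pV2 ?posrE ?invr_gt0.
apply: b'p; first by rewrite (le_trans (ltW hd)).
rewrite (_ : x' + h = x + (y + h)); last by rewrite addrA (addrC x) subrK.
apply: fb; apply: le_lt_trans (le_normcD _ _) _.
by move: xt; rewrite /t in dt *; lra.
Qed.

Lemma expands_coef f d x b e : expands f d x -> 0 < d -> 0 < e ->
  (forall h, normc h < e -> psums b h (f (x + h))) ->
  (forall n, normc (b n) * d ^+ n <= d^-1) /\
  forall h, normc h < d -> psums b h (f (x + h)).
Proof.
move=> [b' b'd b'p] d0 e0 bp; suff -> : b = b' by [].
apply: (@psums_coef_unique _ _ (fun h => f (x + h)) (Num.min d e)).
- by rewrite lt_min d0.
- by move=> h; rewrite lt_min => /andP[_ /bp].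
- by move=> h; rewrite lt_min => /andP[/b'p].
Qed.

Lemma exprn_le_limit (A B r : R) k : 0 < r ->
  (forall s, 0 < s -> s < r -> A * s ^+ k <= B) -> A * r ^+ k <= B.
Proof.
move=> r0 H; have [q [q01 cq]] := unit_seq R.
have c : (fun j => A * r ^+ k * q j ^+ k) @ \oo --> A * r ^+ k * 1.
  by apply: cvgM => //; exact: cvg_cst.
rewrite mulr1 in c; apply: (cvgr_to_le c); apply: nearW => j.
have /andP[q0 q1] := q01 j.
by rewrite -mulrA -exprMn; apply: H; rewrite ?mulr_gt0 // gtr_pMr.
Qed.

(** * Enlarging the disk on which the Taylor series at 0 represents the function *)

Section extension.
Variables (f : R[i] -> R[i]) (a : nat -> R[i]) (r d : R).
Hypotheses (r0 : 0 < r) (r1 : r <= 1) (d0 : 0 < d).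
Hypothesis fa : forall z, normc z < r -> psums a z (f z).
Hypothesis fd : forall x, normc x < r -> expands f d x.

(** Ties the local expansion at [z] to the series [a]. By uniqueness its coefficients are the
    re-expanded ones, so the same [b] works for every radius [t] at which [a] can be re-expanded. *)
Lemma expands_reexp z : normc z < r -> exists b,
  [/\ forall n, csum (reexp a z n) (b n), forall n, normc (b n) * d ^+ n <=
    d^-1,
    forall h, normc h < d -> psums b h (f (z + h)) &
    forall t, 0 < t -> cvgn (series (fun m =>
      normc (a m) * (normc z + t) ^+ m)) ->
      forall h l, normc h <= t -> psums a (z + h) l -> psums b h l].
Proof.
move=> zr; pose t := (r - normc z) / 2.
have t0 : 0 < t by rewrite /t; lra.
have nz := normc_ge0 z.
have st : cvgn (series (fun m => normc (a m) * (normc z + t) ^+ m)).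
  by apply: psums_summable fa; rewrite /t; lra.
have [b [bE _ bp]] := power_series_reexpansion t0 st.
have bf h : normc h < t -> psums b h (f (z + h)).
  move=> ht; apply: bp; first exact: ltW.
  apply: fa; apply: le_lt_trans (le_normcD _ _) _.
  by move: ht; rewrite /t; lra.
have [bd bfd] := expands_coef (fd zr) d0 t0 bf.
exists b; split; [exact: bE|exact: bd|exact: bfd|move=> u u0 su h l hu al].
have [b' [b'E _ b'p]] := power_series_reexpansion u0 su.
suff -> : b = b' by exact: b'p.
by apply/funext => n; exact: ccvg_unique (bE n) (b'E n).
Qed.

(** For fixed [n], the [n]-th Taylor coefficient at [z] is itself a power series in [z], with the
    coefficients on the left, and it is bounded by [d^-1 / d ^+ n] on the disk of radius [r].
    Cauchy's estimate applies to it. *)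
Lemma coef_binomial_bound n m :
  normc (a (m + n)%N *+ 'C(m + n, n)) * r ^+ m.+1 <= m.+2%:R * (d^-1 / d ^+ n).
Proof.
have [G HG] : {G : R[i] -> R[i] | forall z, normc z < r ->
    csum (reexp a z n) (G z) /\ normc (G z) * d ^+ n <= d^-1}.
  suff /choice[G HG] : forall z, exists l, normc z < r ->
      csum (reexp a z n) l /\ normc l * d ^+ n <= d^-1 by exists G.
  move=> z; case: (ltP (normc z) r) => zr; last by exists 0.
  by have [b [bE bd _ _]] := expands_reexp zr; exists (b n).
pose c m := a (m + n)%N *+ 'C(m + n, n).
have cG z : normc z < r -> psums c z (G z).
  move=> /HG[H _].
  apply: eq_ccvg (ccvg_subseq (k := addn^~ n) (fun N => leq_addr n N) H) =>
    N /=.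
  rewrite (big_cat_nat (leq0n n) (leq_addl N n)) /= big_nat_cond big1 ?add0r.
    rewrite -{1}[n]add0n big_addn addnK; apply: eq_bigr => k _.
    by rewrite /reexp addnK /c mulrnAl.
  by move=> k; rewrite andbT => /andP[_ kn]; rewrite /reexp bin_small.
apply: exprn_le_limit => // s s0 sr.
apply: (@cauchy_estimate R s s0 (le_trans (ltW sr) r1) c G).
- by move=> z zs; apply: cG; exact: lt_trans sr.
- by apply: psums_summable cG => //; exact: ltW.
- by rewrite divr_ge0 ?invr_ge0 ?exprn_ge0 // ltW.
- by move=> z zs; rewrite ler_pdivlMr ?exprn_gt0 //;
    have [] := HG z (lt_trans zs sr).
Qed.

(** Each of the [m.+1] terms of the binomial expansion is covered by [coef_binomial_bound]. This is
    the gain of radius, at a cost quadratic in [m]. *)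
Lemma coef_growth m :
  normc (a m) * (r + d) ^+ m * r <= m.+1%:R * (m.+2%:R * d^-1).
Proof.
rewrite exprDn mulr_sumr mulr_suml -[X in X%:R * (_ * _)](card_ord m.+1)
  mulr_natl.
rewrite -sumr_const; apply: ler_sum => -[n /= nm] _.
have nm' : (n <= m)%N by rewrite -ltnS.
have := coef_binomial_bound n (m - n); rewrite subnK // => H.
have dn : 0 < d ^+ n by rewrite exprn_gt0.
move: H; rewrite mulrA ler_pdivlMr // normcMn => H.
have -> : normc (a m) * (r ^+ (m - n) * d ^+ n *+ 'C(m, n)) * r =
    normc (a m) *+ 'C(m, n) * r ^+ (m - n).+1 * d ^+ n.
  rewrite mulrnAr !mulrnAl exprSr; congr (_ *+ _).
  by rewrite !mulrA -!mulrA; do 2 congr (_ * _); rewrite mulrC.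
apply: le_trans H _; rewrite ler_wpM2r ?invr_ge0 ?(ltW d0) //.
by rewrite ler_nat !ltnS leq_subr.
Qed.

Lemma power_series_extends z : normc z < r + d / 2 -> psums a z (f z).
Proof.
move=> zrd; case: (ltP (normc z) r) => [|rz]; first exact: fa.
(* [coef_growth] carries two linear factors. Each use of [linear_growth_bounded] removes one and
   shrinks the radius, from [r + d] to [r1'] and then to [r2], still beyond [r + d / 2]. *)
pose r1' := r + d * (7 / 8); pose r2 := r + d * (3 / 4).
have rd0 : 0 < r * d by rewrite mulr_gt0.
have [B HB] : exists B, forall m, normc (a m) * r1' ^+ m <= m.+2%:R * B.
  have [| | | |B HB] := @linear_growth_bounded R (fun m =>
    normc (a m) / m.+2%:R)
    r1' (r + d) (r * d)^-1; last 1 first.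
  - exists B => m; have := HB m.
    by rewrite mulrAC ler_pdivrMr ?ltr0n // [B * _]mulrC.
  - by move=> n; rewrite divr_ge0 ?normc_ge0 ?ler0n.
  - by rewrite /r1' addr_ge0 ?mulr_ge0 ?divr_ge0 // ltW.
  - by rewrite /r1' ltrD2l gtr_pMr //; lra.
  - move=> n; rewrite mulrAC ler_pdivrMr ?ltr0n // -(ler_pM2r r0).
    rewrite [leRHS](_ : _ = n.+1%:R * (n.+2%:R * d^-1)) ?coef_growth //.
    by field; rewrite !gt_eqF.
have B0 : 0 <= B.
  have := HB 0%N; rewrite expr0 mulr1 => H.
  by rewrite -(pmulr_rge0 B (ltr0n R 2)); apply: le_trans H; exact: normc_ge0.
have [| | | |B' HB'] := @linear_growth_bounded R (fun m => normc (a m))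
  r2 r1' (2 * B); last 1 first.
- have small s : 0 <= s -> s < r2 -> cvgn (series (fun m =>
    normc (a m) * s ^+ m)).
    by move=> s0 sr; apply: bounded_summable HB' => // n; exact: normc_ge0.
  (* The series now converges at [z], but its sum must be identified with [f z]. The point
     [c%:C * z] on the ray through [z], at depth [eta] inside the circle of radius [r], is less than
     [d] away from [z], and its modulus plus that distance is [normc z]. Hence the local expansion
     and the re-expansion of [a] both reach [z] from there, with the same coefficients. *)
  pose eta := Num.min (d / 4) (r / 2).
  have eta0 : 0 < eta by rewrite lt_min !divr_gt0.
  have etad : eta <= d / 4 by rewrite ge_min lexx.
  have etar : eta <= r / 2 by rewrite ge_min lexx orbT.
  have z0 : 0 < normc z by apply: lt_le_trans rz.
  pose c := (r - eta) / normc z.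
  have c0 : 0 < c by rewrite divr_gt0 //; lra.
  have nw : normc (c%:C * z) = r - eta.
    by rewrite normcM normc_real gtr0_norm // /c mulfVK // gt_eqF.
  have nzw : normc (z - c%:C * z) = normc z - (r - eta).
    rewrite (_ : z - c%:C * z = (1 - c)%:C * z); last first.
      by rewrite rmorphB /= mulrBl mul1r.
    rewrite normcM normc_real ger0_norm; last first.
      by rewrite subr_ge0 /c ler_pdivrMr // mul1r; lra.
    by rewrite mulrBl mul1r /c mulfVK // gt_eqF.
  have wr : normc (c%:C * z) < r by rewrite nw; lra.
  have [b [_ _ bf bt]] := expands_reexp wr.
  have hz : c%:C * z + (z - c%:C * z) = z by rewrite addrC subrK.
  have zd : normc z < r2 by rewrite /r2; lra.
  have sz : cvgn (series (fun m =>
      normc (a m) * (normc (c%:C * z) + normc (z - c%:C * z)) ^+ m)).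
    by apply: small; rewrite nw nzw; lra.
  have [l al] := summable_psums (lexx (normc z)) (small _ (ltW z0) zd).
  have bl : psums b (z - c%:C * z) l.
    apply: (bt (normc (z - c%:C * z))) => //; last by rewrite hz.
    by rewrite nzw; lra.
  have := bf (z - c%:C * z); rewrite hz nzw => /(_ _) bz.
  by rewrite (psums_unique (bz _) bl) //; lra.
- by move=> n; exact: normc_ge0.
- by rewrite /r2 addr_ge0 ?mulr_ge0 ?divr_ge0 // ltW.
- by rewrite /r2 /r1' ltrD2l ltr_pM2l //; lra.
- move=> n; apply: le_trans (HB n) _; rewrite mulrA ler_wpM2r // -natrM ler_nat.
  by rewrite muln2 -addnn addSn ltnS addnS ltnS leq_addr.
Qed.

End extension.

(** The radii [n.+1%:R^-1] turn the uniform choice of [d] into a property of all large [n], the form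
    in which compactness of the closed disk is applied. *)
Lemma expands_compact f r : 0 <= r ->
  (forall x, normc x <= r -> exists b e, 0 < e /\
    forall h, normc h < e -> psums b h (f (x + h))) ->
  exists2 d, 0 < d & forall x, normc x <= r -> expands f d x.
Proof.
move=> r0 H.
pose K : set (R * R) := [set p | norm2 p <= r ^+ 2].
have cK : compact K.
  apply: (@subclosed_compact _ _ (`[- r, r]%classic `*` `[- r, r]%classic)).
  - rewrite (_ : K = norm2 (R := R) @^-1` [set x | x <= r ^+ 2]) //.
    apply: closed_comp; last exact: closed_le.
    move=> p _; rewrite /norm2.
    by apply: cvgD; apply: (@continuous_comp _ _ _ _ (fun x : R => x ^+ 2)) ;
      [exact: cvg_fst|exact: exprn_continuous|exact: cvg_snd|exact:
        exprn_continuous].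
  - by apply: compact_setX; exact: segment_compact.
  - move=> [x y]; rewrite /K /norm2 /= => Kxy; rewrite !in_itv /= -!ler_norml.
    have X (u v : R) : u ^+ 2 + v ^+ 2 <= r ^+ 2 -> `|u| <= r.
      move=> uv; rewrite -(ger0_norm r0) -ler_sqr ?nnegrE ?normr_ge0 //.
      by rewrite !real_normK ?num_real // (le_trans _ uv) // lerDl sqr_ge0.
    by split; [apply: X Kxy|rewrite addrC in Kxy; apply: X Kxy].
have KP p : K p <-> normc (xy_to_C p) <= r.
  by rewrite /K /= -normc_xy ler_sqr ?nnegrE ?normc_ge0.
move/compact_near_coveringP : cK => /(_ nat \oo
  (fun n p => expands f n.+1%:R^-1 (xy_to_C p)) _) [|N _ HN].
  move=> p /KP pr; have [b [e [e0 bp]]] := H _ pr.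
  have [d0 d00 Hd] := expands_near e0 bp.
  have d2 : 0 < d0 / 2 by rewrite divr_gt0.
  (* Balls of the plane are squares here, and [normc] is at most the sum of the two coordinates,
     hence the half. *)
  exists (ball p (d0 / 2), [set n | n.+1%:R^-1 < d0]) => /=.
    split; first exact: nbhsx_ballx.
    have /cvgrPdist_lt /(_ _ d00) := @cvg_harmonic R.
    apply: filterS => n; rewrite /harmonic /= sub0r normrN gtr0_norm //.
  move=> [p' n] [/= [b1 b2] nd].
  apply: Hd; [by []|exact: ltW|].
  apply: le_lt_trans (normc_le_ReIm _) _.
  rewrite ReB ImB [d0]splitr /=; move: b1 b2; rewrite /ball /= => b1 b2.
  by rewrite ltrD // distrC.
exists N.+1%:R^-1 => // x xr.
have := HN N (leqnn N) (complex.Re x, complex.Im x).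
have E : xy_to_C (complex.Re x, complex.Im x) = x by case: x {xr}.
rewrite /= E; apply; apply/KP; rewrite E //.
Qed.

Theorem analytic_power_series f :
  (forall x, normc x < 1 -> exists b e, 0 < e /\
    forall h, normc h < e -> psums b h (f (x + h))) ->
  exists a, forall z, normc z < 1 -> psums a z (f z).
Proof.
move=> H; have [a [e [e0 ae]]] : exists b e, 0 < e /\
    forall h, normc h < e -> psums b h (f h).
  have [|b [e [e0 be]]] := H 0; first by rewrite normc0.
  by exists b, e; split => // h he; have := be h he; rewrite add0r.
(* The constraint [r <= 1] bounds the set and matches the range of radii in Cauchy's estimate. A
   supremum below 1 would leave a closed disk inside the unit disk, where [power_series_extends]
   gains [d / 2]. *)
exists a; pose E : set R := [set r | 0 < r /\ r <= 1 /\
  forall z, normc z < r -> psums a z (f z)].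
have E0 : E (Num.min e 1).
  split; first by rewrite lt_min e0 ltr01.
  split; first by rewrite ge_min lexx orbT.
  by move=> z; rewrite lt_min => /andP[/ae].
have supE : has_sup E.
  by split; [exists (Num.min e 1)|exists 1 => r [_ []]].
pose r := sup E.
have r0 : 0 < r.
  apply: (@lt_le_trans _ _ (Num.min e 1)); first by case: E0.
  by apply: sup_upper_bound.
have r1 : r <= 1 by apply: ge_sup; [exists (Num.min e 1)|move=> s [_ []]].
have ra z : normc z < r -> psums a z (f z).
  move=> zr; have : 0 < r - normc z by rewrite subr_gt0.
  move=> /sup_adherent /(_ supE)[s [_ [_ Hs]]];
    rewrite opprB addrCA subrr addr0.
  exact: Hs.
suff <- : r = 1 by [].
apply/eqP; rewrite eq_le r1 leNgt; apply/negP => lt1.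
have [d d0 Hd] : exists2 d, 0 < d & forall x, normc x <= r -> expands f d x.
  by apply: expands_compact (ltW r0) _ => x xr; apply: H;
    exact: le_lt_trans lt1.
have ext := power_series_extends r0 r1 d0 ra (fun x xr => Hd x (ltW xr)).
have : E (Num.min (r + d / 2) 1).
  split; first by rewrite lt_min ltr01 andbT; lra.
  split; first by rewrite ge_min lexx orbT.
  by move=> z; rewrite lt_min => /andP[/ext].
move=> /(sup_upper_bound supE); rewrite -/r leNgt => /negP; apply.
by rewrite lt_min lt1 andbT; lra.
Qed.

End global_power_series.

(** * Taylor coefficients of Bergman functions *)

Section bergman_coefficients.
Variable R : realType.
Local Notation area := ((@lebesgue_measure R) \x (@lebesgue_measure R))%E.
Implicit Types (z h : R[i]) (a b : nat -> R[i]) (F : R[i] -> R[i]) (f g :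
  bergman R).

Lemma unit_diskE z : unit_disk z <-> normc z < 1.
Proof. by rewrite /unit_disk /= norm_normc ltcR. Qed.

Lemma local_expansionP (F : R[i] -> R[i]^o) (x : R[i]) :
  (exists b : nat -> R[i], \forall z \near (x : R[i]^o),
    series (fun n => b n * (z - x) ^+ n : R[i]^o) @ \oo --> F z) <->
  (exists b e, 0 < e /\ forall h, normc h < e -> psums b h (F (x + h))).
Proof.
split => -[b].
  move=> /nbhs_ballP[[e e'] /=]; rewrite ltcE /= => /andP[/eqP-> e0] H.
  exists b, e; split => // h he.
  have /H : ball (x : R[i]^o) (e%:C) (x + h).
    by rewrite -ball_normE /= opprD addNKr normrN norm_normc ltcR.
  by rewrite addrC addKr => /ccvgP.
move=> [e [e0 H]]; exists b; apply/nbhs_ballP; exists e%:C;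
  first by rewrite /= ltcR.
move=> z; rewrite -ball_normE /= norm_normc ltcR normcB => /H.
by rewrite (addrC x) subrK => ?; apply/ccvgP.
Qed.

Lemma bergman_power_series f :
  exists a, forall z, normc z < 1 -> psums a z (val f z).
Proof.
apply: analytic_power_series => x x1.
have := valP f; rewrite inE => -[_ fA _].
by apply/local_expansionP; apply: fA; exact/unit_diskE.
Qed.

Definition coef f : nat -> R[i] := projT1 (cid (bergman_power_series f)).

Lemma coefP f z : normc z < 1 -> psums (coef f) z (val f z).
Proof. exact: (projT2 (cid (bergman_power_series f))). Qed.

Lemma coef_unique f a : (forall z, normc z < 1 -> psums a z (val f z)) -> coef
  f = a.
Proof. by move=> H; apply: (psums_coef_unique ltr01) H => z; exact: coefP. Qed.

Lemma coef_lin c f g n : coef (c *: f + g) n = c * coef f n + coef g n.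
Proof.
suff -> : coef (c *: f + g) = fun n => c * coef f n + coef g n by [].
apply: coef_unique => z z1.
apply: eq_ccvg (ccvgD (ccvgZ c (coefP f z1)) (coefP g z1)) => N /=.
by rewrite mulr_sumr -big_split; apply: eq_bigr => k _; rewrite /= mulrDl mulrA.
Qed.

Lemma coef_inj f g : coef f = coef g -> f = g.
Proof.
move=> E; apply/val_inj/funext => z.
case: (ltP (normc z) 1) => z1.
  by apply: psums_unique (coefP f z1) _; rewrite E; exact: coefP.
have H (k : bergman R) : val k z = 0.
  have := valP k; rewrite inE => -[k0 _ _].
  by apply: k0 => /unit_diskE; rewrite ltNge z1.
by rewrite !H.
Qed.

Definition coef_weight n : R := disk_weight n (1 : R).

Local Notation w := coef_weight.

Lemma coef_weightE n : w n = kappa R / (n.+1%:R * n.+2%:R).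
Proof.
rewrite /coef_weight /disk_weight !expr1n; congr (_ * _).
have -> : n.+2%:R = n.+1%:R + 1 :> R by rewrite -natr1.
by field; rewrite nat1r natr1 !pnatr_eq0.
Qed.

Lemma coef_weight_gt0 n : 0 < w n.
Proof. by rewrite coef_weightE divr_gt0 ?kappa_gt0 // mulr_gt0 ?ltr0Sn. Qed.

(** Monotonicity in the radius is hidden in the difference. It amounts to [(1 - x ^+ k) / k]
    decreasing in [k], and this is [1 - x] times the mean of the decreasing powers [x ^+ i] for
    [i < k]. *)
Lemma disk_weight_le n r : 0 < r -> r <= 1 -> disk_weight n r <= w n.
Proof.
move=> r0 r1; rewrite /coef_weight /disk_weight ler_wpM2l ?(ltW (kappa_gt0 R))
  // !exprM !expr1n.
set x := r ^+ 2.
have x0 : 0 <= x by rewrite sqr_ge0.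
have x1 : x <= 1 by rewrite exprn_ile1 // ltW.
have S : n.+1%:R * x ^+ n.+1 <= \sum_(i < n.+1) x ^+ i.
  have -> : n.+1%:R * x ^+ n.+1 = \sum_(i < n.+1) x ^+ n.+1.
    by rewrite sumr_const card_ord mulr_natl.
  by apply: ler_sum => i _; rewrite ler_wiXn2l // ltnW.
have E k : 1 - x ^+ k = (1 - x) * \sum_(i < k) x ^+ i.
  by rewrite -opprB subrX1 -mulNr opprB.
have H : (1 - x ^+ n.+2) / n.+2%:R <= (1 - x ^+ n.+1) / n.+1%:R.
  rewrite !E -!mulrA ler_wpM2l ?subr_ge0 // big_ord_recr /=.
  rewrite ler_pdivrMr ?ltr0n // mulrAC ler_pdivlMr ?ltr0n //.
  by rewrite -[n.+2%:R]natr1 mulrDr mulrDl mulr1 lerD2l mulrC.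
move: H; rewrite !mulrBl.
move: (x ^+ n.+1 / _) (x ^+ n.+2 / _) (1 / n.+1%:R) (1 / n.+2%:R) => A B C D;
  lra.
Qed.

(** Extended-real, so that it makes sense before [F] is known to be square integrable. *)
Definition disk_norm2 F : \bar R :=
  (\int[area]_(p in unit_disk2 (R := R)) (abs2 (F (xy_to_C p)) * weight
    p)%:E)%E.

(** * Parseval's identity on the unit disk, where the series need not converge uniformly *)

Section parseval_unit_disk.
Variables (a : nat -> R[i]) (F : R[i] -> R[i]).
Hypothesis Fa : forall z, normc z < 1 -> psums a z (F z).

Lemma unit_disk_cmeasurable : cmeasurable (unit_disk2 (R := R)) F.
Proof.
rewrite unit_disk2_disk.
exact: (@power_series_cmeasurable R 1 ltr01 a F Fa).
Qed.

Let mF : measurable_fun (unit_disk2 (R := R))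
  (fun p => (abs2 (F (xy_to_C p)) * weight p)%:E).
Proof.
apply/measurable_EFinP; apply: measurable_funM; last exact: measurable_weight.
by apply: cmeasurable_abs2 unit_disk_cmeasurable; exact: measurable_unit_disk2.
Qed.

Let F0 p : unit_disk2 p -> (0 <= (abs2 (F (xy_to_C p)) * weight p)%:E)%E.
Proof. by move=> Dp; rewrite lee_fin mulr_ge0 ?abs2_ge0 ?weight_ge0. Qed.

Let sub r : 0 < r -> r < 1 -> disk r `<=` unit_disk2 (R := R).
Proof. by move=> r0 r1; rewrite unit_disk2_disk; apply: disk_sub;
  exact: ltW. Qed.

Let small r : 0 < r -> r < 1 -> cvgn (series (fun n => normc (a n) * r ^+ n)).
Proof. by move=> r0 r1; apply: psums_summable Fa => //; exact: ltW. Qed.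

Let parseval r : 0 < r -> r < 1 ->
  series (fun n => abs2 (a n) * disk_weight n r) @ \oo --> disk_integral r (fun
    z => abs2 (F z)).
Proof.
move=> r0 r1; apply: power_series_parseval (small r0 r1) => //;
  first exact: ltW.
by move=> z zr; apply: Fa; exact: lt_trans zr r1.
Qed.

Let nice r : 0 < r -> r < 1 -> disk_nice r (fun z => abs2 (F z)).
Proof.
move=> r0 r1; apply: power_series_abs2_nice (small r0 r1) => //.
by move=> z zr; apply: Fa; exact: lt_trans zr r1.
Qed.

Let integralE r : 0 < r -> r < 1 ->
  (\int[area]_(p in disk r) (abs2 (F (xy_to_C p)) * weight p)%:E =
   (disk_integral r (fun z => abs2 (F z)))%:E)%E.
Proof.
move=> r0 r1; rewrite /disk_integral /Rintegral fineK //.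
apply: integrable_fin_num; first exact: measurable_disk.
exact: disk_nice_integrable r0 (ltW r1) _ (nice r0 r1).
Qed.

(** Monotone convergence along disks of radius tending to 1; on each of them the weights in
    Parseval's identity are at most [w n]. *)
Lemma disk_norm2_le B :
  (forall N, \sum_(0 <= n < N) abs2 (a n) * w n <= B) -> (disk_norm2 F <=
    B%:E)%E.
Proof.
move=> HB; pose r (k : nat) : R := 1 - k.+2%:R^-1.
have r01 k : 0 < r k /\ r k < 1.
  by rewrite subr_gt0 invf_lt1 // ltr1n gtrBl invr_gt0 ltr0Sn.
have rnd j k : (j <= k)%N -> r j <= r k.
  by move=> jk; rewrite lerD2l lerN2 lef_pV2 ?posrE // ler_nat !ltnS.
have U : \bigcup_k disk (r k) = unit_disk2 (R := R).
  apply/seteqP; split => [p [k _]|p]; first by have [? ?] := r01 k; exact: sub.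
  rewrite unit_disk2_disk => /(diskE _ ltr01) p1.
  have e0 : 0 < 1 - normc (xy_to_C p) by rewrite subr_gt0.
  have /cvgrPdist_lt /(_ _ e0) := @cvg_harmonic R.
  move=> [N _ /(_ N.+1 (leqnSn N))] /=; rewrite sub0r normrN gtr0_norm // => H.
  exists N => //; apply/diskE; first by have [] := r01 N.
  by rewrite /r ltrBrDr addrC -ltrBrDr.
have H : (\int[area]_(p in disk (r k)) (abs2 (F (xy_to_C p)) * weight p)%:E @[k
  --> \oo] -->
    \int[area]_(p in \bigcup_k disk (r k)) (abs2 (F (xy_to_C p)) * weight
      p)%:E)%E.
  apply: ge0_nondecreasing_set_cvg_integral.
  - move=> j k jk; rewrite subsetEset; apply: disk_sub; last exact: rnd.
    by have [/ltW] := r01 j.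
  - by move=> k; exact: measurable_disk.
  - move=> k; apply: measurable_funS mF; first exact: measurable_unit_disk2.
    by have [? ?] := r01 k; exact: sub.
  - move=> k p Dp; apply: F0; have [? ?] := r01 k; exact: sub Dp.
rewrite /disk_norm2 -U -(cvg_lim _ H) //.
apply: lime_le; first by apply/cvg_ex; eexists; exact: H.
apply: nearW => k; have [k0 k1] := r01 k.
rewrite integralE // lee_fin.
apply: (cvgr_to_le (parseval k0 k1)); apply: nearW => N.
apply: le_trans (HB N); apply: ler_sum => n _.
by rewrite ler_wpM2l ?abs2_ge0 // disk_weight_le // ltW.
Qed.

(** With [N] fixed, the radius tends to 1 inside a finite sum, so no two limits are exchanged. *)
Lemma disk_norm2_ge N : (disk_norm2 F < +oo)%E ->
  \sum_(0 <= n < N) abs2 (a n) * w n <= fine (disk_norm2 F).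
Proof.
move=> Flty; have F_ge0 : (0 <= disk_norm2 F)%E by apply: integral_ge0 => p;
  exact: F0.
have Ffin : disk_norm2 F \is a fin_num by rewrite ge0_fin_numE.
have le r : 0 < r -> r < 1 -> \sum_(0 <= n < N) abs2 (a n) * disk_weight n r <=
  fine (disk_norm2 F).
  move=> r0 r1.
  have nd : nondecreasing_seq (series (fun n => abs2 (a n) * disk_weight n r)).
    apply/nondecreasing_seqP => n; rewrite -subr_ge0 seriesSB.
    by rewrite mulr_ge0 ?abs2_ge0 // ltW // disk_weight_gt0 // ltW.
  have P := parseval r0 r1.
  have := nondecreasing_cvgn_le nd (cvgP _ P) N; rewrite (cvg_lim _ P) // => H1.
  apply: le_trans H1 _; rewrite -lee_fin -(integralE r0 r1) fineK //.
  apply: ge0_subset_integral => //.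
  - exact: measurable_disk.
  - exact: measurable_unit_disk2.
  - exact: sub.
have [q [q01 cq]] := unit_seq R.
have cw n : (fun k => disk_weight n (q k)) @ \oo --> w n.
  rewrite /coef_weight /disk_weight; apply: cvgM; first exact: cvg_cst.
  rewrite !expr1n; apply: cvgB; (apply: cvgM; last exact: cvg_cst); exact: cq.
have c : (fun k => \sum_(0 <= n < N) abs2 (a n) * disk_weight n (q k)) @ \oo -->
    \sum_(0 <= n < N) abs2 (a n) * w n.
  apply: (@cvg_sum_seq R _ (index_iota 0 N) (fun n k =>
    abs2 (a n) * disk_weight n (q k))
    (fun n => abs2 (a n) * w n)) => n.
  by apply: cvgM => //; exact: cvg_cst.
apply: (cvgr_to_le c); apply: nearW => k.
by have /andP[q0 q1] := q01 k; exact: le.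
Qed.

Lemma disk_norm2_cvg : (disk_norm2 F < +oo)%E ->
  series (fun n => abs2 (a n) * w n) @ \oo --> fine (disk_norm2 F).
Proof.
move=> Flty; have F_ge0 : (0 <= disk_norm2 F)%E by apply: integral_ge0 => p;
  exact: F0.
have Ffin : disk_norm2 F \is a fin_num by rewrite ge0_fin_numE.
have nd : nondecreasing_seq (series (fun n => abs2 (a n) * w n)).
  apply/nondecreasing_seqP => n; rewrite -subr_ge0 seriesSB.
  by rewrite mulr_ge0 ?abs2_ge0 // ltW // coef_weight_gt0.
have ub : ubound (range (series (fun n =>
  abs2 (a n) * w n))) (fine (disk_norm2 F)).
  by move=> _ [N _ <-]; exact: disk_norm2_ge.
have cs : cvgn (series (fun n => abs2 (a n) * w n)).
  by apply: nondecreasing_is_cvgn => //; exists (fine (disk_norm2 F)).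
suff <- : limn (series (fun n => abs2 (a n) * w n)) = fine (disk_norm2 F) by [].
apply/eqP; rewrite eq_le; apply/andP; split.
  by apply: limr_le => //; apply: nearW => N; exact: disk_norm2_ge.
rewrite -lee_fin fineK //; apply: disk_norm2_le => N.
exact: nondecreasing_cvgn_le.
Qed.

End parseval_unit_disk.

Definition sqnorm f : R := complex.Re (bergman_dot f f).

Lemma val_L2 f : L2_A1 (val f).
Proof. by have := valP f; rewrite inE => -[_ _]. Qed.

Lemma sqnormE f : sqnorm f = fine (disk_norm2 (val f)).
Proof.
rewrite /sqnorm /bergman_dot /integral_A1 /= /Rintegral /disk_norm2; congr fine.
apply: eq_integral => p _; congr (_ * _)%:E.
by case: (val f _) => x y; rewrite /abs2 /= !expr2 mulrN opprK.
Qed.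

Lemma sqnorm_cvg f : series (fun n => abs2 (coef f n) * w n) @ \oo --> sqnorm f.
Proof.
rewrite sqnormE; apply: disk_norm2_cvg; first exact: coefP.
by have [] := val_L2 f.
Qed.

Lemma sqnorm_ge f N : \sum_(0 <= n < N) abs2 (coef f n) * w n <= sqnorm f.
Proof.
rewrite sqnormE; apply: disk_norm2_ge; first exact: coefP.
by have [] := val_L2 f.
Qed.

(** The weights decay like [n ^- 2], so the coefficients grow at most linearly. *)
Lemma coef_summable a B : (forall N, \sum_(0 <= n < N) abs2 (a n) * w n <= B) ->
  forall r, 0 <= r -> r < 1 -> cvgn (series (fun n => normc (a n) * r ^+ n)).
Proof.
move=> HB r r0 r1; have K0 := kappa_gt0 R.
have B0 : 0 <= B by have := HB 0%N; rewrite big_geq.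
pose B' := Num.sqrt (B / kappa R).
have B'0 : 0 <= B' by exact: sqrtr_ge0.
have H n : normc (a n) * 1 ^+ n <= n.+1%:R * (2 * B').
  rewrite expr1n mulr1; apply: (@le_trans _ _ (n.+2%:R * B')); last first.
    by rewrite mulrA ler_wpM2r // -natrM ler_nat; lia.
  rewrite -ler_sqr ?nnegrE ?normc_ge0 ?mulr_ge0 // exprMn sqr_sqrtr ?divr_ge0
    ?(ltW K0) //.
  rewrite normc_sq.
  have : abs2 (a n) * w n <= B.
    apply: le_trans (HB n.+1); rewrite big_nat_recr //= lerDr sumr_ge0 // =>
      k _.
    by rewrite mulr_ge0 ?abs2_ge0 // ltW // coef_weight_gt0.
  rewrite coef_weightE mulrA ler_pdivrMr ?mulr_gt0 ?ltr0Sn // -ler_pdivlMr //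
    => H.
  apply: le_trans H _; rewrite mulrAC mulrC ler_wpM2r ?divr_ge0 ?(ltW K0) //.
  by rewrite expr2 ler_wpM2r // ler_nat.
pose s := (r + 1) / 2.
have [| | | |B'' HB''] := @linear_growth_bounded R (fun n =>
  normc (a n)) s 1 (2 * B').
- by move=> n; exact: normc_ge0.
- by rewrite /s; lra.
- by rewrite /s; lra.
- exact: H.
- apply: (bounded_summable (s := s) (B := B'')) => //; last by rewrite /s; lra.
  by move=> n; exact: normc_ge0.
Qed.

(** The Riesz-Fischer half of the identification with a weighted l^2 space; [basis_vector], [opT]
    and [opS] are all obtained from it. *)
Lemma exists_bergman a B : (forall N, \sum_(0 <= n < N) abs2 (a n) * w n <= B)
  ->
  exists f, coef f = a.
Proof.
move=> HB; have sm := coef_summable HB.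
have /choice[F HF] : forall z, exists l : R[i]^o,
    (normc z < 1 -> psums a z l) /\ (~ normc z < 1 -> l = 0).
  move=> z; case: (ltP (normc z) 1) => z1; last by exists 0.
  have [l Hl] := summable_psums (lexx _) (sm _ (normc_ge0 z) z1).
  by exists l; split => // /(_ isT).
have Fa z : normc z < 1 -> psums a z (F z) by case: (HF z).
have bF : F \in bergman_fun (R := R).
  rewrite inE; split.
  - by move=> z nz; apply: (HF z).2 => z1; apply: nz; exact/unit_diskE.
  - move=> x /unit_diskE x1; apply/local_expansionP.
    pose t := (1 - normc x) / 2.
    have t0 : 0 < t by rewrite /t; lra.
    have nx := normc_ge0 x.
    have [|b [_ _ bp]] := @power_series_reexpansion R a x t t0.
      by apply: sm; rewrite /t; lra.
    exists b, t; split => // h ht; apply: bp; first exact: ltW.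
    apply: Fa; apply: le_lt_trans (le_normcD _ _) _.
    by move: ht; rewrite /t; lra.
  - have [mr mi] := unit_disk_cmeasurable Fa.
    split => //; apply: le_lt_trans (disk_norm2_le Fa HB) _; exact: ltry.
by exists (exist _ F bF); apply: coef_unique.
Qed.

End bergman_coefficients.

(** * The inner product in terms of coefficients *)

Section bergman_inner_product.
Variable R : realType.
Local Notation area := ((@lebesgue_measure R) \x (@lebesgue_measure R))%E.
Local Notation H := (bergman R).
Local Notation dot := (@bergman_dot R).
Implicit Types (z c : R[i]) (f g : H).

Lemma val_lin c f g z : val (c *: f + g) z = c * val f z + val g z.
Proof. by []. Qed.

Lemma sqnorm_integrable f : area.-integrable (unit_disk2 (R := R))
  (EFin \o (fun p => abs2 (val f (xy_to_C p)) * weight p)).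
Proof.
have [mr mi lty] := val_L2 f; apply/integrableP; split.
  apply/measurable_EFinP; apply: measurable_funM; last exact: measurable_weight.
  exact: measurable_abs2.
apply: le_lt_trans lty; rewrite le_eqVlt; apply/orP; left; apply/eqP.
apply: eq_integral => p; rewrite inE => Dp /=.
by rewrite ger0_norm // mulr_ge0 ?abs2_ge0 ?weight_ge0.
Qed.

Lemma sqnorm_Rintegral f : sqnorm f =
  \int[area]_(p in unit_disk2 (R := R)) (abs2 (val f (xy_to_C p)) * weight p).
Proof. by rewrite sqnormE. Qed.

(** [c = 1] yields the real part of the inner product and [c = 'i] its imaginary part; as a
    difference of two squares, the mixed integrand inherits integrability from the norms. *)
Lemma abs2_polarization c (u v : R[i]) : complex.Re (u * (c * v)^*) =
  4^-1 * (abs2 (c * v + u) - abs2 (- c * v + u)).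
Proof.
rewrite mulNr; case: (c * v) => x y; case: u => x' y'.
by rewrite /abs2 /= !expr2; field.
Qed.

Lemma sqnorm_polarization c f g :
  4^-1 * (sqnorm (c *: g + f) - sqnorm (- c *: g + f)) =
  \int[area]_(p in unit_disk2 (R := R))
    (complex.Re (val f (xy_to_C p) * (c * val g (xy_to_C p))^*) * weight p).
Proof.
rewrite !sqnorm_Rintegral -RintegralB; last 3 first.
- exact: measurable_unit_disk2.
- exact: sqnorm_integrable.
- exact: sqnorm_integrable.
rewrite -RintegralZl; last 2 first.
- exact: measurable_unit_disk2.
- rewrite (_ : EFin \o _ =
    (EFin \o (fun p => abs2 (val (c *: g + f) (xy_to_C p)) * weight p)%R) \-
    (EFin \o (fun p => abs2 (val (- c *: g + f) (xy_to_C p)) * weight p)%R))%E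
      //.
  by apply: integrableB; [exact: measurable_unit_disk2|exact:
    sqnorm_integrable..].
by apply: eq_Rintegral => p _; rewrite -mulrBl mulrA abs2_polarization !val_lin.
Qed.

Lemma Re_bergman_dot f g :
  complex.Re (dot f g) = 4^-1 * (sqnorm (1 *: g + f) - sqnorm (- 1 *: g + f)).
Proof.
by rewrite sqnorm_polarization; apply: eq_Rintegral => p _; rewrite mul1r.
Qed.

Lemma Im_mul_conj (u v : R[i]) : complex.Im (u * v^*) = complex.Re (u * ('i%C *
  v)^*).
Proof. by case: u => ? ?; case: v => ? ? /=; ring. Qed.

Lemma Im_bergman_dot f g :
  complex.Im (dot f g) = 4^-1 * (sqnorm ('i%C *: g + f) - sqnorm (- 'i%C *: g +
    f)).
Proof.
by rewrite sqnorm_polarization; apply: eq_Rintegral => p _; rewrite Im_mul_conj.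
Qed.

Lemma polarized_sum_cvg c f g :
  (fun N => \sum_(0 <= n < N) complex.Re (coef f n * (c * coef g n)^*) *
    coef_weight R n) @ \oo -->
  4^-1 * (sqnorm (c *: g + f) - sqnorm (- c *: g + f)).
Proof.
pose S h := series (fun n => abs2 (coef h n) * coef_weight R n).
have L : (fun N => 4^-1 * (S (c *: g + f) N - S (- c *: g + f) N)) @ \oo -->
    4^-1 * (sqnorm (c *: g + f) - sqnorm (- c *: g + f)).
  by apply: cvgM; [exact: cvg_cst|apply: cvgB; exact: sqnorm_cvg].
suff <- : (fun N => 4^-1 * (S (c *: g + f) N - S (- c *: g + f) N)) =
  (fun N => \sum_(0 <= n < N) complex.Re (coef f n * (c * coef g n)^*) *
    coef_weight R n) by [].
apply/funext => N; rewrite /S /series /= -sumrB mulr_sumr; apply: eq_bigr =>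
  n _.
by rewrite -mulrBl mulrA abs2_polarization !coef_lin.
Qed.

Lemma Re_realM (x : R) z : complex.Re (x%:C * z) = x * complex.Re z.
Proof. by case: z => ? ? /=; rewrite mul0r subr0. Qed.

Lemma Im_realM (x : R) z : complex.Im (x%:C * z) = x * complex.Im z.
Proof. by case: z => ? ? /=; rewrite mul0r addr0. Qed.

(** The passage from integrals to coefficients: linearity and symmetry of [bergman_dot] are read off
    from this series. *)
Lemma bergman_dot_csum f g :
  csum (fun n => (coef_weight R n)%:C * (coef f n * (coef g n)^*)) (dot f g).
Proof.
apply: ccvg_ReIm.
  rewrite Re_bergman_dot.
  suff -> : (fun N => complex.Re (\sum_(0 <= n < N) (coef_weight R n)%:C *
    (coef f n * (coef g n)^*))) =
    (fun N => \sum_(0 <= n < N) complex.Re (coef f n * (1 * coef g n)^*) *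
      coef_weight R n).
    exact: polarized_sum_cvg.
  by apply/funext => N; rewrite Re_sum; apply: eq_bigr => n _;
    rewrite mul1r Re_realM mulrC.
rewrite Im_bergman_dot.
suff -> : (fun N => complex.Im (\sum_(0 <= n < N) (coef_weight R n)%:C * (coef
  f n * (coef g n)^*))) =
  (fun N => \sum_(0 <= n < N) complex.Re (coef f n * ('i%C * coef g n)^*) *
    coef_weight R n).
  exact: polarized_sum_cvg.
by apply/funext => N; rewrite Im_sum; apply: eq_bigr => n _;
  rewrite -Im_mul_conj Im_realM mulrC.
Qed.

Lemma dot_lin c f g h : dot (c *: f + g) h = c * dot f h + dot g h.
Proof.
apply: ccvg_unique (bergman_dot_csum _ _) _.
apply: eq_ccvg (ccvgD (ccvgZ c (bergman_dot_csum f h)) (bergman_dot_csum g h))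
  => N /=.
rewrite mulr_sumr -big_split; apply: eq_bigr => n _ /=; rewrite coef_lin.
by rewrite mulrCA -mulrDr mulrDl mulrA.
Qed.

Lemma ccvg_conj (u : nat -> R[i]) l : ccvg u l -> ccvg (fun n => (u n)^*) l^*.
Proof.
have E n : normc ((u n)^* - l^*) = normc (u n - l) by rewrite -[RHS]normc_conj
  rmorphB.
by rewrite /ccvg; under [X in _ -> X]eq_cvg do rewrite E.
Qed.

Lemma dot_conj f g : dot g f = (dot f g)^*.
Proof.
apply: ccvg_unique (bergman_dot_csum _ _) _.
apply: eq_ccvg (ccvg_conj (bergman_dot_csum f g)) => N /=.
rewrite rmorph_sum; apply: eq_bigr => n _ /=.
by rewrite !rmorphM /= conjcK oppr0 [coef g n * _]mulrC.
Qed.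

End bergman_inner_product.

(** * The Hilbert space of coefficients *)

Section bergman_hilbert.
Variable R : realType.
Local Notation H := (bergman R).
Local Notation dot := (@bergman_dot R).
Implicit Types (c : R[i]) (f g h : H).

Lemma dotZl c f h : dot (c *: f) h = c * dot f h.
Proof.
have dot0 : dot 0 h = 0.
  by have := dot_lin (-1) 0 0 h; rewrite scaler0 addr0 mulN1r addNr.
by have := dot_lin c f 0 h; rewrite addr0 dot0 addr0.
Qed.

Lemma dotDl f g h : dot (f + g) h = dot f h + dot g h.
Proof. by have := dot_lin 1 f g h; rewrite scale1r mul1r. Qed.

Lemma dotBl f g h : dot (f - g) h = dot f h - dot g h.
Proof. by rewrite dotDl -scaleN1r dotZl mulN1r. Qed.

Lemma dot0l h : dot 0 h = 0.
Proof. by rewrite -(scale0r 0) dotZl mul0r. Qed.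

Lemma dot_suml I (r : seq I) (F : I -> H) h :
  dot (\sum_(i <- r) F i) h = \sum_(i <- r) dot (F i) h.
Proof.
by elim: r => [|i r IH]; rewrite ?big_nil ?dot0l // !big_cons dotDl IH.
Qed.

Lemma dotDr f g h : dot h (f + g) = dot h f + dot h g.
Proof. by rewrite dot_conj dotDl conjD -!dot_conj. Qed.

Lemma dotZr c f h : dot h (c *: f) = conjc c * dot h f.
Proof. by rewrite dot_conj dotZl conjM -dot_conj. Qed.

Lemma dotBr f g h : dot h (f - g) = dot h f - dot h g.
Proof. by rewrite dot_conj dotBl conjB -!dot_conj. Qed.

Lemma dot_sumr I (r : seq I) (F : I -> H) h :
  dot h (\sum_(i <- r) F i) = \sum_(i <- r) dot h (F i).
Proof.
by rewrite dot_conj dot_suml conj_sum; apply: eq_bigr => i _; rewrite -dot_conj.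
Qed.

Lemma dot_sqnorm f : dot f f = (sqnorm f)%:C.
Proof.
have := dot_conj f f; rewrite /sqnorm; case: (dot f f) => x y [] /eqP.
by rewrite -subr_eq0 opprK -mulr2n mulrn_eq0 => /eqP ->.
Qed.

Lemma sqnorm_ge0 f : 0 <= sqnorm f.
Proof. by have := sqnorm_ge f 0; rewrite big_geq //. Qed.

Lemma sqnormD f g : sqnorm (f + g) = sqnorm f + sqnorm g + 2 * complex.Re (dot
  f g).
Proof.
rewrite /sqnorm !dotDl !dotDr (dot_conj f g).
by case: (dot f f) => ? ?; case: (dot g g) => ? ?; case: (dot f g) => ? ? /=;
  ring.
Qed.

Lemma sqnormZ c f : sqnorm (c *: f) = abs2 c * sqnorm f.
Proof.
rewrite {1}/sqnorm dotZl dotZr dot_sqnorm mulrA.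
by case: c => x y; rewrite /abs2 /=; ring.
Qed.

Lemma sqnormN f : sqnorm (- f) = sqnorm f.
Proof. by rewrite -scaleN1r sqnormZ /abs2 /= oppr0 sqrrN expr1n expr0n addr0
  mul1r. Qed.

Lemma sqnormB f g : sqnorm (f - g) = sqnorm f + sqnorm g - 2 * complex.Re (dot
  f g).
Proof. by rewrite sqnormD sqnormN -scaleN1r dotZr; case: (dot f g) => ? ? /=;
  ring. Qed.

Lemma sqnorm0 : sqnorm (0 : H) = 0.
Proof. by rewrite -(scale0r 0) sqnormZ /abs2 /= expr0n addr0 mul0r. Qed.

Lemma sqnorm_eq0 f : sqnorm f = 0 -> f = 0.
Proof.
move=> f0; have c0 g n : sqnorm g = 0 -> coef g n = 0.
  move=> g0; have := sqnorm_ge g n.+1; rewrite g0 big_nat_recr //= => le.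
  have a0 k : 0 <= abs2 (coef g k) * coef_weight R k by rewrite mulr_ge0
    ?abs2_ge0 // ltW // coef_weight_gt0.
  have : abs2 (coef g n) * coef_weight R n <= 0.
    by apply: le_trans le; rewrite lerDr sumr_ge0.
  rewrite pmulr_lle0 ?coef_weight_gt0 // -normc_sq => le0; apply: eq0_normc;
    apply/eqP.
  by rewrite -sqrf_eq0 eq_le le0 sqr_ge0.
by apply: coef_inj; apply/funext => n; rewrite !c0 // sqnorm0.
Qed.

Lemma cauchy_schwarz f g : normc (dot f g) ^+ 2 <= sqnorm f * sqnorm g.
Proof.
have [g0|g0] := eqVneq (sqnorm g) 0.
  by rewrite (sqnorm_eq0 g0) dot_conj dot0l rmorph0 normc0 expr0n sqnorm0 mulr0.
have gp : 0 < sqnorm g by rewrite lt0r g0 sqnorm_ge0.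
have := sqnorm_ge0 ((sqnorm g)%:C *: f - dot f g *: g).
rewrite sqnormB !sqnormZ dotZl dotZr.
have -> : complex.Re ((sqnorm g)%:C * (conjc (dot f g) * dot f g)) =
   sqnorm g * abs2 (dot f g).
  by rewrite Re_realM; congr (_ * _); case: (dot f g) => x y; rewrite /abs2 /=;
    ring.
have -> : abs2 (sqnorm g)%:C = sqnorm g * sqnorm g by rewrite /abs2 /= expr0n
  addr0 expr2.
move=> H0; rewrite normc_sq -(ler_pM2l gp) -subr_ge0; move: H0; congr (0 <= _).
by ring.
Qed.

Lemma hilbert_norm_sq f : hilbert_norm dot f ^+ 2 = sqnorm f.
Proof. by rewrite sqr_sqrtr // sqnorm_ge0. Qed.

Lemma bounded_operatorP (T : H -> H) : bounded_operators dot T <->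
  linear T /\ exists c : R, forall f, sqnorm (T f) <= c * sqnorm f.
Proof.
split=> -[lT [c Tc]]; split => //.
  exists (c ^+ 2) => f; rewrite -!hilbert_norm_sq -exprMn lerXn2r ?nnegrE
    ?sqrtr_ge0 //.
  by apply: le_trans (Tc f); exact: sqrtr_ge0.
exists (Num.sqrt `|c|) => f; rewrite /hilbert_norm -sqrtrM // ler_wsqrtr //.
by apply: le_trans (Tc f) _; rewrite ler_wpM2r ?sqnorm_ge0 // ler_norm.
Qed.

Lemma exists_delta n : exists f : H, coef f = fun m => (m == n)%:R.
Proof.
apply: (@exists_bergman _ _ (coef_weight R n)) => N.
apply: (@le_trans _ _ (\sum_(0 <= m < N) if m == n then coef_weight R n else
  0)).
  apply: ler_sum => m _; case: eqP => [->|_].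
    by rewrite /abs2 /= expr1n expr0n addr0 mul1r.
  by rewrite /abs2 /= expr0n addr0 mul0r.
rewrite -big_mkcond /=; case: (ltnP n N) => nN.
  by rewrite big_nat1_eq nN.
by rewrite big_nat1_eq ltnNge nN /= ltW // coef_weight_gt0.
Qed.

(** The monomial [z ^+ n] on the disk, not normalized: its squared norm is [coef_weight R n]. *)
Definition basis_vector n : H := projT1 (cid (exists_delta n)).

Local Notation e := basis_vector.

Lemma coef_e n m : coef (e n) m = (m == n)%:R.
Proof. by rewrite (projT2 (cid (exists_delta n))). Qed.

Lemma dot_e f n : dot f (e n) = (coef_weight R n)%:C * coef f n.
Proof.
apply: ccvg_unique (bergman_dot_csum _ _) _.
have E N : \sum_(0 <= m < N.+1 + n) (coef_weight R m)%:C * (coef f m * (coef (e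
  n) m)^*) =
    (coef_weight R n)%:C * coef f n.
  have nN : n \in index_iota 0 (N.+1 + n) by rewrite mem_index_iota addSn ltnS
    leq_addl.
  rewrite (bigD1_seq n nN (iota_uniq _ _)) /= big1 ?addr0.
  - by rewrite coef_e eqxx rmorph1 mulr1.
  - by move=> m mn; rewrite coef_e (negbTE mn) rmorph0 !mulr0.
rewrite /ccvg; apply/cvgrPdist_lt => eps eps0; exists n.+1 => // N /= nN.
have -> : N = ((N - n.+1).+1 + n)%N by lia.
by rewrite E subrr normc0 subr0 normr0.
Qed.

Lemma coef0 n : coef (0 : H) n = 0.
Proof.
by have := coef_lin (-1) 0 (0 : H) n; rewrite scaler0 addr0 mulN1r addNr.
Qed.

Lemma coefZ c f n : coef (c *: f) n = c * coef f n.
Proof. by have := coef_lin c f 0 n; rewrite addr0 coef0 addr0. Qed.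

Lemma coefD f g n : coef (f + g) n = coef f n + coef g n.
Proof. by have := coef_lin 1 f g n; rewrite scale1r mul1r. Qed.

Lemma coefB f g n : coef (f - g) n = coef f n - coef g n.
Proof. by rewrite coefD -scaleN1r coefZ mulN1r. Qed.

Lemma coef_sum I (r : seq I) (F : I -> H) n :
  coef (\sum_(i <- r) F i) n = \sum_(i <- r) coef (F i) n.
Proof.
by elim: r => [|i r IH]; rewrite ?big_nil ?coef0 // !big_cons coefD IH.
Qed.

Definition proj N f : H := \sum_(0 <= n < N) coef f n *: e n.

Lemma coef_proj N f m : coef (proj N f) m = if (m < N)%N then coef f m else 0.
Proof.
rewrite coef_sum; case: (ltnP m N) => mN.
  rewrite (bigD1_seq m) ?mem_index_iota ?iota_uniq //= big1 ?addr0.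
    by rewrite coefZ coef_e eqxx mulr1.
  by move=> k km; rewrite coefZ coef_e eq_sym (negbTE km) mulr0.
rewrite big_nat_cond big1 // => k; rewrite andbT => /andP[_ kN].
by rewrite coefZ coef_e gtn_eqF ?mulr0 // (leq_trans kN).
Qed.

Lemma proj_cvg f : (fun N => sqnorm (f - proj N f)) @ \oo --> (0 : R).
Proof.
have E N : sqnorm (f - proj N f) = sqnorm f - \sum_(0 <= n < N) abs2 (coef f n)
  * coef_weight R n.
  have c1 : series (fun n => abs2 (coef (f - proj N f) n) * coef_weight R n) @
    \oo -->
      sqnorm (f - proj N f) by exact: sqnorm_cvg.
  have c2 : (fun M => series (fun n => abs2 (coef f n) * coef_weight R n) M -
      \sum_(0 <= n < N) abs2 (coef f n) * coef_weight R n) @ \oo -->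
      sqnorm f - \sum_(0 <= n < N) abs2 (coef f n) * coef_weight R n.
    by apply: cvgB; [exact: sqnorm_cvg|exact: cvg_cst].
  apply: cvg_unique c1 _ => //; apply: cvg_trans c2; apply: near_eq_cvg.
  exists N => // M /= NM; rewrite /series /= !(big_cat_nat (leq0n N) NM) /=.
  rewrite addrAC subrr add0r [X in _ = X + _]big_nat_cond [X in _ = X + _]big1
    ?add0r.
    apply: eq_big_nat => n /andP[Nn _].
    by rewrite coefB coef_proj ltnNge Nn subr0.
  move=> n; rewrite andbT => /andP[_ nN]; rewrite coefB coef_proj nN subrr.
  by rewrite /abs2 /= expr0n addr0 mul0r.
under eq_cvg do rewrite E.
have : (fun N => sqnorm f - series (fun n =>
  abs2 (coef f n) * coef_weight R n) N) @ \oo -->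
    sqnorm f - sqnorm f.
  by apply: cvgB; [exact: cvg_cst|exact: sqnorm_cvg].
by rewrite subrr.
Qed.

End bergman_hilbert.

(** * The isometries and their adjoints *)

Section block_sums.

(** Indices counted from 1, with value 0 at index 0. Read at the quotient of an index by [k], it
    gives 0 below [k], before the first block. *)
Definition shifted (V : nmodType) (a : nat -> V) (m : nat) : V :=
  if m is m'.+1 then a m' else 0.

Lemma sum_shifted (V : nmodType) (a : nat -> V) N :
  \sum_(0 <= m < N.+1) shifted a m = \sum_(0 <= n < N) a n.
Proof. by rewrite big_nat_recl //= add0r. Qed.

Lemma block_sum (V : nmodType) (G : nat -> V) k M :
  \sum_(0 <= m < k * M) G m = \sum_(0 <= q < M) \sum_(0 <= j < k) G (k * q +
    j)%N.
Proof.
elim: M => [|M IH]; first by rewrite muln0 !big_geq.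
rewrite big_nat_recr //= -IH mulnSr (big_cat_nat (leq0n _) (leq_addr k (k *
  M))) /=.
congr (_ + _); rewrite -{1}[(k * M)%N]add0n big_addn addKn.
by apply: eq_bigr => j _; rewrite addnC.
Qed.

(** Counted from 1, the indices below [k * N.+1] split into the blocks [[k m, k m + k)] for
    [1 <= m <= N], preceded by the indices below [k], where [F] must vanish. *)
Lemma sum_blocks (V : nmodType) (F : nat -> V) k N : (0 < k)%N ->
  (forall n, (n.+1 < k)%N -> F n = 0) ->
  \sum_(0 <= n < (k * N.+1).-1) F n =
  \sum_(0 <= n < N) \sum_(0 <= j < k) F (k * n.+1 + j).-1.
Proof.
move=> k0 F0; rewrite -sum_shifted prednK ?muln_gt0 ?k0 // block_sum
  big_nat_recl //.
rewrite muln0 [X in X + _]big_nat_cond [X in X + _]big1 ?add0r.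
  apply: eq_bigr => n _; apply: eq_bigr => j _.
  by rewrite -[in LHS](@prednK (k * n.+1 + j)) // addn_gt0 muln_gt0 k0.
move=> j; rewrite andbT => /andP[_ jk]; rewrite add0n.
by case: j jk => //= j jk; rewrite F0.
Qed.

Lemma block_index k n j : (j < k)%N -> ((k * n.+1 + j).-1.+1 %/ k = n.+1)%N.
Proof.
move=> jk; have k0 : (0 < k)%N by apply: leq_ltn_trans jk.
by rewrite prednK ?addn_gt0 ?muln_gt0 ?k0 // mulnC divnMDl // divn_small //
  addn0.
Qed.

End block_sums.

Section dilation_operators.
Variable R : realType.
Local Notation H := (bergman R).
Local Notation dot := (@bergman_dot R).
Implicit Types (f g : H) (a b : nat -> R[i]).

Lemma sqnorm_le f B : (forall N, \sum_(0 <= n < N) abs2 (coef f n) *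
  coef_weight R n <= B) ->
  sqnorm f <= B.
Proof.
move=> HB; have H := @sqnorm_cvg R f; apply: (cvgr_to_le H).
by apply: nearW => N; exact: HB.
Qed.

Definition sqrt_nat k : R := Num.sqrt k%:R.

Lemma sqrt_nat_sq k : sqrt_nat k * sqrt_nat k = k%:R.
Proof. by rewrite -expr2 sqr_sqrtr // ler0n. Qed.

(** Since [(1 - z^k) / (1 - z)] is [1 + z + ... + z^(k-1)], multiplying it by [z^(k-1) f(z^k)]
    repeats each coefficient of [f] along a block of length [k]. *)
Definition tcoef k a n : R[i] := (sqrt_nat k)%:C * shifted a (n.+1 %/ k).

(** Dictated by adjointness: in the inner product with [opT k f], collect the block over which
    [coef f n] is repeated and divide by the weight of [n]. *)
Definition scoef k b n : R[i] := (sqrt_nat k)%:C *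
  \sum_(0 <= j < k) (coef_weight R (k * n.+1 + j).-1 / coef_weight R n)%:C * b
    (k * n.+1 + j).-1.

Lemma tcoef_block k a n j : (j < k)%N ->
  tcoef k a (k * n.+1 + j).-1 = (sqrt_nat k)%:C * a n.
Proof. by move=> jk; rewrite /tcoef block_index. Qed.

Lemma tcoef_small k a n : (n.+1 < k)%N -> tcoef k a n = 0.
Proof. by move=> nk; rewrite /tcoef divn_small //= mulr0. Qed.

Lemma coef_weight_telescope m k : (0 < m)%N ->
  \sum_(0 <= j < k) coef_weight R (m + j).-1 = kappa R * (m%:R^-1 - (m +
    k)%:R^-1).
Proof.
move=> m0; elim: k => [|k IH]; first by rewrite big_geq // addn0 subrr mulr0.
have mk : (0 < m + k)%N by rewrite addn_gt0 m0.
rewrite big_nat_recr //= IH coef_weightE prednK // addnS -mulrDr; congr (_ * _).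
have x0 : (m + k)%:R != 0 :> R by rewrite pnatr_eq0 -lt0n.
have -> : (m + k).+1%:R = (m + k)%:R + 1 :> R by rewrite -natr1.
have x1 : (m + k)%:R + 1 != 0 :> R by rewrite natr1 pnatr_eq0.
have m1 : m%:R != 0 :> R by rewrite pnatr_eq0 -lt0n.
by move: ((m + k)%:R : R) x0 x1 => y x0 x1; field; rewrite m1 x0 x1.
Qed.

Lemma coef_weight_block k n : (0 < k)%N ->
  k%:R * \sum_(0 <= j < k) coef_weight R (k * n.+1 + j).-1 = coef_weight R n.
Proof.
move=> k0; rewrite coef_weight_telescope ?muln_gt0 ?k0 // -mulnSr !natrM
  coef_weightE.
have k1 : k%:R != 0 :> R by rewrite pnatr_eq0 -lt0n.
have -> : n.+2%:R = n.+1%:R + 1 :> R by rewrite -natr1.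
by field; rewrite k1 nat1r natr1 !pnatr_eq0.
Qed.

Lemma abs2_realM (x : R) (z : R[i]) : abs2 (x%:C * z) = x ^+ 2 * abs2 z.
Proof. by rewrite abs2M; congr (_ * _); rewrite /abs2 /= expr0n addr0. Qed.

Lemma abs2_0 : abs2 (0 : R[i]) = 0.
Proof. by rewrite /abs2 /= expr0n addr0. Qed.

Lemma partial_sum_le (F : nat -> R) N M : (forall n, 0 <= F n) -> (N <= M)%N ->
  \sum_(0 <= n < N) F n <= \sum_(0 <= n < M) F n.
Proof. by move=> F0 NM; rewrite (big_cat_nat (leq0n _) NM) /= lerDl sumr_ge0.
  Qed.

Lemma leq_block k N : (0 < k)%N -> (N <= (k * N.+1).-1)%N.
Proof. by move=> k0; rewrite -ltnS prednK ?muln_gt0 ?k0 // leq_pmull. Qed.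

Lemma tcoef_bound k f N :
  \sum_(0 <= n < N) abs2 (tcoef k (coef f) n) * coef_weight R n <= sqnorm f.
Proof.
have [->|k0] := posnP k.
  rewrite big1 ?sqnorm_ge0 // => n _.
  by rewrite /tcoef divn0 /= mulr0 abs2_0 mul0r.
apply: (@le_trans _ _
    (\sum_(0 <= n < (k * N.+1).-1) abs2 (tcoef k (coef f) n) * coef_weight R
      n)).
  apply: partial_sum_le; last exact: leq_block.
  by move=> n; rewrite mulr_ge0 ?abs2_ge0 // ltW // coef_weight_gt0.
rewrite sum_blocks //; last by move=> n nk; rewrite tcoef_small // abs2_0 mul0r.
apply: le_trans (sqnorm_ge f N); apply: ler_sum => n _.
rewrite -(coef_weight_block n k0) mulr_sumr mulr_sumr le_eqVlt; apply/orP;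
  left; apply/eqP.
apply: eq_big_nat => j /andP[_ jk].
by rewrite tcoef_block // abs2_realM expr2 sqrt_nat_sq mulrAC mulrCA mulrA
  mulrC mulrA.
Qed.

Lemma exists_T k f : exists g : H, coef g = tcoef k (coef f).
Proof. by apply: (exists_bergman (B := sqnorm f)) => N; exact: tcoef_bound. Qed.

Definition opT k f : H := projT1 (cid (exists_T k f)).

Lemma coef_T k f : coef (opT k f) = tcoef k (coef f).
Proof. exact: projT2 (cid (exists_T k f)). Qed.

(* Jensen's inequality, from the variance [\sum_j l_j (x_j - m)^2 >= 0]. *)
Lemma weighted_mean_sq (n : nat) (l x : nat -> R) : (forall j, 0 <= l j) ->
  \sum_(0 <= j < n) l j <= 1 ->
  (\sum_(0 <= j < n) l j * x j) ^+ 2 <= \sum_(0 <= j < n) l j * x j ^+ 2.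
Proof.
move=> l0 l1; set m := \sum_(0 <= j < n) l j * x j.
have : 0 <= \sum_(0 <= j < n) l j * (x j - m) ^+ 2.
  by apply: sumr_ge0 => j _; rewrite mulr_ge0 // sqr_ge0.
have -> : \sum_(0 <= j < n) l j * (x j - m) ^+ 2 =
    \sum_(0 <= j < n) l j * x j ^+ 2 - 2 * m * m + (\sum_(0 <= j < n) l j) * m
      ^+ 2.
  have -> : 2 * m * m = \sum_(0 <= j < n) 2 * m * (l j * x j) by rewrite
    -mulr_sumr.
  rewrite mulr_suml -sumrB -big_split /=.
  by apply: eq_bigr => j _; ring.
have := ler_wpM2r (sqr_ge0 m) l1; rewrite mul1r !expr2; lra.
Qed.

(** The bound cannot be borrowed from [opT] by duality, since it is what makes [opS] land in the
    space. Up to the factor [(sqrt_nat k)^-1], [scoef] is a mean over a block with weights [l j],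
    whose total is controlled by [coef_weight_block], and Jensen's inequality applies. *)
Lemma scoef_bound k f N :
  \sum_(0 <= n < N) abs2 (scoef k (coef f) n) * coef_weight R n <= sqnorm f.
Proof.
have [->|k0] := posnP k.
  rewrite big1 ?sqnorm_ge0 // => n _.
  by rewrite /scoef big_geq // mulr0 abs2_0 mul0r.
(* [F] discards the initial indices, which belong to no block. *)
set b := coef f; pose F n := if (n.+1 < k)%N then 0 else abs2 (b n) *
  coef_weight R n.
have bw n : 0 <= abs2 (b n) * coef_weight R n by rewrite mulr_ge0 ?abs2_ge0 //
  ltW // coef_weight_gt0.
apply: (@le_trans _ _ (\sum_(0 <= n < (k * N.+1).-1) F n)); last first.
  apply: le_trans (sqnorm_ge f (k * N.+1).-1); apply: ler_sum => n _.
  by rewrite /F; case: ifP.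
rewrite sum_blocks //; last by move=> n nk; rewrite /F nk.
apply: ler_sum => n _.
have wn := coef_weight_gt0 R n.
pose x j := b (k * n.+1 + j).-1.
pose l j := k%:R * (coef_weight R (k * n.+1 + j).-1 / coef_weight R n).
have l0 j : 0 <= l j by rewrite mulr_ge0 // divr_ge0 ?ltW // coef_weight_gt0.
have l1 : \sum_(0 <= j < k) l j <= 1.
  by rewrite -mulr_sumr -mulr_suml mulrA coef_weight_block // divff // gt_eqF.
have rk0 : sqrt_nat k != 0 by rewrite gt_eqF // sqrtr_gt0 ltr0n.
have kk : k%:R != 0 :> R by rewrite pnatr_eq0 -lt0n.
have -> : scoef k b n = (sqrt_nat k)^-1%:C * \sum_(0 <= j < k) (l j)%:C * x j.
  rewrite /scoef !mulr_sumr; apply: eq_bigr => j _; rewrite !mulrA -!rmorphM /=.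
  by congr (_%:C * _); rewrite /l -(sqrt_nat_sq k); field; rewrite rk0 gt_eqF.
rewrite abs2_realM.
have J : abs2 (\sum_(0 <= j < k) (l j)%:C * x j) <= \sum_(0 <= j < k) l j *
  abs2 (x j).
  rewrite /abs2 Re_sum Im_sum; under eq_bigr do rewrite Re_realM.
  under [X in _ + X ^+ 2 <= _]eq_bigr do rewrite Im_realM.
  under [leRHS]eq_bigr do rewrite mulrDr.
  by rewrite big_split lerD //; apply: weighted_mean_sq.
rewrite -mulrA mulrC mulrAC.
apply: le_trans (ler_wpM2r _ (ler_wpM2r _ J)) _; rewrite ?sqr_ge0 ?(ltW wn) //.
rewrite !mulr_suml; apply: ler_sum_nat => j /andP[_ jk].
rewrite /F ltnNge -(divn_gt0 _ k0) block_index //= /l exprVn expr2 sqrt_nat_sq.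
rewrite le_eqVlt; apply/orP; left; apply/eqP; field.
by rewrite kk gt_eqF.
Qed.

Lemma exists_S k f : exists g : H, coef g = scoef k (coef f).
Proof. by apply: (exists_bergman (B := sqnorm f)) => N; exact: scoef_bound. Qed.

Definition opS k f : H := projT1 (cid (exists_S k f)).

Lemma coef_S k f : coef (opS k f) = scoef k (coef f).
Proof. exact: projT2 (cid (exists_S k f)). Qed.

Lemma sqnorm_T k f : sqnorm (opT k f) <= sqnorm f.
Proof. by apply: sqnorm_le => N; rewrite coef_T; exact: tcoef_bound. Qed.

Lemma sqnorm_S k f : sqnorm (opS k f) <= sqnorm f.
Proof. by apply: sqnorm_le => N; rewrite coef_S; exact: scoef_bound. Qed.

Lemma T_linear k : linear (opT k).
Proof.
move=> c f g; apply: coef_inj; apply/funext => n;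
  rewrite coef_lin !coef_T /tcoef.
case: (n.+1 %/ k)%N => [|m] /=; first by rewrite !mulr0 addr0.
by rewrite coef_lin mulrDr mulrCA.
Qed.

Lemma S_linear k : linear (opS k).
Proof.
move=> c f g; apply: coef_inj; apply/funext => n;
  rewrite coef_lin !coef_S /scoef.
rewrite mulrCA -mulrDr; congr (_ * _); rewrite mulr_sumr -big_split /=.
by apply: eq_bigr => j _; rewrite coef_lin mulrDr mulrCA.
Qed.

Lemma T_bounded k : bounded_operators dot (opT k).
Proof.
apply/bounded_operatorP; split; first exact: T_linear.
by exists 1 => f; rewrite mul1r sqnorm_T.
Qed.

Lemma S_bounded k : bounded_operators dot (opS k).
Proof.
apply/bounded_operatorP; split; first exact: S_linear.
by exists 1 => f; rewrite mul1r sqnorm_S.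
Qed.

Lemma conjE (z : R[i]) : (z^*)%R = conjc z.
Proof. by []. Qed.

Lemma conj_real (x : R) : conjc x%:C = x%:C.
Proof. exact: conjc_real. Qed.

(** Along partial sums that end with a complete block, both sides are the same finite sum. *)
Lemma T_adjoint k : (0 < k)%N -> is_adjoint dot (opT k) (opS k).
Proof.
move=> k0 f g.
have c1 := ccvg_subseq (k := fun N => (k * N.+1).-1) (fun N => leq_block N k0)
  (bergman_dot_csum (opT k f) g).
apply: ccvg_unique c1 _; apply: eq_ccvg (bergman_dot_csum f (opS k g)) => N /=.
rewrite sum_blocks //; last first.
  by move=> n nk; rewrite coef_T tcoef_small // mul0r mulr0.
apply: eq_bigr => n _; rewrite coef_S /scoef.
rewrite conjE conjM conj_real conj_sum !mulr_sumr; apply: eq_big_nat =>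
  j /andP[_ jk].
rewrite coef_T tcoef_block // conjE conjM conj_real; move: (conjc _) => z.
have wn : (coef_weight R n)%:C != 0 by rewrite eq_complex /= gt_eqF //
  coef_weight_gt0.
have -> : (coef_weight R (k * n.+1 + j).-1)%:C =
   (coef_weight R n)%:C * (coef_weight R (k * n.+1 + j).-1 / coef_weight R
     n)%:C.
  by rewrite -rmorphM /= mulrCA divff ?mulr1 // gt_eqF // coef_weight_gt0.
by ring.
Qed.

Lemma val_T k f z : (0 < k)%N -> unit_disk z -> val (opT k f) z = dilation k
  (val f) z.
Proof.
move=> k0 /unit_diskE z1.
have c1 := ccvg_subseq (k := fun N => (k * N.+1).-1) (fun N => leq_block N k0)
  (coefP (opT k f) z1).
apply: ccvg_unique c1 _.
have zk1 : normc (z ^+ k) < 1.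
  by rewrite normcX exprn_ilt1 ?normc_ge0 // -lt0n.
have nz : 1 - z != 0.
  rewrite subr_eq0; apply/eqP => zE; move: z1; rewrite -zE normc1 ltxx //.
have -> : dilation k (val f) z = ((sqrt_nat k)%:C * z ^+ k.-1 * ((1 - z ^+ k) /
  (1 - z))) *
    val f (z ^+ k) by rewrite /dilation /sqrt_nat; ring.
apply: eq_ccvg (ccvgZ _ (coefP f zk1)) => N /=.
rewrite sum_blocks //; last by move=> n nk; rewrite coef_T tcoef_small // mul0r.
rewrite mulr_sumr; apply: eq_bigr => n _.
have geo : (1 - z ^+ k) / (1 - z) = \sum_(0 <= j < k) z ^+ j.
  rewrite big_mkord; apply: (mulIf nz); rewrite mulfVK // mulrC.
  by rewrite -opprB subrX1 -mulNr opprB.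
rewrite geo mulr_sumr mulr_suml; apply: eq_big_nat => j /andP[_ jk].
rewrite coef_T tcoef_block //.
have -> : (k * n.+1 + j).-1 = (k.-1 + k * n + j)%N.
  by rewrite mulnS -{1}(prednK k0) !addSn.
by rewrite !exprD exprM; ring.
Qed.

End dilation_operators.

(** * Weak convergence *)

Section weak_convergence.
Variable R : realType.
Local Notation H := (bergman R).
Local Notation dot := (@bergman_dot R).
Implicit Types (f g v x y : H) (c : R[i]) (S T : H -> H) (M : set (H -> H)).

Lemma normc_dot_le f g : normc (dot f g) <= Num.sqrt (sqnorm f) * Num.sqrt
  (sqnorm g).
Proof.
rewrite -sqrtrM ?sqnorm_ge0 // -(ger0_norm (normc_ge0 _)) -sqrtr_sqr ler_wsqrtr
  //.
exact: cauchy_schwarz.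
Qed.

Lemma cvg_sqrt0 (u : nat -> R) : u @ \oo --> (0 : R) ->
  (fun n => Num.sqrt (u n)) @ \oo --> (0 : R).
Proof.
by move=> H; rewrite -[X in _ --> X](@sqrtr0 R); apply: continuous_cvg H;
  exact: sqrt_continuous.
Qed.

Lemma dot_cvg_left (x : nat -> H) x0 g : (fun n =>
  sqnorm (x n - x0)) @ \oo --> (0 : R) ->
  ccvg (fun n => dot (x n) g) (dot x0 g).
Proof.
move=> H; apply: (ccvg_squeeze
  (e := fun n => Num.sqrt (sqnorm (x n - x0)) * Num.sqrt (sqnorm g))) => [n|].
  by rewrite -dotBl normc_dot_le.
by rewrite -[X in _ --> X](mul0r (Num.sqrt (sqnorm g))); apply: cvgM;
  [exact: cvg_sqrt0|exact: cvg_cst].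
Qed.

Lemma sqnorm_sub_le f g : sqnorm (f - g) <= 2 * sqnorm f + 2 * sqnorm g.
Proof.
have := sqnorm_ge0 (f + g); rewrite sqnormD sqnormB; lra.
Qed.

(** For a bounded sequence it suffices to test against vectors of dense span: [B'] bounds the norm
    of [y n - y0], and [g] is replaced by [proj N g]. *)
Lemma weak_cvg_basis (y : nat -> H) y0 (B : R) : (forall n, sqnorm (y n) <= B)
  ->
  (forall m, ccvg (fun n => dot (y n) (basis_vector R m)) (dot y0 (basis_vector
    R m))) ->
  forall g, ccvg (fun n => dot (y n) g) (dot y0 g).
Proof.
move=> yB ye g; pose B' := Num.sqrt (2 * B + 2 * sqnorm y0).
have z0 n : Num.sqrt (sqnorm (y n - y0)) <= B'.
  rewrite ler_wsqrtr // (le_trans (sqnorm_sub_le _ _)) // lerD2r.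
  by rewrite ler_pM2l // yB.
have B'0 : 0 <= B' by exact: sqrtr_ge0.
have cg : (fun N => B' * Num.sqrt (sqnorm (g - proj N g))) @ \oo --> (0 : R).
  rewrite -[X in _ --> X](mulr0 B'); apply: cvgM; first exact: cvg_cst.
  by apply: cvg_sqrt0; exact: proj_cvg.
apply/cvgrPdist_lt => eps eps0; have e2 : 0 < eps / 2 by rewrite divr_gt0.
have [N gN] : exists N, B' * Num.sqrt (sqnorm (g - proj N g)) < eps / 2.
  have /cvgrPdist_lt /(_ _ e2) [N _ /(_ N (leqnn N))] := cg.
  by rewrite /= sub0r normrN ger0_norm ?mulr_ge0 ?sqrtr_ge0 //; exists N.
have cp : ccvg (fun n => dot (y n) (proj N g)) (dot y0 (proj N g)).
  rewrite dot_sumr; under [X in ccvg X]eq_fun do rewrite dot_sumr.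
  apply: ccvg_sum => m; rewrite dotZr;
    under [X in ccvg X]eq_fun do rewrite dotZr.
  exact: ccvgZ.
have /cvgrPdist_lt /(_ _ e2) := cp; apply: filterS => n.
rewrite !sub0r !normrN !ger0_norm ?normc_ge0 // -dotBl => yN.
have -> : dot (y n) g - dot y0 g = dot (y n - y0) (proj N g) + dot (y n - y0)
  (g - proj N g).
  by rewrite -dotDr (addrC (proj N g)) subrK dotBl.
apply: le_lt_trans (le_normcD _ _) _; rewrite [eps]splitr ltrD //.
apply: le_lt_trans (normc_dot_le _ _) _; apply: le_lt_trans gN.
by rewrite ler_wpM2r ?sqrtr_ge0.
Qed.

Lemma initial_cvg (X : choiceType) (Y : topologicalType) (F : X -> Y) (u : nat
  -> X) s :
  (F \o u) @ \oo --> F s -> u @ \oo --> (s : initial_topology F).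
Proof.
move=> cF A /= [_ [[B Bop <-] Bs sBA]].
have : nbhs (F s) B by apply: open_nbhs_nbhs.
by move=> /cF; apply: (@filterS _ \oo _ ((F \o u) @^-1` B)) => n Bn; exact: sBA.
Qed.

(** The form in which closure in the weak operator topology is used: limits of sequences tested on
    all pairs of vectors. *)
Lemma wot_closed M (u : nat -> H -> H) T : von_neumann_algebra dot M ->
  (forall n, M (u n)) -> bounded_operators dot T ->
  (forall f g, ccvg (fun n => dot (u n f) g) (dot (T f) g)) -> M T.
Proof.
move=> [_ _ _ _ Mcl] Mu bT cu; apply: Mcl; split => //.
have cw : u @ \oo --> (T : weak_operator_topology dot).
  apply: initial_cvg; apply/cvg_sup => -[f g]; apply: initial_cvg.
  by apply/ccvgP; exact: cu.
move=> A /cw [N _ HN]; exists (u N); split => //.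
by apply: HN => /=.
Qed.

End weak_convergence.

(** * The generated von Neumann algebra *)

Section generated_algebra.
Variable R : realType.
Local Notation H := (bergman R).
Local Notation dot := (@bergman_dot R).
Local Notation e := (basis_vector R).
Local Notation w := (coef_weight R).
Implicit Types (f g v x y : H) (c : R[i]) (S T X Y : H -> H).

(** Positivity makes every [k] contribute to the loss of energy, and a total of at most 1 is what
    [sqnorm_convex] asks for. *)
Definition cwt (k : nat) : R := 2^-1 ^+ k.+1.

Lemma cwt_gt0 k : 0 < cwt k.
Proof. by rewrite exprn_gt0 // invr_gt0. Qed.

Lemma cwt_sum n : \sum_(0 <= k < n) cwt k <= 1.
Proof.
suff -> : \sum_(0 <= k < n) cwt k = 1 - 2^-1 ^+ n.
  by rewrite gerBl exprn_ge0 // invr_ge0.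
elim: n => [|n IH]; first by rewrite big_geq // expr0 subrr.
by rewrite big_nat_recr //= IH /cwt exprS; field.
Qed.

Lemma sqnorm_convex (n : nat) (l : nat -> R) (x : nat -> H) : (forall j, 0 <= l
  j) ->
  \sum_(0 <= j < n) l j <= 1 ->
  sqnorm (\sum_(0 <= j < n) (l j)%:C *: x j) <= \sum_(0 <= j < n) l j * sqnorm
    (x j).
Proof.
move=> l0 l1; set m := \sum_(0 <= j < n) (l j)%:C *: x j.
have : 0 <= \sum_(0 <= j < n) l j * sqnorm (x j - m).
  by apply: sumr_ge0 => j _; rewrite mulr_ge0 // sqnorm_ge0.
have -> : \sum_(0 <= j < n) l j * sqnorm (x j - m) =
    \sum_(0 <= j < n) l j * sqnorm (x j) - 2 * sqnorm m +
    (\sum_(0 <= j < n) l j) * sqnorm m.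
  have E : sqnorm m = \sum_(0 <= j < n) l j * complex.Re (dot (x j) m).
    rewrite {1}/sqnorm {1}/m dot_suml Re_sum; apply: eq_bigr => j _.
    by rewrite dotZl Re_realM.
  have -> : 2 * sqnorm m = \sum_(0 <= j < n) 2 * (l j * complex.Re (dot (x j)
    m)).
    by rewrite -mulr_sumr -E.
  rewrite mulr_suml -sumrB -big_split.
  apply: eq_bigr => j _; rewrite sqnormB -[RHS]/(_ + _); ring.
have := ler_wpM2r (sqnorm_ge0 m) l1; rewrite mul1r; lra.
Qed.

(** Finitely many isometries enter at stage [n], so the result stays in the algebra; the index [k]
    takes part from stage [k.+1] on. *)
Definition damp n y : H :=
  y - \sum_(0 <= k < n) (cwt k)%:C *: opT k.+2 (opS k.+2 y).

Fixpoint damped n y : H := if n is n'.+1 then damp n' (damped n' y) else y.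

Lemma T_adjointr k f g : (0 < k)%N -> dot f (opT k g) = dot (opS k f) g.
Proof. by move=> k0; rewrite dot_conj T_adjoint // -dot_conj. Qed.

(** Adjointness gives [s] as the inner product of [y] with the subtracted average, and convexity
    bounds the squared norm of that average by [s]. Hence the balance [- 2 * s + s]. *)
Lemma damp_energy n y : sqnorm (damp n y) <=
  sqnorm y - \sum_(0 <= k < n) cwt k * sqnorm (opS k.+2 y).
Proof.
rewrite /damp sqnormB dot_sumr Re_sum.
set s := \sum_(0 <= k < n) cwt k * sqnorm (opS k.+2 y).
have -> : \sum_(0 <= k < n) complex.Re (dot y ((cwt k)%:C *: opT k.+2 (opS k.+2
  y))) = s.
  by apply: eq_bigr => k _; rewrite dotZr conj_real Re_realM T_adjointr.
have : sqnorm (\sum_(0 <= k < n) (cwt k)%:C *: opT k.+2 (opS k.+2 y)) <= s.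
  apply: le_trans (sqnorm_convex _ _ (cwt_sum n)) _.
    by move=> k; exact: ltW (cwt_gt0 k).
  by apply: ler_sum => k _; rewrite ler_wpM2l ?sqnorm_T // ltW // cwt_gt0.
lra.
Qed.

Lemma damped_decr n y : sqnorm (damped n.+1 y) <= sqnorm (damped n y).
Proof.
apply: le_trans (damp_energy n _) _; rewrite gerBl sumr_ge0 // => k _.
by rewrite mulr_ge0 ?sqnorm_ge0 // ltW // cwt_gt0.
Qed.

Lemma damped_le n y : sqnorm (damped n y) <= sqnorm y.
Proof. by elim: n => // n IH; apply: le_trans (damped_decr n y) IH. Qed.

Lemma damped_S_cvg k y :
  (fun n => sqnorm (opS k.+2 (damped n y))) @ \oo --> (0 : R).
Proof.
pose u n := sqnorm (damped n y).
have cu : cvgn u.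
  apply: nonincreasing_is_cvgn; first by apply/nonincreasing_seqP => n;
    exact: damped_decr.
  by exists 0 => _ [n _ <-]; exact: sqnorm_ge0.
have cd : (fun n => (cwt k)^-1 * (u n - u n.+1)) @ \oo --> (0 : R).
  rewrite -[X in _ --> X](mulr0 (cwt k)^-1); apply: cvgM; first exact: cvg_cst.
  rewrite -[X in _ --> X](subrr (limn u)); apply: cvgB => //.
  by rewrite (cvg_shiftS u).
apply: squeeze_cvgr (@cvg_cst _ _ _ _ _) cd.
(* The term of index [k] is present in [damp n] only when [n > k]. *)
exists k.+1 => // n /= kn;
  rewrite sqnorm_ge0 /= -ler_pdivrMl ?invr_gt0 ?cwt_gt0 // invrK.
have := damp_energy n (damped n y).
have : cwt k * sqnorm (opS k.+2 (damped n y)) <=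
    \sum_(0 <= j < n) cwt j * sqnorm (opS j.+2 (damped n y)).
  rewrite (bigD1_seq k) ?mem_index_iota ?iota_uniq //= lerDl sumr_ge0 // => j _.
  by rewrite mulr_ge0 ?sqnorm_ge0 // ltW // cwt_gt0.
by rewrite /u /=; lra.
Qed.

(** Counted from 1, the constants sit at index 1, which lies before the first block when the block
    length is at least 2. *)
Lemma S_e0 k : opS k.+2 (e 0) = 0.
Proof.
apply: coef_inj; apply/funext => n; rewrite coef_S coef0 /scoef.
rewrite big_nat_cond big1 ?mulr0 // => j _; rewrite coef_e.
by rewrite mulnS !addSn mulr0.
Qed.

Lemma damped_e0 n y : dot (damped n y) (e 0) = dot y (e 0).
Proof.
elim: n => // n IH; rewrite /= /damp dotBl IH dot_suml big1 ?subr0 // => k _.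
by rewrite dotZl T_adjoint // S_e0 dot_conj dot0l rmorph0 mulr0.
Qed.

(* As [z^(p-1)] is the indicator of the index [p] (counted from 1), and [T_k]
   maps indicators to multiples of indicators of unions of blocks [kn, kn+k),
   [{p}] is [[p, p(p+1))] minus [[p+1, p(p+1))]. *)
Lemma e_blocks p : (1 < p)%N ->
  e p.-1 = (sqrt_nat R p)^-1%:C *: opT p (\sum_(0 <= n < p) e n) -
           (sqrt_nat R p.+1)^-1%:C *: opT p.+1 (\sum_(0 <= n < p.-1) e n).
Proof.
move=> p1; have p0 : (0 < p)%N by exact: ltn_trans p1.
apply: coef_inj; apply/funext => i; rewrite coefB !coefZ !coef_T /tcoef.
have r0 k : (0 < k)%N -> (sqrt_nat R k)^-1%:C * (sqrt_nat R k)%:C = 1.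
  by move=> k0; rewrite -rmorphM /= mulVf ?rmorph1 // gt_eqF // sqrtr_gt0 ltr0n.
have ind N q : shifted (coef (\sum_(0 <= n < N) e n)) q = ((0 < q <= N)%N)%:R.
  case: q => // q /=; rewrite coef_sum; case: (ltnP q N) => qN.
    rewrite (bigD1_seq q) ?mem_index_iota ?iota_uniq //= coef_e eqxx big1
      ?addr0 //.
    by move=> m mq; rewrite coef_e eq_sym (negbTE mq).
  rewrite big_nat_cond big1 // => m; rewrite andbT => /andP[_ mN].
  by rewrite coef_e gtn_eqF // (leq_trans mN).
rewrite !mulrA r0 // r0 // !mul1r.
rewrite !ind coef_e !divn_gt0 //.
have -> : (i.+1 %/ p <= p)%N = (i.+1 < p * p.+1)%N.
  by have := ltn_divLR i.+1 p.+1 p0; rewrite ltnS mulnC.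
have -> : (i.+1 %/ p.+1 <= p.-1)%N = (i.+1 < p * p.+1)%N.
  have le_pred q : (q <= p.-1)%N = (q < p)%N by rewrite -ltnS prednK.
  by rewrite le_pred ltn_divLR.
have pp : (p < p * p.+1)%N by nia.
have -> : (i == p.-1) = (i.+1 == p) by rewrite -eqSS prednK.
case: (ltngtP i.+1 p) => [ip|ip|->]; rewrite ?subrr ?pp ?ltnn //=.
by rewrite subr0.
Qed.

Lemma damped_cvg_e y m : (0 < m)%N -> ccvg (fun n => dot (damped n y) (e m)) 0.
Proof.
move=> m0; have -> : e m = e m.+1.-1 by [].
have key (k : nat) x : ccvg (fun n => dot (damped n y) (opT k.+2 x)) 0.
  apply: eq_ccvg (_ : ccvg (fun n => dot (opS k.+2 (damped n y)) x) 0) => [n|].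
    by rewrite T_adjointr.
  rewrite -[X in ccvg _ X](dot0l x); apply: dot_cvg_left.
  by under eq_cvg do rewrite subr0; exact: damped_S_cvg.
rewrite e_blocks //; case: m m0 => // k _.
have := ccvgB (ccvgZ (conjc ((sqrt_nat R k.+2)^-1%:C)) (key k (\sum_(0 <= n <
  k.+2) e n)))
  (ccvgZ (conjc ((sqrt_nat R k.+3)^-1%:C)) (key k.+1 (\sum_(0 <= n < k.+1) e
    n))).
by rewrite !mulr0 subrr; apply: eq_ccvg => n; rewrite dotBr !dotZr.
Qed.

Definition constant_part f : H := coef f 0 *: e 0.

Lemma rank_one_bounded n v : bounded_operators dot (fun f => coef f n *: v).
Proof.
apply/bounded_operatorP; split.
  by move=> c f g; rewrite coef_lin scalerDl scalerA.
exists ((w n)^-1 * sqnorm v) => f;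
  rewrite sqnormZ mulrAC ler_wpM2r ?sqnorm_ge0 //.
rewrite mulrC ler_pdivlMr ?coef_weight_gt0 //;
  apply: le_trans (sqnorm_ge f n.+1).
rewrite big_nat_recr //= lerDr sumr_ge0 // => k _.
by rewrite mulr_ge0 ?abs2_ge0 // ltW // coef_weight_gt0.
Qed.

Lemma damped_weak_cvg f g : ccvg (fun n =>
  dot (damped n f) g) (dot (constant_part f) g).
Proof.
apply: (weak_cvg_basis (fun n => damped_le n f)) => -[|m].
  apply: eq_ccvg (ccvg_cst _) => n /=;
    rewrite damped_e0 /constant_part dotZl !dot_e coef_e.
  by rewrite eqxx mulr1 mulrC.
rewrite /constant_part dotZl dot_e coef_e /= !mulr0; exact: damped_cvg_e.
Qed.

(** * Operators that belong to every von Neumann algebra containing the isometries *)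

Section algebra.
Variable M : set (H -> H).
Hypothesis vM : von_neumann_algebra dot M.
Hypothesis MT : forall k, (0 < k)%N -> M (opT k).

Lemma alg_bounded T : M T -> bounded_operators dot T.
Proof. by have [b _ _ _ _] := vM; exact: b. Qed.

Lemma alg_lin c S T : M S -> M T -> M (fun f => c *: S f + T f).
Proof. by have [_ [_ l] _ _ _] := vM; exact: l. Qed.

Lemma alg_id : M id.
Proof. by have [_ [i _] _ _ _] := vM. Qed.

Lemma alg_comp S T : M S -> M T -> M (fun f => S (T f)).
Proof. by have [_ _ cp _ _] := vM; exact: cp. Qed.

Lemma alg_0 : M (fun=> 0).
Proof.
have := alg_lin (-1) alg_id alg_id; congr M; apply/funext => f.
by rewrite scaleN1r addNr.
Qed.

Lemma alg_scale c S : M S -> M (fun f => c *: S f).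
Proof.
by move=> MS; have := alg_lin c MS alg_0; congr M; apply/funext => f;
  rewrite addr0.
Qed.

Lemma alg_add S T : M S -> M T -> M (fun f => S f + T f).
Proof.
by move=> MS Mt; have := alg_lin 1 MS Mt; congr M; apply/funext => f;
  rewrite scale1r.
Qed.

Lemma alg_sum (F : nat -> H -> H) n : (forall k, M (F k)) ->
  M (fun f => \sum_(0 <= k < n) F k f).
Proof.
move=> MF; elim: n => [|n IH].
  by have := alg_0; congr M; apply/funext => f; rewrite big_geq.
by have := alg_add IH (MF n); congr M; apply/funext => f; rewrite big_nat_recr.
Qed.

Lemma alg_S k : (0 < k)%N -> M (opS k).
Proof.
move=> k0; have [_ _ _ adj _] := vM.
by apply: adj (MT k0) (S_bounded R k) _; exact: T_adjoint.
Qed.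

Lemma alg_damped n : M (damped n).
Proof.
elim: n => [|n IH]; first exact: alg_id.
have B : M (fun f => \sum_(0 <= k < n) (cwt k)%:C *: opT k.+2 (opS k.+2 f)).
  by apply: alg_sum => k; apply: alg_scale; apply: alg_comp;
    [exact: MT|exact: alg_S].
have D : M (damp n).
  have := alg_lin (-1) B alg_id; congr M; apply/funext => f.
  by rewrite scaleN1r addrC.
by have := alg_comp D IH.
Qed.

Lemma alg_constant_part : M constant_part.
Proof.
apply: (wot_closed vM alg_damped); first exact: rank_one_bounded.
exact: damped_weak_cvg.
Qed.

(** The adjoint [Y] is carried along because rank one operators will be products of some [X'],
    [constant_part] and [Y], while stability under the involution speaks of a given adjoint and does
    not supply one. *)
Definition reached v := exists X Y, [/\ M X, M Y, is_adjoint dot X Y & X (e 0)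
  = v].

Lemma reached_lin c v v' : reached v -> reached v' -> reached (c *: v + v').
Proof.
move=> [X [Y [MX MY XY <-]]] [X' [Y' [MX' MY' XY' <-]]].
exists (fun f => c *: X f + X' f), (fun f => conjc c *: Y f + Y' f).
split => //; [exact: alg_lin|exact: alg_lin|move=> f g].
by rewrite dotDl dotZl dotDr dotZr conjcK XY XY'.
Qed.

Lemma reached_e0 : reached (e 0).
Proof. by exists id, id; split => //; exact: alg_id. Qed.

Lemma reached_0 : reached 0.
Proof.
by have := reached_lin (-1) reached_e0 reached_e0; rewrite scaleN1r addNr.
Qed.

Lemma reached_ST n : reached (opS 2 (opT n.+1 (e 0))).
Proof.
exists (fun f => opS 2 (opT n.+1 f)), (fun f => opS n.+1 (opT 2 f)).
split=> //.
- by apply: alg_comp; [exact: alg_S|exact: MT].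
- by apply: alg_comp; [exact: alg_S|exact: MT].
- by move=> f g; rewrite -T_adjointr // T_adjoint.
Qed.

(** Counted from 1, [opT n.+1 (e 0)] is supported on [[n+1, 2n+2)], and the pair starting at
    [2 * m.+1] lies beyond it. *)
Lemma coef_ST n m : (0 < n)%N -> (n <= m)%N -> coef (opS 2 (opT n.+1 (e 0))) m
  = 0.
Proof.
move=> n0 nm; rewrite coef_S /scoef big_nat_cond big1 ?mulr0 // => j.
rewrite andbT => /andP[_ j2]; rewrite coef_T /tcoef.
have q2 : (2 <= (2 * m.+1 + j).-1.+1 %/ n.+1)%N by rewrite leq_divRL //; lia.
by case: (_ %/ _)%N q2 => // -[|q] // _; rewrite /= coef_e /= !mulr0.
Qed.

(** The pair [2n, 2n+1] lies inside that support, so a positive number is obtained. *)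
Lemma coef_ST_top n : (0 < n)%N -> coef (opS 2 (opT n.+1 (e 0))) n.-1 != 0.
Proof.
move=> n0; rewrite coef_S /scoef.
have rp k : (0 < k)%N -> 0 < sqrt_nat R k by move=> k0; rewrite sqrtr_gt0 ltr0n.
have E j : (j < 2)%N -> coef (opT n.+1 (e 0)) (2 * n.-1.+1 + j).-1 = (sqrt_nat
  R n.+1)%:C.
  move=> j2; rewrite coef_T /tcoef.
  have -> : ((2 * n.-1.+1 + j).-1.+1 %/ n.+1 = 1)%N.
    by apply/eqP; rewrite eqn_leq -ltnS ltn_divLR // leq_divRL //; lia.
  by rewrite /= coef_e mulr1.
rewrite !big_nat_recr //= big_geq // add0r !E // -mulrDl -rmorphD -!rmorphM /=.
rewrite eq_complex /= negb_and gt_eqF //.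
by rewrite mulr_gt0 ?rp // mulr_gt0 ?rp // addr_gt0 // divr_gt0
  ?coef_weight_gt0.
Qed.

Lemma reached_sum (a : nat -> R[i]) (v : nat -> H) n :
  (forall k, (k < n)%N -> reached (v k)) -> reached (\sum_(0 <= k < n) a k *: v
    k).
Proof.
elim: n => [|n IH] vr; first by rewrite big_geq //; exact: reached_0.
rewrite big_nat_recr //= addrC; apply: reached_lin; first exact: vr.
by apply: IH => k kn; apply: vr; exact: ltnW.
Qed.

(** Triangular elimination: [v] has exact degree [n], and its lower monomials are reached by
    induction. *)
Lemma reached_e n : reached (e n).
Proof.
elim/ltn_ind: n => n IH.
pose v := opS 2 (opT n.+2 (e 0));
  have c0 : coef v n != 0 by exact: (@coef_ST_top n.+1).
have vE : v = proj n.+1 v.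
  apply: coef_inj; apply/funext => m; rewrite coef_proj; case: ltnP => // nm.
  by rewrite coef_ST.
have vS : \sum_(0 <= k < n) coef v k *: e k + coef v n *: e n = v.
  by rewrite [RHS]vE /proj big_nat_recr.
have vS' : (coef v n)^-1 *: v = (coef v n)^-1 *: (\sum_(0 <= k < n) coef v k *:
  e k) + e n.
  by rewrite -[e n]scale1r -(mulVf c0) -scalerA -scalerDr vS.
suff -> : e n = (coef v n)^-1 *: v +
    \sum_(0 <= k < n) (- (coef v n)^-1 * coef v k) *: e k.
  by apply: reached_lin; [exact: reached_ST|exact: reached_sum].
rewrite vS' addrAC scaler_sumr -big_split /= big1 ?add0r // => k _.
by rewrite scalerA mulNr scaleNr subrr.
Qed.

(** If [X] reaches [e j] with adjoint [Y], then [dot (Y f) (e 0)] equals [dot f (e j)]; apply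
    [constant_part] and then some [X'] reaching [e i]. The factor [w 0 / w j] corrects for the basis
    not being normalized. *)
Lemma alg_rank_one_e i j : M (fun f => coef f j *: e i).
Proof.
have [X [Y [MX MY XY Xe]]] := reached_e j.
have [X' [Y' [MX' _ _ Xe']]] := reached_e i.
have [lX' _] := alg_bounded MX'.
have := alg_scale ((w 0) / w j)%:C (alg_comp MX' (alg_comp alg_constant_part
  MY)).
congr M; apply/funext => f; rewrite /constant_part.
have XZ c v : X' (c *: v) = c *: X' v.
  have X0 : X' 0 = 0 by have := lX' (-1) 0 0;
    rewrite scaler0 addr0 scaleN1r addNr.
  by have := lX' c v 0; rewrite addr0 X0 addr0.
rewrite XZ Xe' scalerA; congr (_ *: _).
have w0 n : (w n)%:C != 0 by rewrite eq_complex /= gt_eqF // coef_weight_gt0.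
have : dot (Y f) (e 0) = dot f (e j).
  by rewrite dot_conj -XY Xe -dot_conj.
rewrite !dot_e => H1; apply: (mulfI (w0 j)); rewrite -H1 mulrA -rmorphM /=.
by rewrite mulrCA divff ?mulr1 // gt_eqF // coef_weight_gt0.
Qed.

Lemma alg_rank_one j v : M (fun f => coef f j *: v).
Proof.
apply: (wot_closed (u := fun N f => coef f j *: proj N v) vM).
- move=> N; have := alg_sum N (fun n =>
    alg_scale (coef v n) (alg_rank_one_e n j)).
  congr M; apply/funext => f; rewrite /proj scaler_sumr; apply: eq_bigr => n _.
  by rewrite !scalerA mulrC.
- exact: rank_one_bounded.
move=> f g; rewrite dotZl; under [X in ccvg X]eq_fun do rewrite dotZl.
apply: ccvgZ; apply: dot_cvg_left; under eq_cvg do rewrite -opprB sqnormN.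
exact: proj_cvg.
Qed.

(** [T] after [proj N] is a finite sum of rank one operators, and it converges strongly to [T]
    because [T] is bounded. *)
Lemma alg_all T : bounded_operators dot T -> M T.
Proof.
move=> bT; have /bounded_operatorP[lT [c Tc]] := bT.
have T0 : T 0 = 0 by have := lT (-1) 0 0; rewrite scaler0 addr0 scaleN1r addNr.
have TZ a v : T (a *: v) = a *: T v by have := lT a v 0; rewrite addr0 T0 addr0.
have TD u v : T (u + v) = T u + T v by have := lT 1 u v; rewrite !scale1r.
have TB u v : T (u - v) = T u - T v by rewrite TD -scaleN1r TZ scaleN1r.
have Ts f N : T (proj N f) = \sum_(0 <= n < N) coef f n *: T (e n).
  rewrite /proj; elim: N => [|N IH]; first by rewrite !big_geq.
  by rewrite !big_nat_recr //= TD IH TZ.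
apply: (wot_closed (u := fun N f => T (proj N f)) vM) => //.
  move=> N; have := alg_sum N (fun n => alg_rank_one n (T (e n))).
  by congr M; apply/funext => f; rewrite Ts.
move=> f g; apply: dot_cvg_left.
have cz : (fun N => `|c| * sqnorm (f - proj N f)) @ \oo --> (0 : R).
  by rewrite -[X in _ --> X](mulr0 `|c|); apply: cvgM;
    [exact: cvg_cst|exact: proj_cvg].
apply: squeeze_cvgr (@cvg_cst _ _ _ _ _) cz.
apply: nearW => N; rewrite sqnorm_ge0 /= -opprB sqnormN -TB.
by apply: le_trans (Tc _) _; rewrite ler_wpM2r ?sqnorm_ge0 // ler_norm.
Qed.

End algebra.

(** Makes the bounded operators one of the sets that [smallest] intersects, which yields the
    inclusion of the generated algebra in them. *)
Lemma bounded_operators_von_neumann : von_neumann_algebra dot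
  (bounded_operators dot).
Proof.
have bl a S T : bounded_operators dot S -> bounded_operators dot T ->
    bounded_operators dot (fun f => a *: S f + T f).
  move=> /bounded_operatorP[lS [c Sc]] /bounded_operatorP[lT [d Td]].
  apply/bounded_operatorP; split.
    move=> b f g; rewrite (lS b f g) (lT b f g) [in RHS]scalerDr scalerDr
      addrACA.
    by rewrite !scalerA [b * a]mulrC.
  exists (2 * (abs2 a * c) + 2 * d) => f.
  rewrite -[T f]opprK; apply: le_trans (sqnorm_sub_le _ _) _;
    rewrite sqnormN sqnormZ.
  rewrite [leRHS]mulrDl lerD //.
    by rewrite -[leRHS]mulrA ler_pM2l // -mulrA ler_wpM2l ?abs2_ge0.
  by rewrite -[leRHS]mulrA ler_pM2l.
split => //.
- split; last by move=> a S T; exact: bl.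
  by apply/bounded_operatorP; split => //; exists 1 => f; rewrite mul1r.
- move=> S T /bounded_operatorP[lS [c Sc]] /bounded_operatorP[lT [d Td]].
  apply/bounded_operatorP; split; first by move=> a f g /=; rewrite lT lS.
  exists (`|c| * d) => f /=; apply: le_trans (Sc _) _.
  apply: (@le_trans _ _ (`|c| * sqnorm (T f))).
    by rewrite ler_wpM2r ?sqnorm_ge0 // ler_norm.
  by rewrite -mulrA ler_wpM2l.
Qed.

End generated_algebra.

Theorem theorem1p4 (R : realType) :
  exists T : nat -> bergman R -> bergman R,
    (forall k : nat, (0 < k)%N ->
       bounded_operators (@bergman_dot R) (T k) /\
       forall (f : bergman R) (z : R[i]), unit_disk z ->
         val (T k f) z = dilation k (val f) z) /\
    generated_von_neumann_algebra (@bergman_dot R)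
      [set T k | k in [set k : nat | (0 < k)%N]] =
    bounded_operators (@bergman_dot R).
Proof.
exists (@opT R); split.
  by move=> k k0; split=> [|f z z1]; [exact: T_bounded|exact: val_T].
apply/seteqP; split=> [S|S bS M [vM GM]].
  apply; split; first exact: bounded_operators_von_neumann.
  by move=> _ [k _ <-]; exact: T_bounded.
by apply: (alg_all vM) bS => k k0; apply: GM; exists k.
Qed.
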